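(* Let $n\geq 1$ be an integer and let $k,l\in\mathbb{Z}$. Then the contact manifold $\mathcal{A}ob(DT^*S^n,d\lambda^n_{can},\tau_k)$ contact open book embeds in the contact manifold $\mathcal{A}ob(DT^*S^{n+1},d\lambda^{n+1}_{can},\tau_l)$.
   Context: All contact manifolds are closed and co-oriented. **Contact open books.** Let $(V,\partial V,d\alpha)$ be a compact exact symplectic manifold with convex boundary: a collar of $\partial V$ is symplectomorphic to $((-1,0]\times\partial V,d(e^t\alpha|_{\partial V}))$, and the Liouville field $Y$, $i_Yd\alpha=\alpha$, equals $\partial_t$ there (outward pointing). Let $\phi$ be a symplectomorphism of $(V,d\alpha)$ equal to the identity near $\partial V$. After a symplectic isotopy that is the identity near $\partial V$ one may assume $\phi^*\alpha-\alpha=dh$ for a function $h$. The form $dt+\alpha$ on $\mathbb{R}\times V$ descends to a contact form on the mapping torus $\mathcal{MT}(V,\phi)$, the quotient of $\mathbb{R}\times V$ by $(t,x)\mapsto(t-h(x),\phi(x))$. It is extended over $\partial V\times D^2$ by a contact form $h_1(r)\alpha|_{\partial V}+h_2(r)\,dt$ (with $(r,t)$ polar coordinates on $D^2$) which equals $\alpha|_{\partial V}+r^2dt$ near $r=0$ and matches the form on the mapping torus near the boundary. The resulting contact manifold $\mathcal{MT}(V,\phi)\cup_{id}\partial V\times D^2$ is denoted $\mathcal{A}ob(V,d\alpha,\phi)$; it is called a contact open book with page $(V,d\alpha)$, monodromy $\phi$ and binding $(\partial V,\alpha|_{\partial V})$. It depends only on the symplectic isotopy class of $\phi$ relative to the boundary,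 up to contactomorphism. A contact manifold $(M,\xi)$ is supported by $\mathcal{A}ob(V,d\alpha,\phi)$ if it is contactomorphic to it, i.e. $\xi$ has a contact form whose exterior derivative is symplectic on the pages and which induces the positive orientation on $M$ and the positive contact orientation on the binding. **Contact open book embedding.** $(M_1,\xi_1)$ contact open book embeds in $(M_2,\xi_2)$ if there exist supporting contact open books $\mathcal{A}ob(\Sigma_1,d\alpha_1,\phi_1)$ of $(M_1,\xi_1)$ and $\mathcal{A}ob(\Sigma_2,d\alpha_2,\phi_2)$ of $(M_2,\xi_2)$ and a proper symplectic embedding $g:(\Sigma_1,d\alpha_1)\to(\Sigma_2,d\alpha_2)$ (so $g^*d\alpha_2=d\alpha_1$) with $g\circ\phi_1=\phi_2\circ g$. **Dehn–Seidel twists.** Regard $T^*S^n$ as $\{(\vec x,\vec y)\in\mathbb{R}^{n+1}\times\mathbb{R}^{n+1}: |\vec x|=1,\ \vec x\cdot\vec y=0\}$ with canonical $1$-form $\lambda^n_{can}=\sum y_i\,dx_i$; $DT^*S^n$ is the unit disk cotangent bundle. For $\vec y\ne 0$ put $\sigma_t(\vec x,\vec y)=(\cos t\,\vec x+|\vec y|^{-1}\sin t\,\vec y,\ -|\vec y|\sin t\,\vec x+\cos t\,\vec y)$. For $k>0$ let $g_k:[0,\infty)\to\mathbb{R}$ be a smooth function with $g_k(0)=k\pi$, $g_k'(0)<0$, decreasing to $0$ at some $0<p_0<1$ and $0$ afterwards (chosen so that the map below is smooth). The $k$-fold Dehn–Seidel twist $\tau_k$ is $\tau_k(\vec x,\vec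 y)=\sigma_{g_k(|\vec y|)}(\vec x,\vec y)$ for $\vec y\neq 0$ and $\tau_k(\vec x,0)=((-1)^k\vec x,0)$. It is a symplectomorphism of $(DT^*S^n,d\lambda^n_{can})$, the identity near the boundary, whose symplectic isotopy class does not depend on $g_k$. For $k<0$ the twist $\tau_k$ is defined analogously (it is isotopic to $\tau_{-k}^{-1}$), and $\tau_0=id$. *)

(* Defs.v *)
From HB Require Import structures.
From mathcomp Require Import all_boot all_order all_algebra.
From mathcomp Require Import all_classical all_reals all_analysis.
Set Implicit Arguments.
Unset Strict Implicit.
Unset Printing Implicit Defensive.
Import Order.TTheory GRing.Theory Num.Theory.
Import numFieldNormedType.Exports.
Local Open Scope classical_set_scope.
Local Open Scope ring_scope.

(** Conventions.  All manifolds occurring here are compact, so they are taken,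
    without loss of generality (Whitney), to be embedded submanifolds X of a
    Euclidean space 'rV_N, as subsets of it.  A smooth map or form on X is
    represented by a map or form of the ambient space that is smooth on an open
    neighbourhood of X (every smooth object on X has such a representative).
    Only values at points of X, and on vectors tangent to X, are ever used, so
    the choice of representative is immaterial.

    A 1-form [a] is a function with [a x v] the value at the point [x] on the
    vector [v]; similarly [w x u v] for a 2-form. *)

Section Smooth.
Variables (R : realType) (E F : normedModType R).

(* For open A in a finite-dimensional E this is the usual class C^k. *)
Fixpoint Ck (k : nat) (A : set E) (f : E -> F) : Prop :=
  (forall x, A x -> {for x, continuous f}) /\
  if k is k'.+1 then
    forall v : E, (forall x, A x -> derivable f x v) /\ Ck k' A ('D_v f)
  else True.

Definition smooth (A : set E) (f : E -> F) : Prop := forall k, Ck k A f.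

Definition smooth_near (X : set E) (f : E -> F) : Prop :=
  exists U : set E, [/\ open U, X `<=` U & smooth U f].

End Smooth.

Section Embedding.
Variables (R : realType) (E F : normedModType R).

(* A diffeomorphism from X onto its image; for submanifolds this is the notion
   of embedding. *)
Definition embedding (X : set E) (f : E -> F) : Prop :=
  smooth_near X f /\
  exists g : F -> E,
    smooth_near (f @` X) g /\ forall x, X x -> g (f x) = x.

End Embedding.

Section Forms.
Variables (R : realType) (E : normedModType R).

(* Velocities of smooth curves that stay in X for small nonnegative or for
   small nonpositive time: at a boundary point of a manifold with boundary both
   kinds are needed to get the whole tangent space. *)
Definition tangent (X : set E) (x v : E) : Prop :=
  exists (c : R -> E) (e : R),
    [/\ 0 < e, smooth (fun t : R => - e < t < e) c, c 0 = x, derive1 c 0 = v &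
        (forall t, 0 <= t < e -> X (c t)) \/
        (forall t, - e < t <= 0 -> X (c t))].

Definition form1_near (X : set E) (a : E -> E -> R) : Prop :=
  exists U : set E,
    [/\ open U, X `<=` U,
        forall x, U x -> forall (s : R) (u v : E),
          a x (s *: u + v) = s * a x u + a x v &
        forall v : E, smooth U (fun x => a x v)].

Definition extd (a : E -> E -> R) (x u v : E) : R :=
  'D_u (fun y => a y v) x - 'D_v (fun y => a y u) x.

End Forms.

Section Pullback.
Variables (R : realType) (E F : normedModType R).

Definition pullback1 (X : set E) (f : E -> F)
    (b : F -> F -> R) (a : E -> E -> R) : Prop :=
  forall x v, X x -> tangent X x v -> b (f x) ('D_v f x) = a x v.

Definition pullback2 (X : set E) (f : E -> F)
    (b : F -> F -> F -> R) (a : E -> E -> E -> R) : Prop :=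
  forall x u v, X x -> tangent X x u -> tangent X x v ->
    b (f x) ('D_u f x) ('D_v f x) = a x u v.

End Pullback.

Section Manifolds.
Variables (R : realType) (N m : nat).
Implicit Types X U : set 'rV[R]_N.

Definition halfspace : set 'rV[R]_m :=
  [set u | forall i : 'I_m, i = 0%N :> nat -> 0 <= u 0 i].

(* p parametrizes the part of X in U by the part of the half-space in W, with
   smooth inverse q. *)
Definition local_param X (p : 'rV[R]_m -> 'rV[R]_N) (W : set 'rV[R]_m)
    (q : 'rV[R]_N -> 'rV[R]_m) U : Prop :=
  [/\ open W /\ open U, smooth W p, smooth U q,
      forall u, W u -> halfspace u -> [/\ X (p u), U (p u) & q (p u) = u] &
      forall x, X x -> U x -> [/\ W (q x), halfspace (q x) & p (q x) = x]].

(* Smooth m-dimensional submanifold, possibly with boundary. *)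
Definition manifold X : Prop :=
  forall x, X x -> exists p W q U, local_param X p W q U /\ U x.

Definition boundary X : set 'rV[R]_N :=
  [set x | X x /\ exists p W q U, [/\ local_param X p W q U, U x &
     exists i : 'I_m, i = 0%N :> nat /\ q x 0 i = 0]].

End Manifolds.

Unset Implicit Arguments.

Section OpenBooks.
Variable R : realType.

(** ** Contact manifolds *)

(* A manifold together with a 1-form; the co-oriented contact structure is the
   co-oriented hyperplane field [ker cform], so that [cform] only matters up to
   multiplication by a positive function (see [contactomorphic]). *)
Record cmanifold := CManifold {
  camb : nat;
  cdim : nat;
  cset : set 'rV[R]_camb;
  cform : 'rV[R]_camb -> 'rV[R]_camb -> R }.

(* Closed manifold; the last condition says that [ker cform] is a hyperplane
   field on which [d cform] is nondegenerate. *)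
Definition contact (M : cmanifold) : Prop :=
  [/\ compact (cset M), manifold (cdim M) (cset M),
      boundary (cdim M) (cset M) = set0, form1_near (cset M) (cform M) &
      forall x, cset M x ->
        (exists v, tangent (cset M) x v /\ cform M x v <> 0) /\
        (forall v, tangent (cset M) x v -> cform M x v = 0 -> v <> 0 ->
           exists w, [/\ tangent (cset M) x w, cform M x w = 0 &
                         extd (cform M) x v w <> 0])].

Definition contactomorphic (M1 M2 : cmanifold) : Prop :=
  exists (f : 'rV[R]_(camb M1) -> 'rV[R]_(camb M2))
         (u : 'rV[R]_(camb M1) -> R),
    [/\ embedding (cset M1) f, f @` cset M1 = cset M2,
        forall x, cset M1 x -> 0 < u x &
        pullback1 (cset M1) f (cform M2) (fun x v => u x * cform M1 x v)].

(** ** Pages *)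

Record page := Page {
  pamb : nat;
  pdim : nat;
  pset : set 'rV[R]_pamb;
  pform : 'rV[R]_pamb -> 'rV[R]_pamb -> R }.

Definition bd (P : page) : set 'rV[R]_(pamb P) := boundary (pdim P) (pset P).

Definition pomega (P : page) := extd (pform P).

(* [k] is the collar (-1,0] x bd -> V, symplectic for d(e^t alpha), in which the
   Liouville field Y, characterized by i_Y d alpha = alpha, is d/dt. *)
Definition collar (P : page) (k : R * 'rV[R]_(pamb P) -> 'rV[R]_(pamb P)) :
    Prop :=
  let X := [set z : R * 'rV[R]_(pamb P) | -1 < z.1 <= 0 /\ bd P z.2] in
  [/\ embedding X k,
      k @` X `<=` pset P /\
        (exists U, [/\ open U, bd P `<=` U & pset P `&` U `<=` k @` X]),
      forall b, bd P b -> k (0, b) = b,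
      pullback2 X k (pomega P)
        (extd (fun z w : R * 'rV[R]_(pamb P) => expR z.1 * pform P z.2 w.2)) &
      forall z, X z -> forall v, tangent (pset P) (k z) v ->
        pomega P (k z) ('D_((1, 0) : R * 'rV[R]_(pamb P)) k z) v
          = pform P (k z) v].

Definition exact_symplectic_convex (P : page) : Prop :=
  [/\ compact (pset P), manifold (pdim P) (pset P),
      form1_near (pset P) (pform P),
      forall x v, pset P x -> tangent (pset P) x v -> v <> 0 ->
        exists w, tangent (pset P) x w /\ pomega P x v w <> 0 &
      exists k, collar P k].

(* Symplectomorphism of the page, equal to the identity near the boundary. *)
Definition symplecto (P : page) (phi : 'rV[R]_(pamb P) -> 'rV[R]_(pamb P)) :
    Prop :=
  [/\ embedding (pset P) phi, phi @` pset P = pset P,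
      pullback2 (pset P) phi (pomega P) (pomega P) &
      exists U, [/\ open U, bd P `<=` U &
        forall x, pset P x -> U x -> phi x = x]].

(* Symplectic isotopy, equal to the identity near the boundary. *)
Definition symp_isotopic (P : page)
    (phi0 phi1 : 'rV[R]_(pamb P) -> 'rV[R]_(pamb P)) : Prop :=
  exists Phi : R * 'rV[R]_(pamb P) -> 'rV[R]_(pamb P),
    [/\ smooth_near
          [set z : R * 'rV[R]_(pamb P) | 0 <= z.1 <= 1 /\ pset P z.2] Phi,
        forall s, 0 <= s <= 1 -> symplecto P (fun x => Phi (s, x)),
        (exists U, [/\ open U, bd P `<=` U &
           forall s x, 0 <= s <= 1 -> pset P x -> U x -> Phi (s, x) = x]),
        forall x, pset P x -> Phi (0, x) = phi0 x &
        forall x, pset P x -> Phi (1, x) = phi1 x].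

(** ** Contact open books *)

(* The form dt + alpha on R x V. *)
Definition dt_plus (P : page) (z w : R * 'rV[R]_(pamb P)) : R :=
  w.1 + pform P z.2 w.2.

(* [Q] presents the mapping torus, with its contact form induced by dt + alpha,
   as a subset of M: it is the quotient map of R x V by the action of Z
   generated by (t,x) |-> (t - h x, phi x). *)
Definition mapping_torus (M : cmanifold) (P : page)
    (phi : 'rV[R]_(pamb P) -> 'rV[R]_(pamb P)) (h : 'rV[R]_(pamb P) -> R)
    (Q : R * 'rV[R]_(pamb P) -> 'rV[R]_(camb M)) : Prop :=
  let X := [set z : R * 'rV[R]_(pamb P) | pset P z.2] in
  let T z := (z.1 - h z.2, phi z.2) in
  [/\ smooth_near X Q /\ Q @` X `<=` cset M,
      forall z, X z -> exists U, [/\ open U, U z & embedding (X `&` U) Q],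
      forall z z', X z -> X z' ->
        (Q z = Q z' <-> exists j, z' = iter j T z \/ z = iter j T z') &
      pullback1 X Q (cform M) (dt_plus P)].

Definition nrm2 (q : R * R) : R := Num.sqrt (q.1 ^+ 2 + q.2 ^+ 2).

(* h1(r) alpha + h2(r) dt on bd x D^2, in Cartesian coordinates on D^2, where
   dt = (x dy - y dx) / r^2.  (At r = 0 the second term vanishes, as it should,
   since h2(r) = r^2 near 0.) *)
Definition binding_form (P : page) (h1 h2 : R -> R)
    (z w : 'rV[R]_(pamb P) * (R * R)) : R :=
  let r := nrm2 z.2 in
  h1 r * pform P z.1 w.1
    + h2 r / r ^+ 2 * (z.2.1 * w.2.2 - z.2.2 * w.2.1).

(* The boundary of the mapping torus is glued to bd x bd D^2, D^2 being the
   unit disk.  The gluing is smooth along the collar k of V: the angle t on D^2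
   is proportional to the R-coordinate of the mapping torus (which has period c
   there) and r = 1 - s for the collar coordinate s.  To express this, the chart
   [B] of a neighbourhood of the binding is defined on the disk of radius 1 + e.
   [0 < h1] only matters in dimension 3, where it excludes additional twisting
   of the contact structure around the binding. *)
Definition binding_chart (M : cmanifold) (P : page)
    (Q : R * 'rV[R]_(pamb P) -> 'rV[R]_(camb M))
    (k : R * 'rV[R]_(pamb P) -> 'rV[R]_(pamb P)) (c e : R)
    (B : 'rV[R]_(pamb P) * (R * R) -> 'rV[R]_(camb M)) (h1 h2 : R -> R) :
    Prop :=
  let X := [set z : 'rV[R]_(pamb P) * (R * R) | bd P z.1 /\ nrm2 z.2 < 1 + e] in
  [/\ embedding X B /\ B @` X `<=` cset M,
      forall b, bd P b -> forall r t, 1 <= r < 1 + e ->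
        B (b, (r * cos t, r * sin t)) = Q (c * t / (2 * pi), k (1 - r, b)),
      [/\ smooth (fun r : R => 0 < r < 1 + e) h1,
          smooth (fun r : R => 0 < r < 1 + e) h2,
          (forall r, 0 <= r < 1 + e -> 0 < h1 r) &
          exists e0, 0 < e0 /\
            forall r, 0 <= r < e0 -> h1 r = 1 /\ h2 r = r ^+ 2] &
      pullback1 X B (cform M) (binding_form P h1 h2)].

(* M is the contact manifold Aob(V, d alpha, phi) built from the page P; the
   construction involves choices, hence a relation.  [h] is normalized to be
   positive (it is only determined up to constants), so that the action of Z has
   first-return map phi, and constant near the boundary (a further isotopy
   achieves this when the boundary is disconnected). *)
Definition is_Aob (M : cmanifold) (P : page)
    (phi : 'rV[R]_(pamb P) -> 'rV[R]_(pamb P)) : Prop :=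
  cdim M = (pdim P).+1 /\
  exists (phi' : 'rV[R]_(pamb P) -> 'rV[R]_(pamb P))
         (h : 'rV[R]_(pamb P) -> R) (c : R)
         (k : R * 'rV[R]_(pamb P) -> 'rV[R]_(pamb P)) (e : R)
         (Q : R * 'rV[R]_(pamb P) -> 'rV[R]_(camb M))
         (B : 'rV[R]_(pamb P) * (R * R) -> 'rV[R]_(camb M)) (h1 h2 : R -> R),
    [/\ symp_isotopic P phi phi',
        [/\ smooth_near (pset P) h,
            (forall x, pset P x -> 0 < h x),
            (forall x v, pset P x -> tangent (pset P) x v ->
               pform P (phi' x) ('D_v phi' x) - pform P x v = 'D_v h x) &
            exists U, [/\ open U, bd P `<=` U &
              forall x, pset P x -> U x -> h x = c]],
        collar P k,
        [/\ mapping_torus M P phi' h Q, 0 < e <= 1 &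
            binding_chart M P Q k c e B h1 h2] &
        let torus := Q @` [set z : R * 'rV[R]_(pamb P) | pset P z.2] in
        let core :=
          B @` [set z : 'rV[R]_(pamb P) * (R * R) | bd P z.1 /\ nrm2 z.2 < 1] in
        torus `|` core = cset M /\ torus `&` core = set0].

Definition supports (P : page) (phi : 'rV[R]_(pamb P) -> 'rV[R]_(pamb P))
    (M : cmanifold) : Prop :=
  exists A, [/\ contact A, is_Aob A P phi & contactomorphic M A].

(* A symplectic embedding is proper when it maps boundary points, and only
   those, to boundary points. *)
Definition proper_symplectic_embedding (P1 P2 : page)
    (g : 'rV[R]_(pamb P1) -> 'rV[R]_(pamb P2)) : Prop :=
  [/\ embedding (pset P1) g, g @` pset P1 `<=` pset P2,
      forall x, pset P1 x -> (bd P2 (g x) <-> bd P1 x) &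
      pullback2 (pset P1) g (pomega P2) (pomega P1)].

Definition contact_open_book_embeds (M1 M2 : cmanifold) : Prop :=
  exists (P1 P2 : page) phi1 phi2 g,
    [/\ exact_symplectic_convex P1 /\ exact_symplectic_convex P2,
        symplecto P1 phi1 /\ symplecto P2 phi2,
        supports P1 phi1 M1 /\ supports P2 phi2 M2,
        proper_symplectic_embedding P1 P2 g &
        forall x, pset P1 x -> g (phi1 x) = phi2 (g x)].

(** ** Cotangent disk bundles and Dehn-Seidel twists *)

Section Dehn.
Variable n : nat.
Local Notation Rn1 := 'rV[R]_n.+1.
Local Notation R2n2 := 'rV[R]_(n.+1 + n.+1).

Definition dotp (x y : Rn1) : R := \sum_i x 0 i * y 0 i.
Definition enorm (y : Rn1) : R := Num.sqrt (dotp y y).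

(* R^(n+1) x R^(n+1) is identified with R^(2n+2), (x, y) being [row_mx x y]. *)
Definition DTS : set R2n2 :=
  [set z | [/\ enorm (lsubmx z) = 1, dotp (lsubmx z) (rsubmx z) = 0 &
               enorm (rsubmx z) <= 1]].

Definition lambda_can (z w : R2n2) : R := dotp (rsubmx z) (lsubmx w).

Definition DTS_page : page :=
  Page (n.+1 + n.+1) (2 * n) DTS lambda_can.

Definition sigma (t : R) (z : R2n2) : R2n2 :=
  let x := lsubmx z in let y := rsubmx z in
  row_mx (cos t *: x + ((enorm y)^-1 * sin t) *: y)
         (- (enorm y * sin t) *: x + cos t *: y).

Definition twist_profile (k : int) (g : R -> R) : Prop :=
  let s : R := (Num.sg k)%:~R in
  [/\ smooth_near [set r : R | 0 <= r] g, g 0 = k%:~R * pi,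
      s * derive1 g 0 < 0 &
      exists p0, [/\ 0 < p0 < 1,
        forall a b, 0 <= a -> a < b -> b <= p0 -> s * g b < s * g a &
        forall r, p0 <= r -> g r = 0]].

Definition twist_map (k : int) (g : R -> R) (z : R2n2) : R2n2 :=
  if rsubmx z == 0 then row_mx ((-1) ^ k *: lsubmx z) 0
  else sigma (g (enorm (rsubmx z))) z.

(* For k < 0 the profile is the negative of one for -k. *)
Definition is_twist (k : int) (tau : R2n2 -> R2n2) : Prop :=
  if k == 0 then forall z, DTS z -> tau z = z
  else smooth_near DTS tau /\
       exists g, twist_profile k g /\
         forall z, DTS z -> tau z = twist_map k g z.

End Dehn.

End OpenBooks.

(* Main.v *)
(** Place [T*S^n] in [T*S^(n+1)] over the equator by [(X, Y) |-> ((0, X), (v, Y))],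
    where the normal fibre coordinate [v] is a small constant for [Y] near [0] and
    vanishes for larger [Y]: the image is symplectic and avoids the zero section.
    The monodromies only matter up to symplectic isotopy rel boundary.  Flatten
    [tau_k] so that its angle profile is constantly [k pi] near the zero section, and
    compose [tau_l] with [sigma_m], where [m] is the difference of the two profiles,
    cut off to [0] near the zero section of [T*S^(n+1)].  The composite is the twist
    with the flattened profile on the image of the page, whatever [l] is.  Over the
    region where [v <> 0] it is [(-1)^k], hence sends the image point of [(X, Y)] to
    the point over [(-1)^k (X, Y)] with fibre coordinate [(-1)^k v] instead of [v].  A
    rotation by [k pi] of the normal disk factor of a neighbourhood of [T*S^n], cut
    off to be Hamiltonian with compact support, corrects this sign. *)

Require Import Defs.
From HB Require Import structures.
From mathcomp Require Import all_boot all_order all_algebra.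
From mathcomp Require Import all_classical all_reals all_analysis.
From mathcomp Require Import ring lra.
Set Implicit Arguments.
Unset Strict Implicit.
Unset Printing Implicit Defensive.
Import Order.TTheory GRing.Theory Num.Theory.
Import numFieldNormedType.Exports.
Local Open Scope classical_set_scope.
Local Open Scope ring_scope.

(** The zero section of the target is the obstacle: $\sigma_t$ is undefined on it and [tau_l] is
    $(-1)^l$ there, which composing with a $\sigma_m$ cut off near it cannot alter. This is why the
    page is pushed away. The push costs nothing symplectically, since the base coordinate conjugate
    to [v] is constantly 0.

    The constants are nested windows in squared fibre norms. The height falls from 1/8 to 0 for
    $|Y|^2$ between 1/64 and 1/32, so where $|Y|^2<1/32$ the image has $|y|^2$ in $[1/64,1/16]$. The
    change of [tau_l] is complete from $|y|^2=1/64$ on, the flattened profile is $k\pi$ up to 1/16,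
    and the tube rotation is rigid for $v^2<1/40$, $|Y|^2<1/20$, with support in $|y|^2\le 1/4$.

    A twist is given as smooth at $y=0$ only as a map; $\sigma$ with its profile does not make sense
    there. Inverses and deformations that reach the zero section are therefore written through the
    map itself, and identities at $y=0$ come from a limit. *)

(* Finite dimension, in the form needed to get differentiability from continuous
   directional derivatives. *)
Class findim (R : realType) (E : normedModType R) : Prop := FinDim {
  findim_basis : exists (d : nat) (b : 'I_d -> E) (l : 'I_d -> {linear E -> R^o}),
    (forall i, continuous (l i)) /\ forall v, v = \sum_i l i v *: b i }.

(** * Differentiability from continuous directional derivatives *)

Section C1.
Variable R : realType.

Lemma is_derive_line (E F : normedModType R) (f : E -> F) (y b : E) (t : R) :
  derivable f (y + t *: b) b ->
  is_derive t (1 : R) (fun s : R => f (y + s *: b)) ('D_b f (y + t *: b)).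
Proof.
have e : (fun h : R => h^-1 *: (((fun s : R => f (y + s *: b)) \o shift t) (h *: (1 : R)) - f (y + t *: b)))
    = (fun h : R => h^-1 *: ((f \o shift (y + t *: b)) (h *: b) - f (y + t *: b))).
  apply/funext => h /=; congr (_ *: (f _ - _)).
  by rewrite scalerDl [h *: (1 : R)]mulr1 addrCA.
by move=> df; split; rewrite /derivable /derive e.
Qed.

(** Mean value theorem for $t\mapsto f(y+tb)$. The slope [c] is free rather than the derivative at
    [y], so that increments along several successive segments can all be compared with the
    derivatives at one common point. *)
Lemma line_increment (E : normedModType R) (f : E -> R) (y b : E) (s c e : R) :
  (forall t : R, `|t| <= `|s| -> derivable (f : E -> R^o) (y + t *: b) b) ->
  (forall t : R, `|t| <= `|s| -> `|'D_b (f : E -> R^o) (y + t *: b) - c| <= e) ->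
  `|f (y + s *: b) - f y - s * c| <= e * `|s|.
Proof.
move=> df bd.
pose g t := f (y + t *: b).
have dg t : `|t| <= `|s| -> is_derive t (1 : R) (g : R -> R^o) ('D_b (f : E -> R^o) (y + t *: b)).
  by move=> ts; apply: is_derive_line; exact: df.
have -> : f y = g 0 by rewrite /g scale0r addr0.
rewrite -/(g s).
have cg a b' : (forall t, t \in `[a, b'] -> `|t| <= `|s|) -> {within `[a, b'], continuous g}.
  move=> h; apply: derivable_within_continuous => t tab.
  by have [] := dg t (h t tab).
have [s0|s0] := leP 0 s.
  have h t : t \in `[0, s] -> `|t| <= `|s|.
    by rewrite in_itv /= => /andP[t0 ts]; rewrite !ger0_norm.
  have h' t : t \in `]0, s[ -> `|t| <= `|s|.
    by rewrite in_itv /= => /andP[t0 ts]; apply: h; rewrite in_itv /= !ltW.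
  have [t ts ->] := MVT_segment s0 (fun t ht => dg t (h' t ht)) (cg _ _ h).
  have ht : `|t| <= `|s| by exact: h.
  rewrite subr0 mulrC -mulrBr normrM mulrC ler_wpM2r//; exact: bd.
have h t : t \in `[s, 0] -> `|t| <= `|s|.
  by rewrite in_itv /= => /andP[t0 ts]; rewrite !ler0_norm ?lerN2 // ltW.
have h' t : t \in `]s, 0[ -> `|t| <= `|s|.
  by rewrite in_itv /= => /andP[t0 ts]; apply: h; rewrite in_itv /= !ltW.
have [t ts] := MVT_segment (ltW s0) (fun t ht => dg t (h' t ht)) (cg _ _ h).
have ht : `|t| <= `|s| by exact: h.
rewrite sub0r => gE.
rewrite (_ : g s - g 0 - s * c = s * ('D_b (f : E -> R^o) (y + t *: b) - c)); last first.
  by rewrite -[g s - g 0]opprB gE; ring.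
by rewrite normrM mulrC ler_wpM2r//; exact: bd.
Qed.

(** The increment from $x$ to $x+h$ is split into one segment per basis direction, and
    [line_increment] controls each of them by the continuity of the corresponding derivative at
    $x$. *)
Lemma C1_differentiable_scalar (E : normedModType R) {fE : findim E} (A : set E)
    (f : E -> R^o) (x : E) :
  open A -> A x -> (forall v y, A y -> derivable f y v) ->
  (forall v, {for x, continuous ('D_v f)}) -> differentiable f x.
Proof.
move=> oA Ax df cf.
have [[d [b [l [cl lE]]]]] := fE.
pose L (h : E) : R^o := \sum_i l i h * 'D_(b i) f x.
have linL : linear L.
  move=> a u v; rewrite /L scaler_sumr -big_split /=; apply: eq_bigr => i _.
  by rewrite linearP mulrDl scalerAl.
pose Ll : {linear E -> R^o} := HB.pack L (GRing.isLinear.Build _ _ _ _ L linL).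
have cL : continuous Ll.
  apply: (continuous_big (op := +%R)) => [|i _ y]; first exact: add_continuous.
  by apply: cvgM; [exact: cl|exact: cvg_cst].
suff key : f \o shift x = cst (f x) + Ll +o_ (0 : E) id.
  apply/diff_locallyP; split; last by rewrite (diff_unique cL key).
  by move=> y; rewrite (diff_unique cL key); exact: cL.
have /choice[k Hk] : forall i, exists k, 0 < k /\ forall h, `|l i h| <= k * `|h|.
  by move=> i; have [k k0 H] := linear_lipschitz (cl i); exists k.
(* Relative to $|h|$, [C] bounds the sum of the coordinates of $h$ and [B] the length of the
   polygonal path from $x$ to $x+h$. *)
pose C := \sum_i k i; pose B := \sum_i k i * `|b i|.
have C0 : 0 <= C by apply: sumr_ge0 => i _; rewrite ltW//; case: (Hk i).
have B0 : 0 <= B.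
  by apply: sumr_ge0 => i _; rewrite mulr_ge0// ltW//; case: (Hk i).
apply/eqaddoP => _/posnumP[eps].
pose eta := eps%:num / (C + 1).
have C1 : 0 < C + 1 by rewrite ltr_wpDl.
have eta0 : 0 < eta by rewrite divr_gt0.
have [r r0 Hr] : exists2 r : R, 0 < r & forall y, `|x - y| < r ->
    A y /\ forall i, `|'D_(b i) f y - 'D_(b i) f x| <= eta.
  have : \forall y \near x, A y /\ forall i, `|'D_(b i) f y - 'D_(b i) f x| <= eta.
    near=> y; split; first by near: y; exact: open_nbhs_nbhs.
    move=> i; rewrite distrC; move: i; near: y; apply: filter_forall => i.
    by have /cvgrPdist_le /(_ _ eta0) := cf (b i).
  by move=> /nbhs_normP[r /= r0 Hr]; exists r => // y xy; exact: Hr.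
near=> h.
have hr : B * `|h| < r.
  rewrite (@le_lt_trans _ _ ((B + 1) * `|h|))//.
    by apply: ler_wpM2r => //; rewrite lerDl.
  rewrite mulrC -ltr_pdivlMr ?ltr_wpDl//; near: h.
  by apply: nbhs0_lt; rewrite divr_gt0// ltr_wpDl.
(* Induction on the list of directions already travelled; the bound on the path length keeps every
   segment in the ball where [Hr] applies. *)
have step (s : seq 'I_d) : \sum_(i <- s) `|l i h| * `|b i| < r ->
    `|f (x + \sum_(i <- s) l i h *: b i) - f x - \sum_(i <- s) l i h * 'D_(b i) f x|
      <= eta * \sum_(i <- s) `|l i h|.
  elim: s => [|i s IH]; first by rewrite !big_nil addr0 !subrr normr0 mulr0.
  rewrite !big_cons => Hs.
  have Hs' : \sum_(i <- s) `|l i h| * `|b i| < r.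
    by apply: le_lt_trans Hs; rewrite lerDr mulr_ge0.
  have nS : `|\sum_(i <- s) l i h *: b i| <= \sum_(i <- s) `|l i h| * `|b i|.
    apply: le_trans (ler_norm_sum _ _ _) _.
    by rewrite le_eqVlt; apply/orP; left; apply/eqP/eq_bigr => j _; rewrite normrZ.
  set S := \sum_(j <- s) l j h *: b j in nS *.
  have near t : `|t| <= `|l i h| -> `|x - (x + S + t *: b i)| < r.
    move=> th; rewrite -addrA opprD addNKr normrN; apply: le_lt_trans Hs.
    rewrite addrC; apply: le_trans (ler_normD _ _) _; rewrite lerD// normrZ.
    exact: ler_wpM2r.
  have := @line_increment E f (x + S) (b i) (l i h) ('D_(b i) f x) eta.
  move=> /(_ (fun t th => df _ _ (proj1 (Hr _ (near t th))))).
  move=> /(_ (fun t th => proj2 (Hr _ (near t th)) i)) H1.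
  rewrite mulrDr (_ : _ - _ = (f (x + S + l i h *: b i) - f (x + S) - l i h * 'D_(b i) f x) +
     (f (x + S) - f x - \sum_(j <- s) l j h * 'D_(b j) f x)); last first.
    by rewrite [_ + S]addrC addrA; ring.
  by apply: le_trans (ler_normD _ _) _; rewrite lerD// IH.
have hB : \sum_i `|l i h| * `|b i| <= B * `|h|.
  rewrite /B mulr_suml; apply: ler_sum => i _.
  by rewrite mulrAC; apply: ler_wpM2r => //; case: (Hk i).
have := step (index_enum _) (le_lt_trans hB hr).
rewrite -lE => /le_trans Hs.
have -> : (f \o shift x - (cst (f x) + Ll)) h = f (x + h) - f x - L h :> R.
  by rewrite /= fctE /= opprD addrA [h + x]addrC.
apply: Hs; apply: (@le_trans _ _ (eta * (C * `|h|))).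
  apply: ler_wpM2l; first exact: ltW.
  by rewrite /C mulr_suml; apply: ler_sum => i _; case: (Hk i).
rewrite mulrA; apply: ler_wpM2r => //.
rewrite /eta -mulrA ler_piMr// mulrC ler_pdivrMr// mul1r lerDl//.
Unshelve. all: by end_near. Qed.
End C1.

(** * Calculus of C^k maps on finite-dimensional spaces *)

Section Calculus.
Variable R : realType.
Implicit Types E F G : normedModType R.

Lemma findim_R : findim (R^o : normedModType R).
Proof.
split; exists 1%N, (fun _ => 1 : R^o), (fun _ => idfun); split; first by move=> i x.
by move=> v; rewrite big_ord1 /= [v *: 1]mulr1.
Qed.

Lemma findim_rV n : findim ('rV[R]_n : normedModType R).
Proof.
pose co (i : 'I_n) (x : 'rV[R]_n) : R^o := x 0 i.
have lco i : linear (co i) by move=> a u v; rewrite /co !mxE.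
split; exists n, (fun i => delta_mx 0 i),
  (fun i => HB.pack (co i) (GRing.isLinear.Build _ _ _ _ (co i) (lco i)) : {linear 'rV[R]_n -> R^o}); split.
  by move=> i; exact: coord_continuous.
by move=> v; rewrite [LHS]row_sum_delta.
Qed.

Lemma findim_prod E F : findim E -> findim F -> findim (E * F)%type.
Proof.
move=> [[d [b [l [cl lE]]]]] [[d' [b' [l' [cl' lE']]]]].
pose m (i : 'I_(d + d')) (z : E * F) : R^o :=
  match fintype.split i with inl j => l j z.1 | inr j => l' j z.2 end.
have lm i : linear (m i).
  by move=> a u v; rewrite /m; case: (fintype.split i) => j; rewrite /= linearP.
split; exists (d + d')%N, (fun i => match fintype.split i with inl j => (b j, 0) | inr j => (0, b' j) end),
  (fun i => HB.pack (m i) (GRing.isLinear.Build _ _ _ _ (m i) (lm i)) : {linear (E * F)%type -> R^o}); split.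
  move=> i z /=; rewrite /m; case: (fintype.split i) => j.
    by apply: (@continuous_comp _ _ _ fst (l j)); [exact: cvg_fst|exact: cl].
  by apply: (@continuous_comp _ _ _ snd (l' j)); [exact: cvg_snd|exact: cl'].
move=> [u v]; rewrite big_split_ord /=.
rewrite (eq_bigr (fun i => (l i u *: b i, 0))); last first.
  move=> i _; rewrite /m (unsplitK (inl i)) /=.
  by rewrite -[LHS]/(_, _) /= scaler0.
rewrite [X in _ + X](eq_bigr (fun i => (0, l' i v *: b' i))); last first.
  move=> i _; rewrite /m (unsplitK (inr i)) /=.
  by rewrite -[LHS]/(_, _) /= scaler0.
have s1 I r (f : I -> E) : \sum_(i <- r) (f i, 0 : F) = (\sum_(i <- r) f i, 0).
  elim: r => [|i r IH]; first by rewrite !big_nil.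
  by rewrite !big_cons IH -[LHS]/(_, _) /= addr0.
have s2 I r (f : I -> F) : \sum_(i <- r) (0 : E, f i) = (0, \sum_(i <- r) f i).
  elim: r => [|i r IH]; first by rewrite !big_nil.
  by rewrite !big_cons IH -[LHS]/(_, _) /= addr0.
by rewrite s1 s2 -lE -lE' -[RHS]/(_, _) /= addr0 add0r.
Qed.

Lemma Ck_continuous E F k (A : set E) (f : E -> F) x :
  Ck k A f -> A x -> {for x, continuous f}.
Proof. by case: k => [|k] [] h _; exact: h. Qed.

Lemma Ck_derivable E F k (A : set E) (f : E -> F) x v :
  Ck k.+1 A f -> A x -> derivable f x v.
Proof. by move=> [_ /(_ v)[h _]]; exact: h. Qed.

Lemma Ck_derive E F k (A : set E) (f : E -> F) v : Ck k.+1 A f -> Ck k A ('D_v f).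
Proof. by move=> [_ /(_ v)[]]. Qed.

Lemma CkW E F k (A : set E) (f : E -> F) : Ck k.+1 A f -> Ck k A f.
Proof.
elim: k f => [|k IH] f [cf df]; first by split.
by split=> // v; have [? ?] := df v; split=> //; exact: IH.
Qed.

Lemma Ck_subset E F k (A B : set E) (f : E -> F) : A `<=` B -> Ck k B f -> Ck k A f.
Proof.
move=> AB; elim: k f => [|k IH] f [cf df]; first by split=> // x /AB; exact: cf.
split=> [x /AB|v]; first exact: cf.
by have [dv ck] := df v; split; [move=> x /AB; exact: dv|exact: IH].
Qed.

Lemma Ck_local E F k (A : set E) (f : E -> F) :
  (forall x, A x -> exists U : set E, U x /\ Ck k U f) -> Ck k A f.
Proof.
elim: k f => [|k IH] f h.
  by split=> // x /h[U [Ux]] /Ck_continuous; exact.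
split; first by move=> x /h[U [Ux]] /Ck_continuous; exact.
move=> v; split; first by move=> x /h[U [Ux]] /Ck_derivable; exact.
by apply: IH => x /h[U [Ux]] /Ck_derive ckU; exists U.
Qed.

Lemma near_derive_eq E F (A : set E) (f g : E -> F) x v : open A -> A x ->
  (forall y, A y -> f y = g y) -> 'D_v f x = 'D_v g x.
Proof.
move=> oA Ax fg; apply: near_eq_derive.
have : nbhs x A by exact: open_nbhs_nbhs.
by apply: filterS => y; exact: fg.
Qed.

Lemma Ck_eq E F k (A : set E) (f g : E -> F) : open A ->
  (forall y, A y -> f y = g y) -> Ck k A f -> Ck k A g.
Proof.
move=> oA; elim: k f g => [|k IH] f g fg [cf df].
  split=> // x Ax; change (g @ x --> g x); rewrite -fg//.
  apply: cvg_trans (cf _ Ax); apply: near_eq_cvg.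
  by have : nbhs x A by [exact: open_nbhs_nbhs]; apply: filterS => y; exact: fg.
split.
  move=> x Ax; change (g @ x --> g x); rewrite -fg//.
  apply: cvg_trans (cf _ Ax); apply: near_eq_cvg.
  by have : nbhs x A by [exact: open_nbhs_nbhs]; apply: filterS => y; exact: fg.
move=> v; have [dv ck] := df v; split.
  move=> x Ax; apply: near_eq_derivable (dv _ Ax).
  by have : nbhs x A by [exact: open_nbhs_nbhs]; apply: filterS => y; exact: fg.
by apply: IH ck => y Ay; exact: near_derive_eq fg.
Qed.

Lemma is_derive_lin_comp E F G (L : {linear F -> G}) (f : E -> F) x v : continuous L ->
  derivable f x v -> is_derive x v (fun y => L (f y)) (L ('D_v f x)).
Proof.
move=> cL df.
have : L (h^-1 *: ((f \o shift x) (h *: v) - f x)) @[h --> 0^'] --> L ('D_v f x).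
  by apply: cvg_comp; [exact: df|exact: cL].
under eq_fun do rewrite linearZ linearB /=.
by move=> h; split; [apply/cvg_ex; eexists; exact: h|exact: cvg_lim h].
Qed.

Lemma Ck_lin_comp E F G k (A : set E) (L : {linear F -> G}) (f : E -> F) : open A ->
  continuous L -> Ck k A f -> Ck k A (fun x => L (f x)).
Proof.
move=> oA cL; elim: k f => [|k IH] f cf.
  split=> // x Ax; apply: (@continuous_comp _ _ _ f L); last exact: cL.
  exact: Ck_continuous cf _.
split.
  move=> x Ax; apply: (@continuous_comp _ _ _ f L); last exact: cL.
  exact: Ck_continuous cf _.
move=> v; have H x (Ax : A x) := is_derive_lin_comp cL (Ck_derivable (v:=v) cf Ax).
split; first by move=> x /H[].
apply: (@Ck_eq _ _ _ _ (fun x => L ('D_v f x))) => //; first by move=> x /H[].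
by apply: IH; exact: Ck_derive.
Qed.

(** Expanding the values of [f] in a basis of [F] reduces this to the scalar case. *)
Lemma Ck1_differentiable E F {fE : findim E} {fF : findim F} k (A : set E) (f : E -> F) x :
  open A -> Ck k.+1 A f -> A x -> differentiable f x.
Proof.
move=> oA cf Ax; have [[d [b [l [cl lE]]]]] := fF.
have -> : f = fun y => \sum_i l i (f y) *: b i by apply/funext => y; exact: lE.
have -> : (fun y => \sum_i l i (f y) *: b i) = \sum_i (fun y => l i (f y) *: b i).
  by apply/funext => y; rewrite fct_sumE.
apply: differentiable_sum => i; apply: differentiableZl.
have dl v y : A y -> is_derive y v (fun y => l i (f y)) (l i ('D_v f y)).
  by move=> Ay; apply: is_derive_lin_comp => //; exact: Ck_derivable cf Ay.
apply: (@C1_differentiable_scalar R E fE A) => //.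
- by move=> v y /(dl v)[].
- move=> v; have cD := Ck_continuous (Ck_derive v cf) Ax.
  change ('D_v (fun y : E => l i (f y)) @ x --> 'D_v (fun y : E => l i (f y)) x).
  have -> : 'D_v (fun y => l i (f y)) x = l i ('D_v f x).
    by have [] := dl v x Ax.
  apply: cvg_trans; last by apply: cvg_comp; [exact: cD|exact: cl].
  apply: near_eq_cvg.
  have : nbhs x A by exact: open_nbhs_nbhs.
  by apply: filterS => y Ay /=; have [] := dl v y Ay.
Qed.

Lemma derive_comp E F G (f : E -> F) (g : F -> G) x v :
  differentiable f x -> differentiable g (f x) ->
  'D_v (fun y => g (f y)) x = 'D_('D_v f x) g (f x).
Proof.
move=> df dg; rewrite !deriveE//; last exact: differentiable_comp.
by rewrite (diff_comp df dg).
Qed.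

Lemma Ck_cst E F k (A : set E) (a : F) : Ck k A (fun _ => a).
Proof.
elim: k a => [|k IH] a; split=> //; try by move=> x _; exact: cvg_cst.
move=> v; split; first by move=> x _; exact: derivable_cst.
rewrite (_ : 'D_v _ = fun=> 0) ; first exact: IH.
by apply/funext => x; rewrite derive_cst.
Qed.

Lemma is_derive_linear E F (f : E -> F) x v : linear f -> is_derive x v f (f v).
Proof.
move=> lf.
have h : h^-1 *: ((f \o shift x) (h *: v) - f x) @[h --> 0^'] --> f v.
  apply: cvg_near_cst; near=> h.
  rewrite /= lf addrK scalerA mulVf ?scale1r //.
  by near: h; exact: nbhs_dnbhs_neq.
by split; [apply/cvg_ex; eexists; exact: h|exact: cvg_lim h].
Unshelve. all: by end_near. Qed.

Lemma Ck_linear E F k (A : set E) (f : E -> F) : linear f -> continuous f -> Ck k A f.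
Proof.
move=> lf cf; case: k => [|k]; (split; first by move=> x _; exact: cf) => //.
move=> v; split; first by move=> x _; have [] := is_derive_linear x v lf.
rewrite (_ : 'D_v _ = fun=> f v); first exact: Ck_cst.
by apply/funext => x; have [] := is_derive_linear x v lf.
Qed.

Lemma Ck_add E F k (A : set E) (f g : E -> F) :
  Ck k A f -> Ck k A g -> open A -> Ck k A (fun x => f x + g x).
Proof.
move=> + + oA; elim: k f g => [|k IH] f g cf cg.
  by split=> // x Ax; apply: cvgD; [exact: (Ck_continuous cf)|exact: (Ck_continuous cg)].
split.
  by move=> x Ax; apply: cvgD; [exact: (Ck_continuous cf)|exact: (Ck_continuous cg)].
move=> v; split.
  by move=> x Ax; apply: derivableD; [exact: Ck_derivable cf _|exact: Ck_derivable cg _].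
apply: (@Ck_eq _ _ _ _ (fun x => 'D_v f x + 'D_v g x)) => //.
  by move=> x Ax; rewrite -deriveD//; [exact: Ck_derivable cf _|exact: Ck_derivable cg _].
by apply: IH; exact: Ck_derive.
Qed.

Lemma is_derive_scale E F (k : E -> R) (w : E -> F) x v :
  {for x, continuous w} -> derivable (k : E -> R^o) x v -> derivable w x v ->
  is_derive x v (fun y => k y *: w y) ('D_v (k : E -> R^o) x *: w x + k x *: 'D_v w x).
Proof.
move=> cw dk dw.
have H : h^-1 *: (((fun y => k y *: w y) \o shift x) (h *: v) - k x *: w x) @[h --> 0^'] -->
   'D_v (k : E -> R^o) x *: w x + k x *: 'D_v w x.
  have -> : (fun h : R => h^-1 *: (((fun y => k y *: w y) \o shift x) (h *: v) - k x *: w x)) =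
     (fun h : R => (h^-1 *: (((k : E -> R^o) \o shift x) (h *: v) - k x)) *: (w \o shift x) (h *: v) +
        k x *: (h^-1 *: ((w \o shift x) (h *: v) - w x))).
    apply/funext => h /=; rewrite -scalerA (scalerA (k x)) mulrC -scalerA -scalerDr.
    by congr (_ *: _); rewrite scalerBl scalerBr addrA subrK.
  apply: cvgD; last by apply: cvgZ; [exact: cvg_cst|exact: dw].
  apply: cvgZ; first exact: dk.
  have c : h *: v + x @[h --> (0 : R)^'] --> x.
    rewrite -[X in _ --> X]add0r; apply: cvgD; last exact: cvg_cst.
    rewrite -[X in _ --> X](scale0r v); apply: cvgZ; last exact: cvg_cst.
    exact: cvg_within.
  exact: (cvg_comp _ _ c cw).
by split; [apply/cvg_ex; eexists; exact: H|exact: cvg_lim H].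
Qed.

Lemma Ck_scale E F k (A : set E) (a : E -> R) (w : E -> F) :
  Ck k A (a : E -> R^o) -> Ck k A w -> open A -> Ck k A (fun x => a x *: w x).
Proof.
move=> + + oA; elim: k a w => [|k IH] a w ca cw.
  by split=> // x Ax; apply: cvgZ; [exact: (Ck_continuous ca)|exact: (Ck_continuous cw)].
split.
  by move=> x Ax; apply: cvgZ; [exact: (Ck_continuous ca)|exact: (Ck_continuous cw)].
move=> v; have H x (Ax : A x) := is_derive_scale (Ck_continuous cw Ax)
  (Ck_derivable (v:=v) ca Ax) (Ck_derivable (v:=v) cw Ax).
split; first by move=> x /H[].
apply: (@Ck_eq _ _ _ _ (fun x => 'D_v (a : E -> R^o) x *: w x + a x *: 'D_v w x)) => //.
  by move=> x /H[].
apply: Ck_add => //; apply: IH; do ?[exact: CkW|exact: Ck_derive].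
Qed.

Lemma Ck_sum E F k (A : set E) I (r : seq I) (f : I -> E -> F) : open A ->
  (forall i, Ck k A (f i)) -> Ck k A (fun x => \sum_(i <- r) f i x).
Proof.
move=> oA cf; elim: r => [|i r IH].
  under eq_fun do rewrite big_nil; exact: Ck_cst.
under eq_fun do rewrite big_cons; exact: Ck_add.
Qed.

(** By the chain rule $D_v(g\circ f)=\sum_i l_i(D_vf)\,(D_{b_i}g)\circ f$. Expanding the moving
    direction $D_vf$ in a fixed basis leaves only derivatives of [g] in constant directions, to
    which the induction hypothesis applies. *)
Lemma Ck_comp E F G {fE : findim E} {fF : findim F} {fG : findim G} k
    (A : set E) (B : set F) (f : E -> F) (g : F -> G) :
  open A -> open B -> (forall x, A x -> B (f x)) ->
  Ck k A f -> Ck k B g -> Ck k A (fun x => g (f x)).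
Proof.
move=> oA oB AB; elim: k G fG g => [|k IH] G fG g cf cg.
  split=> // x Ax; apply: (@continuous_comp _ _ _ f g); first exact: Ck_continuous cf _.
  by apply: (Ck_continuous cg); exact: AB.
have dd x (Ax : A x) : differentiable f x /\ differentiable g (f x).
  by split; [exact: Ck1_differentiable cf Ax|exact: (Ck1_differentiable oB cg (AB _ Ax))].
split.
  move=> x Ax; apply: (@continuous_comp _ _ _ f g); first exact: Ck_continuous cf _.
  by apply: (Ck_continuous cg); exact: AB.
move=> v; split.
  move=> x Ax; apply: diff_derivable; have [df dg] := dd x Ax.
  exact: (differentiable_comp df dg).
have [[d [b [l [cl lE]]]]] := fF.
apply: (@Ck_eq _ _ _ _ (fun x => \sum_i l i ('D_v f x) *: 'D_(b i) g (f x))) => //.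
  move=> x Ax; have [df dg] := dd x Ax; rewrite [RHS](derive_comp v df dg) [in RHS](lE ('D_v f x)).
  rewrite [RHS]deriveE// linear_sum; apply: eq_bigr => i _.
  by rewrite (deriveE (b i) dg) [RHS]linearZ.
apply: Ck_sum => // i; apply: Ck_scale => //.
  by apply: Ck_lin_comp => //; exact: Ck_derive.
by apply: (IH G fG ('D_(b i) g)); [exact: CkW|exact: Ck_derive].
Qed.

End Calculus.

#[global] Instance findim_R_inst (R : realType) : findim (R^o : normedModType R) := findim_R R.
#[global] Instance findim_rV_inst (R : realType) n : findim ('rV[R]_n : normedModType R) := findim_rV R n.
#[global] Instance findim_prod_inst (R : realType) (E F : normedModType R) :
  findim E -> findim F -> findim ((E * F)%type : normedModType R) := @findim_prod R E F.

(** * Smooth maps, elementary functions and cutoffs *)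

Section Smooth.
Variable R : realType.
Implicit Types E F G : normedModType R.

Lemma smooth_cst E F (A : set E) (a : F) : smooth A (fun _ => a).
Proof. by move=> k; exact: Ck_cst. Qed.

Lemma smooth_linear E F (A : set E) (f : E -> F) : linear f -> continuous f -> smooth A f.
Proof. by move=> lf cf k; exact: Ck_linear. Qed.

Lemma smooth_id E (A : set E) : smooth A (fun x => x).
Proof. by apply: smooth_linear => // x; exact: cvg_id. Qed.

Lemma smooth_fst E F (A : set (E * F)) : smooth A fst.
Proof. by apply: smooth_linear => // x; exact: cvg_fst. Qed.

Lemma smooth_snd E F (A : set (E * F)) : smooth A snd.
Proof. by apply: smooth_linear => // x; exact: cvg_snd. Qed.

Lemma smooth_subset E F (A B : set E) (f : E -> F) : A `<=` B -> smooth B f -> smooth A f.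
Proof. by move=> AB cf k; exact: Ck_subset (cf k). Qed.

Lemma smooth_eq E F (A : set E) (f g : E -> F) : open A ->
  (forall y, A y -> f y = g y) -> smooth A f -> smooth A g.
Proof. by move=> oA fg cf k; exact: Ck_eq fg (cf k). Qed.

Lemma smooth_local E F (A : set E) (f : E -> F) :
  (forall x, A x -> exists U : set E, U x /\ smooth U f) -> smooth A f.
Proof. by move=> h k; apply: Ck_local => x /h[U [Ux]] /(_ k); exists U. Qed.

Lemma smoothD E F (A : set E) (f g : E -> F) : open A ->
  smooth A f -> smooth A g -> smooth A (fun x => f x + g x).
Proof. by move=> oA cf cg k; exact: Ck_add. Qed.

Lemma smoothZ E F (A : set E) (a : E -> R) (w : E -> F) : open A ->
  smooth A (a : E -> R^o) -> smooth A w -> smooth A (fun x => a x *: w x).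
Proof. by move=> oA ca cw k; exact: Ck_scale. Qed.

Lemma smoothN E F (A : set E) (f : E -> F) : open A ->
  smooth A f -> smooth A (fun x => - f x).
Proof.
move=> oA cf; apply: (@smooth_eq _ _ _ (fun x => (-1) *: f x)) => // [y _|].
  by rewrite scaleN1r.
exact: smoothZ (smooth_cst _ _) _.
Qed.

Lemma smoothB E F (A : set E) (f g : E -> F) : open A ->
  smooth A f -> smooth A g -> smooth A (fun x => f x - g x).
Proof. by move=> oA cf cg; apply: smoothD => //; exact: smoothN. Qed.

Lemma smoothM E (A : set E) (f g : E -> R) : open A ->
  smooth A (f : E -> R^o) -> smooth A (g : E -> R^o) -> smooth A (fun x => f x * g x : R^o).
Proof. exact: (@smoothZ E R^o). Qed.

Lemma smooth_sum E F (A : set E) I (r : seq I) (f : I -> E -> F) : open A ->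
  (forall i, smooth A (f i)) -> smooth A (fun x => \sum_(i <- r) f i x).
Proof. by move=> oA cf k; apply: Ck_sum => // i; exact: cf. Qed.

Lemma smooth_comp E F G {fE : findim E} {fF : findim F} {fG : findim G}
    (A : set E) (B : set F) (f : E -> F) (g : F -> G) :
  open A -> open B -> (forall x, A x -> B (f x)) ->
  smooth A f -> smooth B g -> smooth A (fun x => g (f x)).
Proof. by move=> oA oB AB cf cg k; exact: (Ck_comp oA oB AB). Qed.

Lemma smooth_lin_comp E F G (A : set E) (L : F -> G) (f : E -> F) : open A ->
  linear L -> continuous L -> smooth A f -> smooth A (fun x => L (f x)).
Proof.
move=> oA lL cL cf k.
exact: (@Ck_lin_comp R E F G k A (HB.pack L (GRing.isLinear.Build _ _ _ _ L lL) : {linear F -> G})).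
Qed.

Lemma smooth_pair E F G (A : set E) (f : E -> F) (g : E -> G) : open A ->
  smooth A f -> smooth A g -> smooth A (fun x => (f x, g x)).
Proof.
move=> oA cf cg.
apply: (@smooth_eq _ _ _ (fun x => (f x, 0) + (0, g x))) => // [x _|].
  by rewrite -[LHS]/(_, _) /= addr0 add0r.
apply: smoothD => //.
  apply: (@smooth_lin_comp _ _ _ _ (fun y => (y, 0 : G))) => //.
    by move=> a u v; rewrite -[RHS]/(_, _) /= scaler0 addr0.
  by move=> y; apply: cvg_pair; [exact: cvg_id|exact: cvg_cst].
apply: (@smooth_lin_comp _ _ _ _ (fun y => (0 : F, y))) => //.
  by move=> a u v; rewrite -[RHS]/(_, _) /= scaler0 addr0.
by move=> y; apply: cvg_pair; [exact: cvg_cst|exact: cvg_id].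
Qed.

Lemma smooth_continuous E F (A : set E) (f : E -> F) x :
  smooth A f -> A x -> {for x, continuous f}.
Proof. by move=> /(_ 0%N); exact: Ck_continuous. Qed.

Lemma smooth_derive E F (A : set E) (f : E -> F) v : smooth A f -> smooth A ('D_v f).
Proof. by move=> cf k; exact: Ck_derive (cf k.+1). Qed.

Lemma smooth_differentiable E F {fE : findim E} {fF : findim F} (A : set E) (f : E -> F) x :
  open A -> smooth A f -> A x -> differentiable f x.
Proof. by move=> oA /(_ 1%N); exact: Ck1_differentiable. Qed.

Lemma open_preimage E F (A : set E) (f : E -> F) (B : set F) : open A ->
  (forall x, A x -> {for x, continuous f}) -> open B -> open (A `&` f @^-1` B).
Proof.
move=> oA cf oB; rewrite openE => x [Ax Bx]; apply: filterI; first exact: open_nbhs_nbhs.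
by apply: (cf x Ax); exact: open_nbhs_nbhs.
Qed.

Lemma derive_R_scale F (f : R -> F) x v : derivable f x 1 -> 'D_v f x = v *: 'D_1 f x.
Proof.
move=> /derivable1_diffP df; rewrite !deriveE// -linearZ.
by congr ('d f x _); rewrite [_ *: _]mulr1.
Qed.

(** If each derivative in a family is a finite linear combination of members of the family,
    induction on the order treats all members at once. Sine and cosine, negative powers, the square
    root and the flat function all fall under this scheme. *)
Lemma smooth_family I (fam : I -> R -> R) (D : I -> seq (R * I)) (A : set R) : open A ->
  (forall i x, A x -> is_derive x (1 : R) (fam i : R -> R^o) (\sum_(c <- D i) c.1 * fam c.2 x)) ->
  forall i, smooth A (fam i : R -> R^o).
Proof.
move=> oA dfam i k; elim: k i => [|k IH] i; (split;
  first by move=> x Ax; apply/differentiable_continuous/derivable1_diffP; case: (dfam i x Ax)) => //.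
move=> v; have H x (Ax : A x) : 'D_v (fam i : R -> R^o) x = v *: \sum_(c <- D i) (c.1 * fam c.2 x).
  by have [d1 e1] := dfam i x Ax; rewrite derive_R_scale// e1.
split.
  by move=> x Ax; have [/derivable1_diffP d1 _] := dfam i x Ax; exact: diff_derivable.
apply: (@Ck_eq _ _ _ _ _ (fun x => v *: \sum_(c <- D i) (c.1 * fam c.2 x : R^o))) => //.
  by move=> x Ax; rewrite H.
apply: Ck_scale => //; first exact: Ck_cst.
apply: Ck_sum => // c; apply: (@Ck_scale _ _ R^o) => //; exact: Ck_cst.
Qed.

Lemma smooth_cos (A : set R) : smooth A (@cos R : R -> R^o).
Proof.
apply: (@smooth_subset _ _ _ setT) => //.
apply: (@smooth_family bool (fun b => if b then @cos R else @sin R)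
  (fun b => if b then [:: (-1, false)] else [:: (1, true)]) _ openT _ true) => -[] x _;
  rewrite big_seq1 /= ?mulN1r ?mul1r; exact: _.
Qed.

Lemma smooth_sin (A : set R) : smooth A (@sin R : R -> R^o).
Proof.
apply: (@smooth_subset _ _ _ setT) => //.
apply: (@smooth_family bool (fun b => if b then @cos R else @sin R)
  (fun b => if b then [:: (-1, false)] else [:: (1, true)]) _ openT _ false) => -[] x _;
  rewrite big_seq1 /= ?mulN1r ?mul1r; exact: _.
Qed.

Lemma scaleRE (a b : R) : a *: (b : R^o) = a * b. Proof. by []. Qed.

Lemma is_derive_negX (x : R) j : x != 0 ->
  is_derive x (1 : R) (fun y : R => y ^- j : R^o) (- j%:R * x ^- j.+1).
Proof.
move=> x0; case: j => [|j].
  rewrite oppr0 mul0r (_ : (fun y : R => y ^- 0 : R^o) = cst 1); first exact: is_derive_cst.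
  by apply/funext => y; rewrite expr0 invr1.
have dX : is_derive x (1 : R) (fun y : R => y ^+ j.+1 : R^o) (j.+1%:R * x ^+ j).
  split; first exact: exprn_derivable.
  by rewrite exp_derive [LHS]mulr1.
have xj : (fun y : R => y ^+ j.+1) x != 0 by rewrite /= expf_eq0.
have := @is_deriveV R (fun y => y ^+ j.+1) x _ 1 xj dX; rewrite /= => H.
apply: is_derive_eq; rewrite !scaleRE mulNr mulNr; congr (- _).
rewrite !exprS expr0; field.
by rewrite expf_eq0 x0 (negbTE x0) andbF.
Qed.

Lemma smooth_inv : smooth [set x : R | x != 0] (fun x => x^-1 : R^o).
Proof.
have -> : (fun x : R => x^-1 : R^o) = (fun x => x ^- 1 : R^o) by [].
apply: (@smooth_family nat (fun j x => x ^- j) (fun j => [:: (- j%:R, j.+1)])); first exact: open_neq.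
by move=> j x /= x0; rewrite big_seq1; exact: is_derive_negX.
Qed.

Lemma smooth_sqrt : smooth [set x : R | 0 < x] (fun x => Num.sqrt x : R^o).
Proof.
have -> : (fun x : R => Num.sqrt x : R^o) = (fun x => Num.sqrt x * x ^- 0 : R^o).
  by apply/funext => x; rewrite expr0 invr1 mulr1.
(* The derivative of $\sqrt{x}\,x^{-j}$ is $(1/2-j)\sqrt{x}\,x^{-(j+1)}$, so this family is
   closed. *)
apply: (@smooth_family nat (fun j x => Num.sqrt x * x ^- j)
  (fun j => [:: (2^-1 - j%:R, j.+1)])); first exact: open_gt.
move=> j x /= x0; rewrite big_seq1 /=.
have dS := is_derive1_sqrt x0.
have dX := is_derive_negX j (lt0r_neq0 x0).
apply: is_derive_eq; rewrite /= !scaleRE.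
have s0 : Num.sqrt x != 0 by rewrite lt0r_neq0// sqrtr_gt0.
have e : x = Num.sqrt x ^+ 2 by rewrite sqr_sqrtr// ltW.
set s := Num.sqrt x in s0 e *; rewrite e !exprS; field.
by rewrite expr0 mulr1 expf_neq0 ?mulf_neq0.
Qed.

Lemma smoothV E {fE : findim E} (A : set E) (f : E -> R) : open A ->
  (forall x, A x -> f x != 0) -> smooth A (f : E -> R^o) -> smooth A (fun x => (f x)^-1 : R^o).
Proof.
move=> oA f0 cf.
by apply: (@smooth_comp E R^o R^o _ _ _ A [set x : R | x != 0]) smooth_inv => //; exact: open_neq.
Qed.

Lemma smooth_sqrt_comp E {fE : findim E} (A : set E) (f : E -> R) : open A ->
  (forall x, A x -> 0 < f x) -> smooth A (f : E -> R^o) ->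
  smooth A (fun x => Num.sqrt (f x) : R^o).
Proof.
move=> oA f0 cf.
by apply: (@smooth_comp E R^o R^o _ _ _ A [set x : R | 0 < x]) smooth_sqrt => //; exact: open_gt.
Qed.

Lemma smooth_cos_comp E {fE : findim E} (A : set E) (f : E -> R) : open A ->
  smooth A (f : E -> R^o) -> smooth A (fun x => cos (f x) : R^o).
Proof.
move=> oA cf.
by apply: (@smooth_comp E R^o R^o _ _ _ A setT) (smooth_cos _) => //; exact: openT.
Qed.

Lemma smooth_sin_comp E {fE : findim E} (A : set E) (f : E -> R) : open A ->
  smooth A (f : E -> R^o) -> smooth A (fun x => sin (f x) : R^o).
Proof.
move=> oA cf.
by apply: (@smooth_comp E R^o R^o _ _ _ A setT) (smooth_sin _) => //; exact: openT.
Qed.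

(** [flat 0] is Cauchy's flat function $e^{-1/x}$. The factors $x^{-j}$ are there to obtain a family
    closed under differentiation, as required by [smooth_family]. *)
Definition flat (j : nat) (x : R) : R := if 0 < x then x ^- j * expR (- x^-1) else 0.

(** The term of order $j+1$ of the exponential series gives $e^{1/x}\ge x^{-(j+1)}/(j+1)!$. At 0 the
    difference quotient of [flat j] is [flat j.+1], and this bound sends it to 0. *)
Lemma flat_bound j x : `|flat j x| <= j.+1`!%:R * `|x|.
Proof.
rewrite /flat; case: ifP => x0; last by rewrite normr0 mulr_ge0.
rewrite !ger0_norm ?(ltW x0)//; last by rewrite mulr_ge0 ?expR_ge0// invr_ge0 exprn_ge0// ltW.
have : (x ^-1) ^+ j.+1 / j.+1`!%:R <= expR (x^-1).
  by apply: le_trans (expR_ge1Dxn j _); [rewrite lerDr|rewrite invr_ge0 ltW].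
rewrite expRN => H.
have e0 : 0 < expR (x^-1) by exact: expR_gt0.
have f0 : 0 < (j.+1`!)%:R :> R by rewrite ltr0n fact_gt0.
rewrite ler_pdivrMr// -ler_pdivrMl; last by rewrite mulr_gt0.
apply: le_trans H; rewrite exprVn exprS.
have xj : x ^+ j != 0 by rewrite expf_eq0 (gt_eqF x0) andbF.
rewrite le_eqVlt; apply/orP; left; apply/eqP; field.
by rewrite xj (gt_eqF f0) (gt_eqF x0).
Qed.

Lemma is_derive_flat j x :
  is_derive x (1 : R) (flat j : R -> R^o) (- j%:R * flat j.+1 x + flat j.+2 x).
Proof.
have [x0|x0|->] := ltgtP x 0.
- have -> : - j%:R * flat j.+1 x + flat j.+2 x = 0 by rewrite /flat ltNge (ltW x0) mulr0 addr0.
  apply: (@near_eq_is_derive R R^o R^o (cst 0) (flat j) x 1 0 _ (is_derive_cst _ _ _)).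
  have : nbhs x [set y : R | y < 0] by apply: open_nbhs_nbhs; split=> //; exact: open_lt.
  by apply: filterS => y /= y0; rewrite /flat ltNge ltW.
- apply: (@near_eq_is_derive R R^o R^o (fun y => y ^- j * expR (- y^-1))).
    have : nbhs x [set y : R | 0 < y] by apply: open_nbhs_nbhs; split=> //; exact: open_gt.
    by apply: filterS => y /= y0; rewrite /flat y0.
  have dX := is_derive_negX j (lt0r_neq0 x0).
  have d1 : is_derive x (1 : R) (fun y : R => - y^-1 : R^o) (x ^- 2).
    have := @is_derive_negX x 1 (lt0r_neq0 x0); rewrite mulN1r => H.
    have -> : (fun y : R => - y^-1 : R^o) = - (fun y : R => y ^- 1 : R^o).
      by apply/funext => y; rewrite fctE expr1.
    by apply: is_derive_eq; rewrite opprK.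
  have d2 := @is_derive1_comp R (@expR R) (fun y => - y^-1) x _ _ (is_derive_expR _) d1.
  apply: is_derive_eq; rewrite /flat x0 /= !scaleRE.
  rewrite !exprS; field.
  by rewrite expf_eq0 (gt_eqF x0) andbF.
- have -> : - j%:R * flat j.+1 0 + flat j.+2 0 = 0 by rewrite /flat ltxx mulr0 addr0.
  have H : h^-1 *: (((flat j : R -> R^o) \o shift 0) (h *: (1 : R)) - flat j 0) @[h --> (0:R)^'] --> (0 : R^o).
    apply/cvgrPdist_le => e e0; near=> h.
    rewrite sub0r normrN /= addr0 [h *: _]mulr1 [flat j 0]/flat ltxx subr0.
    have h0 : h != 0 by near: h; exact: nbhs_dnbhs_neq.
    rewrite (_ : h^-1 *: _ = flat j.+1 h); last first.
      by rewrite /flat; case: ifP => _; rewrite scaleRE ?mulr0// exprS invfM mulrA.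
    apply: le_trans (flat_bound _ _) _; rewrite -ler_pdivlMl ?ltr0n ?fact_gt0//.
    near: h; apply: dnbhs0_le; rewrite mulr_gt0// invr_gt0 ltr0n fact_gt0 //.
  by split; [apply/cvg_ex; eexists; exact: H|exact: cvg_lim H].
Unshelve. all: by end_near. Qed.

Lemma smooth_flat (A : set R) : smooth A (flat 0 : R -> R^o).
Proof.
apply: (@smooth_subset _ _ _ setT) => //.
apply: (@smooth_family nat flat (fun j => [:: (- j%:R, j.+1); (1, j.+2)]) setT openT) => j x _.
by rewrite big_cons big_seq1 /= mul1r; exact: is_derive_flat.
Qed.

(** For $a<b$ this is the descending smooth step: 1 for $t\le a$, 0 for $t\ge b$. *)
Definition cutoff (a b t : R) : R := flat 0 (b - t) / (flat 0 (b - t) + flat 0 (t - a)).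

Lemma flat_ge0 x : 0 <= flat 0 x.
Proof. by rewrite /flat; case: ifP => // _; rewrite expr0 invr1 mul1r expR_ge0. Qed.

Lemma flat_gt0 x : 0 < x -> 0 < flat 0 x.
Proof. by move=> x0; rewrite /flat x0 expr0 invr1 mul1r expR_gt0. Qed.

Lemma flat_eq0 x : x <= 0 -> flat 0 x = 0.
Proof. by move=> x0; rewrite /flat ltNge x0. Qed.

Lemma cutoff1 a b t : a < b -> t <= a -> cutoff a b t = 1.
Proof.
move=> ab ta; rewrite /cutoff [flat 0 (t - a)]flat_eq0 ?subr_le0// addr0 divff//.
by rewrite gt_eqF// flat_gt0// subr_gt0 (le_lt_trans ta).
Qed.

Lemma cutoff0 a b t : b <= t -> cutoff a b t = 0.
Proof. by move=> bt; rewrite /cutoff flat_eq0 ?mul0r// subr_le0. Qed.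

Lemma cutoff_den a b t : a < b -> 0 < flat 0 (b - t) + flat 0 (t - a).
Proof.
move=> ab; have [tb|bt] := ltP t b.
  by rewrite ltr_pwDl ?flat_ge0// flat_gt0// subr_gt0.
by rewrite ltr_wpDl ?flat_ge0// flat_gt0// subr_gt0 (lt_le_trans ab).
Qed.

Lemma cutoff_ge0 a b t : a < b -> 0 <= cutoff a b t.
Proof. by move=> ab; rewrite divr_ge0 ?flat_ge0// ltW ?cutoff_den. Qed.

Lemma cutoff_le1 a b t : a < b -> cutoff a b t <= 1.
Proof. by move=> ab; rewrite ler_pdivrMr ?cutoff_den// mul1r lerDl flat_ge0. Qed.

Lemma smooth_cutoff a b (A : set R) : a < b -> smooth A (cutoff a b : R -> R^o).
Proof.
move=> ab; apply: (@smooth_subset _ _ _ setT) => //.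
have sm (f : R -> R) : smooth setT (f : R -> R^o) -> smooth setT (fun t => flat 0 (f t) : R^o).
  move=> sf; apply: (@smooth_comp R^o R^o R^o _ _ _ setT setT _ _ openT openT _ sf) => //.
  exact: smooth_flat.
have s1 : smooth setT (fun t => flat 0 (b - t) : R^o).
  by apply: sm; apply: (@smoothB R^o R^o); [exact: openT|exact: smooth_cst|exact: smooth_id].
have s2 : smooth setT (fun t => flat 0 (t - a) : R^o).
  by apply: sm; apply: (@smoothB R^o R^o); [exact: openT|exact: smooth_id|exact: smooth_cst].
apply: (@smoothM R^o) => //; first exact: openT.
apply: (@smoothV R^o); [exact: openT|by move=> t _; rewrite gt_eqF// cutoff_den|].
by apply: (@smoothD R^o R^o) => //; exact: openT.
Qed.

Lemma smooth_cutoff_comp E {fE : findim E} a b (A : set E) (f : E -> R) : open A -> a < b ->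
  smooth A (f : E -> R^o) -> smooth A (fun x => cutoff a b (f x) : R^o).
Proof.
move=> oA ab cf.
by apply: (@smooth_comp E R^o R^o _ _ _ A setT) (smooth_cutoff _ ab) => //; exact: openT.
Qed.

End Smooth.

(** * Smoothness near a set, tangent vectors and pullbacks *)

Section SmoothNear.
Variable R : realType.
Implicit Types E F G : normedModType R.

Lemma open_oo (a b : R) : open (fun t : R => a < t < b : Prop).
Proof.
rewrite (_ : (fun t : R => _) = [set t | a < t] `&` [set t | t < b]).
  by apply: openI; [exact: open_gt|exact: open_lt].
by apply/seteqP; split=> t /=; [move=> /andP[]|move=> [-> ->]].
Qed.

Lemma smooth_near_sub E F (X Y : set E) (f : E -> F) :
  X `<=` Y -> smooth_near Y f -> smooth_near X f.
Proof. by move=> XY [U [oU YU sf]]; exists U; split=> // x /XY /YU. Qed.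

Lemma smooth_nearT E F (X : set E) (f : E -> F) : smooth setT f -> smooth_near X f.
Proof. by move=> sf; exists setT; split=> //; exact: openT. Qed.

Lemma smooth_near_differentiable E F {fE : findim E} {fF : findim F} (X : set E) (f : E -> F) x :
  smooth_near X f -> X x -> differentiable f x.
Proof. by move=> [U [oU XU sf]] /XU; exact: smooth_differentiable. Qed.

Lemma smooth_near_comp E F G {fE : findim E} {fF : findim F} {fG : findim G}
    (X : set E) (Y : set F) (f : E -> F) (g : F -> G) :
  (forall x, X x -> Y (f x)) ->
  smooth_near X f -> smooth_near Y g -> smooth_near X (fun x => g (f x)).
Proof.
move=> XY [U [oU XU sf]] [V [oV YV sg]].
have oW : open (U `&` f @^-1` V).
  by apply: open_preimage => // x; exact: smooth_continuous.
exists (U `&` f @^-1` V); split=> // [x Xx|].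
  by split; [exact: XU|exact/YV/XY].
apply: (@smooth_comp _ _ _ _ _ _ _ _ V f g oW oV) => //; first by move=> x [].
by apply: smooth_subset sf => x [].
Qed.

Lemma smooth_near_pair E F G (X : set E) (f : E -> F) (g : E -> G) :
  smooth_near X f -> smooth_near X g -> smooth_near X (fun x => (f x, g x)).
Proof.
move=> [U [oU XU sf]] [V [oV XV sg]]; exists (U `&` V); split; first exact: openI.
  by move=> x Xx; split; [exact: XU|exact: XV].
apply: smooth_pair; [exact: openI| |].
  by apply: smooth_subset sf => x [].
by apply: smooth_subset sg => x [].
Qed.

Lemma derive_curve E F {fE : findim E} {fF : findim F} (c : R -> E) (f : E -> F) (e : R) :
  0 < e -> smooth (fun t : R => - e < t < e) c -> differentiable f (c 0) ->
  is_derive (0 : R) (1 : R) (fun t => f (c t)) ('D_(derive1 c 0) f (c 0)).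
Proof.
move=> e0 sc df.
have dc : differentiable (c : R^o -> E) 0.
  by apply: (smooth_differentiable (@open_oo (- e) e) sc); rewrite oppr_lt0 e0.
split; first exact/derivable1_diffP/(differentiable_comp dc df).
by rewrite (derive_comp _ dc df) derive1E.
Qed.

(** A derivative that exists can be computed from one side only. Curves in the definition of
    [tangent] are in [X] for times of one sign, which is all that is available at a boundary
    point. *)
Lemma derive_zero_side F (f : R -> F) (e : R) : 0 < e -> derivable f 0 1 ->
  (forall t, 0 <= t < e -> f t = 0) \/ (forall t, - e < t <= 0 -> f t = 0) -> 'D_1 f 0 = 0.
Proof.
move=> e0 df H; rewrite /derive.
have f0 : f 0 = 0 by case: H; apply; rewrite lexx ?e0 // oppr_lt0 e0.
case: H => H.
  rewrite cvg_at_rightE //; apply: lim_near_cst => //; near=> t.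
  rewrite /= addr0 [t *: _]mulr1 f0 subr0 H ?scaler0//.
  by apply/andP; split; [apply: ltW; near: t; exact: nbhs_right_gt|near: t; exact: nbhs_right_lt].
rewrite cvg_at_leftE //; apply: lim_near_cst => //; near=> t.
rewrite /= addr0 [t *: _]mulr1 f0 subr0 H ?scaler0//.
by apply/andP; split; [near: t; apply: nbhs_left_gt; rewrite oppr_lt0|apply: ltW; near: t; exact: nbhs_left_lt].
Unshelve. all: by end_near. Qed.

Lemma derive_ge0_right (f : R -> R^o) (e : R) : 0 < e -> derivable f 0 1 -> f 0 = 0 ->
  (forall t, 0 <= t < e -> 0 <= f t) -> 0 <= 'D_1 f 0.
Proof.
move=> e0 df f0 H; rewrite /derive cvg_at_rightE //.
apply: limr_ge.
  have := df; rewrite /derivable => /cvg_ex[l Hl]; apply/cvg_ex; exists l.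
  exact: cvg_dnbhs_at_right Hl.
near=> t; rewrite /= addr0 [t *: _]mulr1 f0 subr0.
have t0 : 0 < t by near: t; exact: nbhs_right_gt.
rewrite scaleRE mulr_ge0 ?invr_ge0 ?(ltW t0)//; apply: H.
by rewrite (ltW t0) /=; near: t; exact: nbhs_right_lt.
Unshelve. all: by end_near. Qed.

Lemma tangent_mem E (X : set E) x v : tangent X x v -> X x.
Proof. by move=> [c [e [e0 sc <- _ [] H]]]; apply: H; rewrite lexx ?e0// oppr_lt0 e0. Qed.

(** The difference of the two maps vanishes along one half of a curve with velocity [v]. Hence
    derivatives in tangent directions depend only on values on [X], and representatives can be
    exchanged. *)
Lemma tangent_derive_eq E F {fE : findim E} {fF : findim F} (X : set E) (f g : E -> F) x v :
  differentiable f x -> differentiable g x -> (forall y, X y -> f y = g y) ->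
  tangent X x v -> 'D_v f x = 'D_v g x.
Proof.
move=> df dg fg [c [e [e0 sc c0 <- H]]]; subst x; apply/eqP; rewrite -subr_eq0; apply/eqP.
have [d1 e1] : is_derive (0 : R) (1 : R) (fun t => f (c t)) ('D_(derive1 c 0) f (c 0)).
  exact: (derive_curve e0 sc).
have [d2 e2] : is_derive (0 : R) (1 : R) (fun t => g (c t)) ('D_(derive1 c 0) g (c 0)).
  exact: (derive_curve e0 sc).
rewrite -e1 -e2 -deriveB//; apply: (derive_zero_side e0); first exact: derivableB.
by case: H => H; [left|right] => t /H Xc; rewrite fctE /= fg ?subrr.
Qed.

Lemma tangent_near E (X U : set E) x v : open U -> U x ->
  tangent X x v -> tangent (X `&` U) x v.
Proof.
move=> oU Ux [c [e [e0 sc c0 dc H]]].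
have cc : {for 0, continuous c}.
  by apply: (smooth_continuous sc); rewrite oppr_lt0 e0.
have : nbhs (0 : R) (c @^-1` U) by apply: cc; rewrite c0; exact: open_nbhs_nbhs.
move=> /nbhs_normP[d /= d0 Hd].
have He t : - Num.min e d < t < Num.min e d -> (- e < t < e) /\ U (c t).
  move=> /andP[t1 t2]; split.
    apply/andP; split; last by apply: lt_le_trans t2 _; rewrite ge_min lexx.
    by apply: le_lt_trans t1; rewrite lerN2 ge_min lexx.
  apply: Hd => /=; rewrite sub0r normrN ltr_norml; apply/andP; split.
    by apply: le_lt_trans t1; rewrite lerN2 ge_min lexx orbT.
  by apply: lt_le_trans t2 _; rewrite ge_min lexx orbT.
exists c, (Num.min e d); split=> //; first by rewrite lt_min e0.
  by apply: smooth_subset sc => t /He[].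
have m0 : 0 < Num.min e d by rewrite lt_min e0.
case: H => H; [left|right] => t /andP[t1 t2].
  have /He[/andP[t3 t4] Ut] : - Num.min e d < t < Num.min e d.
    by rewrite t2 andbT; apply: lt_le_trans t1; rewrite oppr_lt0.
  by split=> //; apply: H; rewrite t1.
have /He[/andP[t3 t4] Ut] : - Num.min e d < t < Num.min e d.
  by rewrite t1 /=; apply: le_lt_trans t2 _.
by split=> //; apply: H; rewrite t3.
Qed.

Lemma tangent_push E F {fE : findim E} {fF : findim F} (X : set E) (Y : set F) (f : E -> F) x v :
  smooth_near X f -> (forall y, X y -> Y (f y)) ->
  tangent X x v -> tangent Y (f x) ('D_v f x).
Proof.
move=> sf XY tv; have Xx := tangent_mem tv; have df : differentiable f x by exact: smooth_near_differentiable sf Xx.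
have [U [oU XU sfU]] := sf.
have [c [e [e0 sc c0 dc H]]] := tangent_near oU (XU _ Xx) tv.
(* The half of the curve outside [X] must stay in the domain of smoothness of [f] as well, for the
   image curve to be smooth on a full interval around 0. *)
pose W := (fun t : R => - e < t < e : Prop) `&` c @^-1` U.
have oW : open W by apply: open_preimage oU => [|t te]; [exact: open_oo|exact: smooth_continuous sc te].
have W0 : W 0 by split; [rewrite oppr_lt0 e0|rewrite /= c0; exact: XU].
have /nbhs_normP[d /= d0 Hd] : nbhs (0 : R) W by exact: open_nbhs_nbhs.
have Hd' t : - Num.min e d < t < Num.min e d -> W t.
  move=> /andP[t1 t2]; apply: Hd; rewrite /= sub0r normrN ltr_norml; apply/andP; split.
    by apply: le_lt_trans t1; rewrite lerN2 ge_min lexx orbT.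
  by apply: lt_le_trans t2 _; rewrite ge_min lexx orbT.
exists (fun t => f (c t)), (Num.min e d); split.
- by rewrite lt_min e0.
- apply: (@smooth_comp R R^o E F _ _ _ _ U) => //; first exact: open_oo.
    by move=> t /Hd'[].
  by apply: smooth_subset sc => t /Hd'[].
- by rewrite c0.
- rewrite derive1E -dc; rewrite -c0 in df *.
  by apply: derive_val; exact: (derive_curve e0 sc).
case: H => H; [left|right] => t /andP[t1 t2]; apply/XY.
  by have [] := H t _; rewrite // t1 /=; apply: lt_le_trans t2 _; rewrite ge_min lexx.
have [] // := H t _; rewrite t2 andbT; apply: le_lt_trans t1.
by rewrite lerN2 ge_min lexx.
Qed.

Lemma pullback2_comp E F G {fE : findim E} {fF : findim F} {fG : findim G}
    (X : set E) (Y : set F) (f : E -> F) (g : F -> G) a b c :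
  smooth_near X f -> smooth_near Y g -> (forall x, X x -> Y (f x)) ->
  pullback2 X f b a -> pullback2 Y g c b -> pullback2 X (fun x => g (f x)) c a.
Proof.
move=> sf sg XY fb gb x u v Xx tu tv.
have df : differentiable f x by exact: smooth_near_differentiable sf Xx.
have dg : differentiable g (f x) by exact: smooth_near_differentiable sg (XY _ Xx).
rewrite !(derive_comp _ df dg) -fb//; apply: gb; first exact: XY.
- exact: tangent_push tu.
- exact: tangent_push tv.
Qed.

Lemma embedding_comp E F G {fE : findim E} {fF : findim F} {fG : findim G}
    (X : set E) (Y : set F) (f : E -> F) (g : F -> G) : (forall x, X x -> Y (f x)) ->
  embedding X f -> embedding Y g -> embedding X (fun x => g (f x)).
Proof.
move=> XY [sf [f' [sf' f'K]]] [sg [g' [sg' g'K]]]; split.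
  exact: (smooth_near_comp XY).
exists (fun z => f' (g' z)); split; last by move=> x Xx; rewrite g'K ?f'K//; exact: XY.
apply: (@smooth_near_comp _ _ _ _ _ _ _ (f @` X)) => //.
  by move=> z [x Xx <-]; rewrite g'K; [exists x|exact: XY].
by apply: smooth_near_sub sg' => z [x Xx <-]; exists (f x) => //; exact: XY.
Qed.

End SmoothNear.

(** * Composition of symplectomorphisms and of isotopies of a page *)

Section Symplecto.
Variables (R : realType) (P : page R).
Let X := Defs.pset R P.

Lemma symplecto_mem phi x : symplecto R P phi -> X x -> X (phi x).
Proof. by move=> [_ im _ _] Xx; rewrite /X -im; exists x. Qed.

Lemma symplecto_comp phi psi : symplecto R P phi -> symplecto R P psi ->
  symplecto R P (fun x => psi (phi x)).
Proof.
move=> sphi spsi; have memphi := symplecto_mem sphi.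
have [ephi iphi pphi [U [oU bU idU]]] := sphi.
have [epsi ipsi ppsi [V [oV bV idV]]] := spsi.
split.
- exact: (embedding_comp memphi).
- rewrite -[RHS]ipsi -[X in _ = psi @` X]iphi; apply/seteqP; split=> [z [x Xx <-]|z [y [x Xx <-] <-]].
    by exists (phi x) => //; exists x.
  by exists x.
- by apply: (pullback2_comp _ _ memphi pphi ppsi); [case: ephi|case: epsi].
- exists (U `&` V); split; [exact: openI|by move=> x bx; split; [exact: bU|exact: bV]|].
  by move=> x Xx [Ux Vx]; rewrite idU// idV.
Qed.

Lemma symp_isotopic_comp phi0 phi1 psi0 psi1 :
  symp_isotopic R P phi0 phi1 -> symp_isotopic R P psi0 psi1 ->
  symp_isotopic R P (fun x => psi0 (phi0 x)) (fun x => psi1 (phi1 x)).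
Proof.
move=> [Phi [sm sy [U [oU bU idU]] P0 P1]] [Psi [sm' sy' [V [oV bV idV]] Q0 Q1]].
have s0 : 0 <= (0 : R) <= 1 by rewrite lexx ler01.
have s1 : 0 <= (1 : R) <= 1 by rewrite lexx ler01.
exists (fun z => Psi (z.1, Phi z)); split.
- apply: (smooth_near_comp (f := fun z => (z.1, Phi z)) _ _ sm').
    by move=> [s x] /= [s01 Xx]; split=> //; exact: (symplecto_mem (sy s s01)).
  by apply: smooth_near_pair sm; apply: smooth_nearT; exact: smooth_fst.
- by move=> s s01; exact: (symplecto_comp (sy s s01) (sy' s s01)).
- exists (U `&` V); split; [exact: openI|by move=> x bx; split; [exact: bU|exact: bV]|].
  by move=> s x s01 Xx [Ux Vx]; rewrite /= idU// idV.
- by move=> x Xx; rewrite /= P0// Q0// -P0//; exact: (symplecto_mem (sy 0 s0)).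
- by move=> x Xx; rewrite /= P1// Q1// -P1//; exact: (symplecto_mem (sy 1 s1)).
Qed.

End Symplecto.

(** * Derivative rules in a form suited to explicit formulas *)

Section DerivativeRules.
Variable R : realType.
Implicit Types E F G : normedModType R.

Lemma linear_continuous_findim E F {fE : findim E} (f : E -> F) : linear f -> continuous f.
Proof.
move=> lf; have [[d [b [l [cl lE]]]]] := fE.
pose fl : {linear E -> F} := HB.pack f (GRing.isLinear.Build _ _ _ _ f lf).
have -> : f = fun v => \sum_i l i v *: f (b i).
  apply/funext => v; rewrite [in LHS](lE v) -[LHS]/(fl _) linear_sum.
  by apply: eq_bigr => i _; rewrite linearZ.
apply: (continuous_big (op := +%R)) => [|i _ y]; first exact: add_continuous.
by apply: cvgZ; [exact: cl|exact: cvg_cst].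
Qed.

Lemma is_derive_line0 E F (f : E -> F) x v (df : F) :
  is_derive x v f df <-> is_derive (0 : R) (1 : R) (fun t : R => f (t *: v + x)) df.
Proof.
have e : (fun h : R => h^-1 *: ((f \o shift x) (h *: v) - f x)) =
  (fun h : R => h^-1 *: (((fun t : R => f (t *: v + x)) \o shift 0) (h *: (1 : R)) - f (0 *: v + x))).
  by apply/funext => h /=; rewrite addr0 [h *: (1 : R)]mulr1 scale0r add0r.
by split=> -[d1 d2]; split; rewrite /derivable /derive ?e // -e.
Qed.

Lemma is_deriveD_fun E F (f g : E -> F) x v df dg :
  is_derive x v f df -> is_derive x v g dg -> is_derive x v (fun y => f y + g y) (df + dg).
Proof. by move=> hf hg; exact: is_deriveD. Qed.

(** Restricted to a line, a derivable map is continuous; passing to the line thus avoids the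
    continuity assumption on [w] made in [is_derive_scale]. *)
Lemma is_deriveZ_fun E F (k : E -> R) (w : E -> F) x v (dk : R) dw :
  is_derive x v (k : E -> R^o) dk -> is_derive x v w dw ->
  is_derive x v (fun y => k y *: w y) (dk *: w x + k x *: dw).
Proof.
move=> /is_derive_line0 hk /is_derive_line0 hw; apply/is_derive_line0.
have [dk1 ek] := hk; have [dw1 ew] := hw.
have c : {for 0, continuous (fun t : R => w (t *: v + x))}.
  by apply/differentiable_continuous/derivable1_diffP.
have := is_derive_scale c dk1 dw1.
by rewrite ek ew scale0r add0r.
Qed.

Lemma is_deriveM_fun E (k w : E -> R) x v (dk dw : R) :
  is_derive x v (k : E -> R^o) dk -> is_derive x v (w : E -> R^o) dw ->
  is_derive x v (fun y => k y * w y : R^o) (dk * w x + k x * dw).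
Proof. exact: (@is_deriveZ_fun E R^o). Qed.

Lemma is_derive_linear_fun E F G {fF : findim F} (L : F -> G) (f : E -> F) x v df : linear L ->
  is_derive x v f df -> is_derive x v (fun y => L (f y)) (L df).
Proof.
move=> lL [d1 <-]; have cL : continuous L by exact: linear_continuous_findim.
exact: (@is_derive_lin_comp R E F G (HB.pack L (GRing.isLinear.Build _ _ _ _ L lL) : {linear F -> G})).
Qed.

Lemma is_derive_chain E (F : R -> R) (f : E -> R) x v (a df : R) :
  is_derive (f x) (1 : R) (F : R -> R^o) a -> is_derive x v (f : E -> R^o) df ->
  is_derive x v (fun y => F (f y) : R^o) (a * df).
Proof.
move=> dF /is_derive_line0 hf; apply/is_derive_line0.
apply: (@is_derive1_comp R F (fun t : R => f (t *: v + x))) hf.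
by rewrite scale0r add0r.
Qed.

Lemma is_derive_cst_fun E F (a : F) x v : is_derive x v (fun _ : E => a) 0.
Proof. exact: is_derive_cst. Qed.

Lemma is_derive_id_fun E x v : is_derive x v (fun y : E => y) v.
Proof. exact: is_derive_id. Qed.

Lemma is_derive_differentiable E F (f : E -> F) x v : differentiable f x ->
  is_derive x v f ('D_v f x).
Proof. by move=> df; apply/derivableP/diff_derivable. Qed.

End DerivativeRules.

(** * The cotangent bundle of the sphere and its normalized geodesic flow *)

Section Dot.
Variables (R : realType) (n : nat).
Implicit Types (x y u v : 'rV[R]_n.+1).
Local Notation dot := (dotp R n).

Lemma dotC x y : dot x y = dot y x.
Proof. by apply: eq_bigr => i _; rewrite mulrC. Qed.

Lemma dotDl x y u : dot (x + y) u = dot x u + dot y u.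
Proof. by rewrite -big_split; apply: eq_bigr => i _; rewrite mxE mulrDl. Qed.

Lemma dotZl a x u : dot (a *: x) u = a * dot x u.
Proof. by rewrite mulr_sumr; apply: eq_bigr => i _; rewrite mxE mulrA. Qed.

Lemma dotDr x y u : dot u (x + y) = dot u x + dot u y.
Proof. by rewrite !(dotC u) dotDl. Qed.

Lemma dotZr a x u : dot u (a *: x) = a * dot u x.
Proof. by rewrite !(dotC u) dotZl. Qed.

Lemma dotNl x u : dot (- x) u = - dot x u.
Proof. by rewrite -scaleN1r dotZl mulN1r. Qed.

Lemma dotNr x u : dot u (- x) = - dot u x.
Proof. by rewrite !(dotC u) dotNl. Qed.

Lemma dot0l u : dot 0 u = 0.
Proof. by rewrite -(scale0r 0) dotZl mul0r. Qed.

Lemma dot0r u : dot u 0 = 0.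
Proof. by rewrite dotC dot0l. Qed.

Lemma dot_ge0 x : 0 <= dot x x.
Proof. by apply: sumr_ge0 => i _; rewrite -expr2 sqr_ge0. Qed.

Lemma dot_eq0 x : (dot x x == 0) = (x == 0).
Proof.
apply/idP/eqP => [|->]; last by rewrite dot0l.
rewrite /dotp psumr_eq0 => [/allP H|i _]; last by rewrite -expr2 sqr_ge0.
apply/rowP => i; rewrite mxE; apply/eqP.
by have := H i (mem_index_enum _); rewrite -expr2 sqrf_eq0.
Qed.

Lemma dot_gt0 x : (0 < dot x x) = (x != 0).
Proof. by rewrite lt_neqAle dot_ge0 andbT eq_sym dot_eq0. Qed.

Lemma enorm_sqr x : enorm R n x ^+ 2 = dot x x.
Proof. by rewrite /enorm sqr_sqrtr// dot_ge0. Qed.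

Lemma enorm_ge0 x : 0 <= enorm R n x. Proof. exact: sqrtr_ge0. Qed.

Lemma enorm_gt0 x : (0 < enorm R n x) = (x != 0).
Proof. by rewrite /enorm sqrtr_gt0 dot_gt0. Qed.

Lemma enorm_neq0 x : (enorm R n x != 0) = (x != 0).
Proof. by rewrite -enorm_gt0 lt_neqAle enorm_ge0 andbT eq_sym. Qed.

Lemma enorm_le1 x : (enorm R n x <= 1) = (dot x x <= 1).
Proof. by rewrite -enorm_sqr expr_le1 ?enorm_ge0. Qed.

Lemma enorm_eq1 x : (enorm R n x = 1) <-> (dot x x = 1).
Proof.
rewrite -enorm_sqr; split=> [->|/eqP]; first by rewrite expr1n.
by rewrite sqrf_eq1 => /orP[/eqP//|/eqP h]; have := enorm_ge0 x; rewrite h ler0N1.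
Qed.

Lemma is_derive_dot (E : normedModType R) (f g : E -> 'rV[R]_n.+1) (z v : E) (df dg : 'rV[R]_n.+1) :
  is_derive z v f df -> is_derive z v g dg ->
  is_derive z v (fun z => dot (f z) (g z) : R^o) (dot df (g z) + dot (f z) dg).
Proof.
move=> hf hg.
have H i : is_derive z v (fun z => f z 0 i * g z 0 i : R^o) (df 0 i * g z 0 i + f z 0 i * dg 0 i).
  have lin : linear (fun w : 'rV[R]_n.+1 => w 0 i : R^o) by move=> a u w; rewrite !mxE.
  by apply: is_deriveM_fun; apply: (is_derive_linear_fun lin).
have e : (fun z => dot (f z) (g z) : R^o) = \sum_i (fun z => f z 0 i * g z 0 i : R^o).
  by apply/funext => w; rewrite fct_sumE.
rewrite e; have := @is_derive_sum R E R^o n.+1 _ z v _ H.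
by rewrite big_split.
Qed.

Lemma smooth_dot (E : normedModType R) (A : set E) (f g : E -> 'rV[R]_n.+1) : open A ->
  smooth A f -> smooth A g -> smooth A (fun z => dot (f z) (g z) : R^o).
Proof.
move=> oA sf sg; apply: (@smooth_sum R E R^o) => // i.
have lin : linear (fun w : 'rV[R]_n.+1 => w 0 i : R^o) by move=> a u w; rewrite !mxE.
pose proof (linear_continuous_findim lin) as cl.
pose proof (smooth_lin_comp oA lin cl sf) as h1; pose proof (smooth_lin_comp oA lin cl sg) as h2.
exact: (smoothM oA h1 h2).
Qed.

Lemma smooth_enorm (E : normedModType R) {fE : findim E} (A : set E) (f : E -> 'rV[R]_n.+1) :
  open A -> (forall z, A z -> f z != 0) ->
  smooth A f -> smooth A (fun z => enorm R n (f z) : R^o).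
Proof.
move=> oA f0 sf; apply: smooth_sqrt_comp => // [z Az|].
  by rewrite dot_gt0 f0.
exact: smooth_dot.
Qed.

Lemma is_derive_enorm (E : normedModType R) (f : E -> 'rV[R]_n.+1) (z v : E) (df : 'rV[R]_n.+1) : f z != 0 ->
  is_derive z v f df ->
  is_derive z v (fun z => enorm R n (f z) : R^o) (dot (f z) df / enorm R n (f z)).
Proof.
move=> f0 hf; have dd := is_derive_dot hf hf.
have s0 : 0 < dot (f z) (f z) by rewrite dot_gt0.
have H := @is_derive_chain R E Num.sqrt (fun w => dot (f w) (f w)) z v _ _ (is_derive1_sqrt s0) dd.
apply: is_derive_eq; rewrite -/(enorm R n (f z)) (dotC df).
by field; rewrite enorm_neq0.
Qed.

End Dot.

Section RowMx.
Variables (R : realType) (m n : nat).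

Lemma lsubmx_linear : linear (@lsubmx R 1 m n). Proof. exact: linearP. Qed.
Lemma rsubmx_linear : linear (@rsubmx R 1 m n). Proof. exact: linearP. Qed.

Lemma row_mxE_sum (a : 'rV[R]_m) (b : 'rV[R]_n) : row_mx a b = row_mx a 0 + row_mx 0 b.
Proof. by rewrite add_row_mx addr0 add0r. Qed.

Let linl : linear (fun a : 'rV[R]_m => row_mx a (0 : 'rV[R]_n)).
Proof. by move=> k u v; rewrite scale_row_mx add_row_mx scaler0 addr0. Qed.

Let linr : linear (fun b : 'rV[R]_n => row_mx (0 : 'rV[R]_m) b).
Proof. by move=> k u v; rewrite scale_row_mx add_row_mx scaler0 addr0. Qed.

Lemma is_derive_row_mx (E : normedModType R) (f : E -> 'rV[R]_m) (g : E -> 'rV[R]_n) (z v : E) (df : 'rV[R]_m) (dg : 'rV[R]_n) :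
  is_derive z v f df -> is_derive z v g dg ->
  is_derive z v (fun z => row_mx (f z) (g z)) (row_mx df dg).
Proof.
move=> hf hg; rewrite row_mxE_sum (_ : (fun z => _) = (fun z => row_mx (f z) 0 + row_mx 0 (g z))).
  apply: is_deriveD_fun; first exact: (is_derive_linear_fun linl).
  exact: (is_derive_linear_fun linr).
by apply/funext => w; rewrite row_mxE_sum.
Qed.

Lemma smooth_row_mx (E : normedModType R) (A : set E) (f : E -> 'rV[R]_m) (g : E -> 'rV[R]_n) :
  open A -> smooth A f -> smooth A g -> smooth A (fun z => row_mx (f z) (g z)).
Proof.
move=> oA sf sg; rewrite (_ : (fun z => _) = (fun z => row_mx (f z) 0 + row_mx 0 (g z))); last first.
  by apply/funext => w; rewrite row_mxE_sum.
apply: smoothD => //.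
  by apply: (smooth_lin_comp oA linl) => //; exact: linear_continuous_findim.
by apply: (smooth_lin_comp oA linr) => //; exact: linear_continuous_findim.
Qed.

Lemma smooth_lsubmx (E : normedModType R) (A : set E) (f : E -> 'rV[R]_(m + n)) :
  open A -> smooth A f -> smooth A (fun z => lsubmx (f z)).
Proof.
move=> oA sf; apply: (smooth_lin_comp oA lsubmx_linear) => //.
exact: linear_continuous_findim lsubmx_linear.
Qed.

Lemma smooth_rsubmx (E : normedModType R) (A : set E) (f : E -> 'rV[R]_(m + n)) :
  open A -> smooth A f -> smooth A (fun z => rsubmx (f z)).
Proof.
move=> oA sf; apply: (smooth_lin_comp oA rsubmx_linear) => //.
exact: linear_continuous_findim rsubmx_linear.
Qed.

Lemma is_derive_lsubmx (E : normedModType R) (f : E -> 'rV[R]_(m + n)) (z v : E) (df : 'rV[R]_(m + n)) :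
  is_derive z v f df -> is_derive z v (fun z => lsubmx (f z)) (lsubmx df).
Proof. exact: (is_derive_linear_fun lsubmx_linear). Qed.

Lemma is_derive_rsubmx (E : normedModType R) (f : E -> 'rV[R]_(m + n)) (z v : E) (df : 'rV[R]_(m + n)) :
  is_derive z v f df -> is_derive z v (fun z => rsubmx (f z)) (rsubmx df).
Proof. exact: (is_derive_linear_fun rsubmx_linear). Qed.

End RowMx.

Section Sigma.
Variables (R : realType) (n : nat).
Local Notation dot := (dotp R n).
Local Notation en := (enorm R n).
Local Notation E := 'rV[R]_(n.+1 + n.+1).
Implicit Types (z u v : E).

(** The form $d\lambda_{can}$ as a constant bilinear form of the ambient space: [lambda_can] is
    linear in its base point, so its exterior derivative does not depend on the point. *)
Definition omega u v : R := dot (rsubmx u) (lsubmx v) - dot (rsubmx v) (lsubmx u).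

Lemma extd_lambda z u v : extd (lambda_can R n) z u v = omega u v.
Proof.
rewrite /extd /omega /lambda_can; congr (_ - _).
  have l : linear (fun y : E => dot (rsubmx y) (lsubmx v) : R^o).
    by move=> a y w; rewrite !linearP dotDl dotZl.
  by have [_ ->] := is_derive_linear z u l.
have l : linear (fun y : E => dot (rsubmx y) (lsubmx u) : R^o).
  by move=> a y w; rewrite !linearP dotDl dotZl.
by have [_ ->] := is_derive_linear z v l.
Qed.

Definition on_TS z := dot (lsubmx z) (lsubmx z) = 1 /\ dot (lsubmx z) (rsubmx z) = 0.

(** The linearization of the equations of [on_TS]. Velocities of curves satisfy it by
    [tangent_on_TS], and on the disk bundle it suffices by [tangent_DTS]; computations with tangent
    vectors become algebra. *)
Definition tangent_TS z v :=
  dot (lsubmx z) (lsubmx v) = 0 /\ dot (lsubmx z) (rsubmx v) + dot (rsubmx z) (lsubmx v) = 0.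

(** Both the time and the point vary, over an arbitrary parameter space. This covers the radial
    twists and also the tube coordinates, where the time depends on further variables. *)
Lemma is_derive_sigma (F : normedModType R) (psi : F -> R) (f : F -> E) (q w : F) a v :
  rsubmx (f q) != 0 -> is_derive q w (psi : F -> R^o) a -> is_derive q w f v ->
  let x := lsubmx (f q) in let y := rsubmx (f q) in let r := en y in
  let c := cos (psi q) in let s := sin (psi q) in
  is_derive q w (fun p => sigma R n (psi p) (f p))
    (row_mx (c *: lsubmx v + (r^-1 * s) *: rsubmx v + (- s * a) *: x
             + (r^-1 * c * a - r^-3 * dot y (rsubmx v) * s) *: y)
            (- (r * s) *: lsubmx v + c *: rsubmx v
             - (r * c * a + r^-1 * dot y (rsubmx v) * s) *: x - (s * a) *: y)).
Proof.
move=> y0 hpsi hf x y r c s.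
have r0 : r != 0 by rewrite enorm_neq0.
have dx := is_derive_lsubmx hf; have dy := is_derive_rsubmx hf.
have dr := @is_derive_enorm R n F (fun p => rsubmx (f p)) q w _ y0 dy.
have dc := @is_derive_chain R F _ psi q w _ _ (is_derive_cos _) hpsi.
have ds := @is_derive_chain R F _ psi q w _ _ (is_derive_sin _) hpsi.
have dri : is_derive q w (fun p : F => (en (rsubmx (f p)))^-1 : R^o) (- r^-2 * (dot y (rsubmx v) / r)).
  apply: (@is_derive_chain R F (fun t => t^-1) (fun p => en (rsubmx (f p)))) dr.
  by have := @is_deriveV R id r 1 1 r0 (is_derive_id _ _); rewrite scaleRE mulr1.
have dm1 := is_deriveM_fun dri ds.
have dm2 := is_deriveM_fun dr ds.
have dn2 : is_derive q w (fun p : F => - (en (rsubmx (f p)) * sin (psi p)) : R^o)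
   (- (dot y (rsubmx v) / r * s + r * (c * a))) by exact: is_deriveN.
have D1 := is_deriveD_fun (is_deriveZ_fun dc dx) (is_deriveZ_fun dm1 dy).
have D2 := is_deriveD_fun (is_deriveZ_fun dn2 dx) (is_deriveZ_fun dc dy).
have D := is_derive_row_mx D1 D2.
apply: is_derive_eq; rewrite -/x -/y -/c -/s -/r; congr row_mx.
  apply/rowP => i; rewrite !mxE; field; exact: r0.
apply/rowP => i; rewrite !mxE; field; exact: r0.
Qed.

(** $\sigma_t$ is the Hamiltonian flow of $|y|$, so for constant time it preserves $\omega$; a
    variable time $\psi$ adds $d|y|\wedge d\psi$. The extra term vanishes when $\psi$ is a function
    of $|y|$, and in [rot_pullback] it is cancelled by the rotation of the disk factor. *)
Lemma omega_sigma (F : normedModType R) (psi : F -> R) (f : F -> E) (q w1 w2 : F) u v a b :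
  on_TS (f q) -> rsubmx (f q) != 0 -> tangent_TS (f q) u -> tangent_TS (f q) v ->
  is_derive q w1 f u -> is_derive q w2 f v ->
  is_derive q w1 (psi : F -> R^o) a -> is_derive q w2 (psi : F -> R^o) b ->
  let r := en (rsubmx (f q)) in
  omega ('D_w1 (fun p => sigma R n (psi p) (f p)) q) ('D_w2 (fun p => sigma R n (psi p) (f p)) q) =
  omega u v + b * (dot (rsubmx (f q)) (rsubmx u) / r) - a * (dot (rsubmx (f q)) (rsubmx v) / r).
Proof.
move=> [x1 xy] y0 [xu xu'] [xv xv'] hu hv ha hb r.
have [_ ->] := is_derive_sigma y0 ha hu; have [_ ->] := is_derive_sigma y0 hb hv.
rewrite -/r /omega !row_mxKl !row_mxKr.
set x := lsubmx (f q) in x1 xy xu xu' xv xv' *; set y := rsubmx (f q) in r y0 xy xu xu' xv xv' *.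
have r0 : r != 0 by rewrite enorm_neq0.
have yy : dot y y = r * r by rewrite -enorm_sqr expr2.
set c := cos _; set s := sin _.
have cs : c * c + s * s = 1 by rewrite -!expr2 cos2Dsin2.
have {}xu' : dot x (rsubmx u) = - dot y (lsubmx u) by apply/eqP; rewrite -addr_eq0 xu'.
have {}xv' : dot x (rsubmx v) = - dot y (lsubmx v) by apply/eqP; rewrite -addr_eq0 xv'.
(* Multiplying by $\cos^2+\sin^2$ makes both sides homogeneous of degree two in [c] and [s]; a
   rational identity in the scalar products remains. *)
rewrite -[RHS]mul1r -cs.
rewrite !(dotDl, dotDr, dotNl, dotNr, dotZl, dotZr).
rewrite ?(dotC (lsubmx u) x) ?(dotC (lsubmx v) x) ?(dotC (rsubmx u) x) ?(dotC (rsubmx v) x) ?(dotC y x).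
rewrite ?(dotC (lsubmx u) y) ?(dotC (lsubmx v) y) ?(dotC (rsubmx u) y) ?(dotC (rsubmx v) y).
rewrite ?(dotC (lsubmx v) (lsubmx u)) ?(dotC (rsubmx v) (rsubmx u)).
rewrite ?(dotC (lsubmx u) (rsubmx v)) ?(dotC (lsubmx v) (rsubmx u)).
rewrite x1 xy xu xv xu' xv' yy.
field.
exact: r0.
Qed.

End Sigma.

(** * Inserting and deleting a coordinate *)

Section InsDel.
Variables (R : realType) (n : nat).
Implicit Types (x : 'rV[R]_n.+1) (b : 'rV[R]_n).

Definition ins (i : 'I_n.+1) (a : R) b : 'rV[R]_n.+1 :=
  \row_j if unlift i j is Some k then b 0 k else a.

Definition del (i : 'I_n.+1) x : 'rV[R]_n := \row_k x 0 (lift i k).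

Lemma ins_eq i a b : ins i a b 0 i = a.
Proof. by rewrite mxE unlift_none. Qed.

Lemma ins_lift i a b k : ins i a b 0 (lift i k) = b 0 k.
Proof. by rewrite mxE liftK. Qed.

Lemma insK i a b : del i (ins i a b) = b.
Proof. by apply/rowP => k; rewrite mxE ins_lift. Qed.

Lemma delK i x : ins i (x 0 i) (del i x) = x.
Proof. by apply/rowP => j; rewrite mxE; case: unliftP => [k ->|->] //; rewrite mxE. Qed.

Lemma insD i a b a' b' : ins i (a + a') (b + b') = ins i a b + ins i a' b'.
Proof. by apply/rowP => j; rewrite !mxE; case: unlift => [k|] //; rewrite mxE. Qed.

Lemma insZ i c a b : ins i (c * a) (c *: b) = c *: ins i a b.
Proof. by apply/rowP => j; rewrite !mxE; case: unlift => [k|] //; rewrite mxE. Qed.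

Lemma del_linear i : linear (del i).
Proof. by move=> a u v; apply/rowP => k; rewrite !mxE. Qed.

Lemma ins_linear i : linear (fun z : (R^o * 'rV[R]_n)%type => ins i z.1 z.2).
Proof. by move=> a [u1 u2] [v1 v2] /=; rewrite -insZ -insD. Qed.

Lemma entry_linear i : linear (fun x => x 0 i : R^o).
Proof. by move=> a u v; rewrite !mxE. Qed.

Lemma smooth_del (E : normedModType R) (A : set E) (f : E -> 'rV[R]_n.+1) i :
  open A -> smooth A f -> smooth A (fun z => del i (f z)).
Proof.
move=> oA; apply: smooth_lin_comp => //; first exact: del_linear.
exact: linear_continuous_findim (@del_linear i).
Qed.

Lemma smooth_entry (E : normedModType R) (A : set E) (f : E -> 'rV[R]_n.+1) i :
  open A -> smooth A f -> smooth A (fun z => f z 0 i : R^o).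
Proof.
move=> oA; apply: (smooth_lin_comp oA (@entry_linear i)) => //.
exact: linear_continuous_findim (@entry_linear i).
Qed.

Lemma smooth_ins (E : normedModType R) (A : set E) (f : E -> R) (g : E -> 'rV[R]_n) i :
  open A -> smooth A (f : E -> R^o) -> smooth A g -> smooth A (fun z => ins i (f z) (g z)).
Proof.
move=> oA sf sg; have sp := smooth_pair oA sf sg.
apply: (smooth_lin_comp oA (@ins_linear i) _ sp) => //.
exact: linear_continuous_findim (@ins_linear i).
Qed.

Lemma is_derive_ins (E : normedModType R) (f : E -> R) (g : E -> 'rV[R]_n) i
    (z v : E) (df : R) (dg : 'rV[R]_n) :
  is_derive z v (f : E -> R^o) df -> is_derive z v g dg ->
  is_derive z v (fun z => ins i (f z) (g z)) (ins i df dg).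
Proof.
have l1 : linear (fun a : R^o => ins i a 0).
  by move=> a u w; rewrite -insZ -insD scaler0 addr0.
have l2 : linear (fun b : 'rV[R]_n => ins i 0 b).
  by move=> a u w; rewrite -insZ -insD mulr0 addr0.
have e a b : ins i a b = ins i a 0 + ins i 0 b by rewrite -insD addr0 add0r.
move=> hf hg; rewrite e (_ : (fun z => _) = fun z => ins i (f z) 0 + ins i 0 (g z)); last first.
  by apply/funext => w; rewrite -e.
apply: is_deriveD_fun; first exact: (@is_derive_linear_fun R E R^o _ _ _ f z v df l1).
exact: (is_derive_linear_fun l2).
Qed.

End InsDel.

Lemma dot_ins (R : realType) n i (a c : R) (b d : 'rV[R]_n.+1) :
  dotp R n.+1 (ins i a b) (ins i c d) = a * c + dotp R n b d.
Proof.
rewrite /dotp (bigD1_ord i) //= !ins_eq; congr (_ + _).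
by apply: eq_bigr => k _; rewrite !ins_lift.
Qed.

Lemma entry_sqr_le (R : realType) n (b : 'rV[R]_n.+1) k : b 0 k * b 0 k <= dotp R n b b.
Proof.
rewrite /dotp (bigD1 k) //= lerDl; apply: sumr_ge0 => i _.
by rewrite -expr2 sqr_ge0.
Qed.

(** * The disk cotangent bundle as a manifold with boundary *)

Section DTSGeometry.
Variables (R : realType) (n : nat).
Local Notation dot := (dotp R n).
Local Notation en := (enorm R n).
Local Notation E := 'rV[R]_(n.+1 + n.+1).
Local Notation D := (DTS R n).
Implicit Types (z u v : E).

Lemma DTSP z : D z <-> on_TS z /\ dot (rsubmx z) (rsubmx z) <= 1.
Proof.
rewrite /DTS /on_TS /=; split=> [[h1 h2 h3]|[[h1 h2] h3]].
  by split; [split=> //; apply/enorm_eq1|rewrite -enorm_le1].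
by split=> //; [apply/enorm_eq1|rewrite enorm_le1].
Qed.

Lemma smooth_coords (A : set E) : open A -> smooth A (fun z => lsubmx z) /\ smooth A (fun z => rsubmx z).
Proof.
by move=> oA; split; [apply: smooth_lsubmx => //|apply: smooth_rsubmx => //]; exact: smooth_id.
Qed.

Lemma smooth_dots (A : set E) : open A ->
  [/\ smooth A (fun z => dot (lsubmx z) (lsubmx z) : R^o),
      smooth A (fun z => dot (lsubmx z) (rsubmx z) : R^o) &
      smooth A (fun z => dot (rsubmx z) (rsubmx z) : R^o)].
Proof. by move=> oA; have [sl sr] := smooth_coords oA; split; exact: smooth_dot. Qed.

Lemma is_derive_coords z v :
  is_derive z v (fun z => lsubmx z) (lsubmx v) /\ is_derive z v (fun z => rsubmx z) (rsubmx v).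
Proof.
by split; [apply: is_derive_lsubmx|apply: is_derive_rsubmx]; exact: is_derive_id_fun.
Qed.

Lemma tangent_on_TS (X : set E) z v : X `<=` @on_TS R n -> tangent X z v -> tangent_TS z v.
Proof.
move=> XT tv; have Xz := tangent_mem tv.
have [s1 s2 _] := smooth_dots openT.
have df (f : E -> R^o) a : smooth setT f -> (forall w, X w -> f w = a) -> 'D_v f z = 0.
  move=> sf fa; rewrite -(derive_cst (a : R^o) z v).
  apply: (@tangent_derive_eq _ _ _ _ _ X f (cst a) z v) => //.
  exact: (smooth_differentiable openT sf).
have [dx dy] := is_derive_coords z v.
have [_ e1] := is_derive_dot dx dx; have [_ e2] := is_derive_dot dx dy.
split.
  have := df _ 1 s1 (fun w Xw => proj1 (XT w Xw)); rewrite e1 (dotC (lsubmx v)) => h; lra.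
have := df _ 0 s2 (fun w Xw => proj2 (XT w Xw)); rewrite e2 (dotC (lsubmx v)) => h; lra.
Qed.

Lemma DTS_on_TS : D `<=` @on_TS R n.
Proof. by move=> z /DTSP[]. Qed.

Lemma compact_DTS : compact D.
Proof.
have [s1 s2 s3] := smooth_dots openT.
have cl (f : E -> R^o) (B : set R) : smooth setT f -> closed B -> closed (f @^-1` B).
  by move=> sf cB; apply: preimage_closed => // z _; exact: (smooth_continuous sf).
apply: bounded_closed_compact.
  exists 1; split => // M M1 z /DTSP[[h1 _] h3].
  rewrite /= (le_trans _ (ltW M1))// [leLHS]/Num.Def.normr/= mx_normrE.
  apply: bigmax_le => // -[i j] _ /=.
  rewrite -(@expr_le1 _ 2) // real_normK ?num_real// expr2 (ord1 i).
  rewrite -[z]hsubmxK; case: (split_ordP j) => k ->.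
    by rewrite row_mxEl -h1; exact: entry_sqr_le.
  by rewrite row_mxEr (le_trans _ h3)//; exact: entry_sqr_le.
have -> : D = ((fun z => dot (lsubmx z) (lsubmx z)) @^-1` [set 1]) `&`
  (((fun z => dot (lsubmx z) (rsubmx z)) @^-1` [set 0]) `&`
   ((fun z => dot (rsubmx z) (rsubmx z)) @^-1` [set t | t <= 1])).
  by apply/seteqP; split=> z /=; [move=> /DTSP[[? ?] ?]|move=> [? [? ?]]; apply/DTSP].
apply: closedI; first by apply: cl => //; exact: closed_eq.
by apply: closedI; apply: cl => //; do ?[exact: closed_eq|exact: closed_le].
Qed.

(** Normalize $x+tv_x$ and project $y+tv_y$ orthogonally to the result. Since $x\cdot v_x=0$, the
    normalizing factor has derivative 0 at $t=0$, so the velocity there is $v$. The fibre norm is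
    not controlled. *)
Lemma interior_curve z v : on_TS z -> tangent_TS z v ->
  exists c : R -> E, [/\ smooth setT c, c 0 = z, is_derive (0 : R) (1 : R) c v & forall t, on_TS (c t)].
Proof.
move=> [x1 xy] [xv xv'].
set x := lsubmx z in x1 xy xv xv'; set y := rsubmx z in xy xv'.
pose N (t : R) := 1 + t * t * dot (lsubmx v) (lsubmx v).
have N0 t : 0 < N t by rewrite ltr_wpDr// mulr_ge0 ?dot_ge0// -expr2 sqr_ge0.
pose a t := (Num.sqrt (N t))^-1.
pose X t := a t *: (x + t *: lsubmx v).
pose Y t := (y + t *: rsubmx v) - dot (y + t *: rsubmx v) (X t) *: X t.
have XX t : dot (X t) (X t) = 1.
  rewrite /X dotZl dotZr !(dotDl, dotDr, dotZl, dotZr) (dotC (lsubmx v) x) xv x1.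
  have -> : 1 + t * 0 + (t * 0 + t * (t * dot (lsubmx v) (lsubmx v))) = N t by rewrite /N; ring.
  rewrite /a -[X in _ * (_ * X)](@sqr_sqrtr _ (N t)) ?ltW//; field.
  by rewrite gt_eqF// sqrtr_gt0.
have oR : open (setT : set R) by exact: openT.
have sid : smooth setT (fun t : R => t : R^o) by exact: smooth_id.
have sN : smooth setT (N : R -> R^o).
  apply: (@smoothD R R^o R^o) => //; first exact: smooth_cst.
  apply: (@smoothM R R^o) => //; last exact: smooth_cst.
  exact: (@smoothM R R^o).
have sa : smooth setT (a : R -> R^o).
  apply: (@smoothV R R^o) => //; first by move=> t _; rewrite gt_eqF// sqrtr_gt0.
  exact: (@smooth_sqrt_comp R R^o).
have sl (w0 w1 : 'rV[R]_n.+1) : smooth setT (fun t : R => w0 + t *: w1).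
  by apply: (@smoothD R R^o) => //; [exact: smooth_cst|apply: (@smoothZ R R^o) => //; exact: smooth_cst].
have sX : smooth setT X by exact: (@smoothZ R R^o).
have sY : smooth setT Y.
  apply: (@smoothB R R^o) => //; apply: (@smoothZ R R^o) => //; exact: (@smooth_dot R n R^o).
have N00 : N 0 = 1 by rewrite /N !mul0r addr0.
have a0 : a 0 = 1 by rewrite /a N00 sqrtr1 invr1.
have X0 : X 0 = x by rewrite /X a0 scale1r scale0r addr0.
have Y0 : Y 0 = y by rewrite /Y X0 scale0r addr0 dotC xy scale0r subr0.
exists (fun t => row_mx (X t) (Y t)); split.
- exact: smooth_row_mx.
- by rewrite X0 Y0 hsubmxK.
- have did : is_derive (0 : R) (1 : R) (fun t : R => t : R^o) 1 by exact: is_derive_id.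
  have dN : is_derive (0 : R) (1 : R) (N : R -> R^o) 0.
    have d2 := @is_deriveM_fun R R^o (fun t => t) (fun t => t) 0 1 _ _ did did.
    have d3 := @is_deriveM_fun R R^o (fun t => t * t) (fun _ => dot (lsubmx v) (lsubmx v)) 0 1 _ _
      d2 (is_derive_cst_fun _ _ _).
    have d4 := @is_deriveD_fun R R^o R^o (fun _ => 1) _ 0 1 _ _ (is_derive_cst_fun _ _ _) d3.
    by apply: (is_derive_eq d4); rewrite !(mulr0, mul0r, addr0, add0r).
  have da : is_derive (0 : R) (1 : R) (a : R -> R^o) 0.
    have hN : 0 < N 0 by [].
    have ds := @is_derive_chain R R^o Num.sqrt N 0 1 _ _ (is_derive1_sqrt hN) dN.
    have sN0 : Num.sqrt (N 0) != 0 by rewrite gt_eqF// sqrtr_gt0.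
    have := @is_deriveV R (fun t => Num.sqrt (N t)) 0 _ 1 sN0 ds.
    by rewrite mulr0 scaler0.
  have dl (w0 w1 : 'rV[R]_n.+1) : is_derive (0 : R) (1 : R) (fun t : R => w0 + t *: w1) w1.
    have d1 := @is_deriveZ_fun R R^o _ (fun t => t) (fun _ => w1) 0 1 _ _ did (is_derive_cst_fun _ _ _).
    have d2 := @is_deriveD_fun R R^o _ (fun _ => w0) _ 0 1 _ _ (is_derive_cst_fun _ _ _) d1.
    apply: (is_derive_eq d2).
    by rewrite scaler0 addr0 add0r scale1r.
  have dX : is_derive (0 : R) (1 : R) X (lsubmx v).
    apply: is_derive_eq; first exact: (@is_deriveZ_fun R R^o _ a _ 0 1 _ _ da (dl _ _)).
    by rewrite scale0r add0r a0 scale1r.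
  have dY : is_derive (0 : R) (1 : R) Y (rsubmx v).
    have d1 := @is_derive_dot R n R^o _ _ 0 1 _ _ (dl y (rsubmx v)) dX.
    apply: is_derive_eq; first exact: (is_deriveB (dl y (rsubmx v)) (@is_deriveZ_fun R R^o _ _ _ 0 1 _ _ d1 dX)).
    rewrite /= scale0r addr0 X0 (dotC y x) xy scale0r addr0.
    by rewrite (dotC _ x) xv' scale0r subr0.
  by rewrite -[v]hsubmxK; exact: (@is_derive_row_mx R _ _ R^o).
move=> t; rewrite /on_TS row_mxKl row_mxKr; split; first exact: XX.
by rewrite /Y [LHS]dotDr dotNr dotZr XX mulr1 (dotC (X t)) subrr.
Qed.

End DTSGeometry.

Section DTSManifold.
Variables (R : realType) (n : nat).
Local Notation dot := (dotp R n).
Local Notation en := (enorm R n).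
Local Notation E := 'rV[R]_(n.+1 + n.+1).
Local Notation D := (DTS R n).
Implicit Types (z u v : E).

Lemma near_oo (f : R -> R^o) (B : set R) : smooth setT f -> open B -> B (f 0) ->
  exists2 e, 0 < e & forall t, - e < t < e -> B (f t).
Proof.
move=> sf oB B0; have cf : {for (0 : R), continuous f} by exact: (smooth_continuous sf).
have /nbhs_normP[e /= e0 He] : nbhs (0 : R) (f @^-1` B) by apply: cf; exact: open_nbhs_nbhs.
by exists e => // t te; apply: He; rewrite /= sub0r normrN ltr_norml.
Qed.

Lemma curve_in_interior z v : on_TS z -> tangent_TS z v -> dot (rsubmx z) (rsubmx z) < 1 ->
  exists (c : R -> E) e, [/\ 0 < e, smooth (fun t : R => - e < t < e : Prop) c, c 0 = z,
    is_derive (0 : R) (1 : R) c v & forall t, - e < t < e -> D (c t)].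
Proof.
move=> tz tv y1; have [c [sc c0 dc Tc]] := interior_curve tz tv.
have syy : smooth setT (fun t : R => dot (rsubmx (c t)) (rsubmx (c t)) : R^o).
  by apply: (@smooth_dot R n R^o); try exact: openT; apply: (@smooth_rsubmx R _ _ R^o) => //; exact: openT.
have [e e0 He] : exists2 e, 0 < e & forall t, - e < t < e -> dot (rsubmx (c t)) (rsubmx (c t)) < 1.
  by apply: (near_oo syy (@open_lt _ 1)); rewrite /= c0.
exists c, e; split=> //; first by exact: smooth_subset sc.
by move=> t te; apply/DTSP; split=> //; exact/ltW/He.
Qed.

(** At a point with $|y|=1$ the curve of [interior_curve] may leave the disk bundle on both sides of
    0. Rescaling its fibre part to norm $1+tk$, with $k=y\cdot v_y$, keeps the velocity and makes
    the curve stay in the bundle for times of the sign opposite to $k$. *)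
Lemma tangent_DTS z v : D z -> tangent_TS z v -> tangent D z v.
Proof.
move=> /DTSP[tz yle] tv; have := yle; rewrite le_eqVlt => /orP[/eqP y1|y1]; last first.
  have [c [e [e0 sc c0 dc Dc]]] := curve_in_interior tz tv y1.
  exists c, e; split=> //; first by rewrite derive1E; case: dc.
  by left=> t /andP[t0 te]; apply: Dc; rewrite te andbT (lt_le_trans _ t0)// oppr_lt0.
have [c [sc c0 dc Tc]] := interior_curve tz tv.
pose yy (t : R) := dot (rsubmx (c t)) (rsubmx (c t)).
have oR : open (setT : set R) by exact: openT.
have sr : smooth setT (fun t : R => rsubmx (c t)) by exact: (@smooth_rsubmx R _ _ R^o).
have sl : smooth setT (fun t : R => lsubmx (c t)) by exact: (@smooth_lsubmx R _ _ R^o).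
have syy : smooth setT (yy : R -> R^o) by exact: (@smooth_dot R n R^o).
have [d d0 Hd] : exists2 e, 0 < e & forall t, - e < t < e -> 0 < yy t.
  by apply: (near_oo syy (@open_gt _ 0)); rewrite /= /yy c0 y1.
pose k := dot (rsubmx z) (rsubmx v).
(* The second bound gives $|tk|\le 1$, so that $1+tk$ is nonnegative. *)
pose e := Num.min d (`|k| + 1)^-1.
have k1 : 0 < `|k| + 1 by rewrite ltr_wpDl.
have e0 : 0 < e by rewrite lt_min d0 invr_gt0.
have Hyy t : - e < t < e -> 0 < yy t.
  move=> /andP[t1 t2]; apply: Hd; rewrite (lt_le_trans t2) ?ge_min ?lexx// andbT.
  by apply: le_lt_trans t1; rewrite lerN2 ge_min lexx.
have Hk t : - e < t < e -> `|t * k| <= 1.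
  move=> te; have : `|t| < e by rewrite ltr_norml.
  rewrite lt_min => /andP[_ t1]; rewrite normrM.
  apply: (@le_trans _ _ ((`|k| + 1)^-1 * (`|k| + 1))); last by rewrite mulVf ?gt_eqF.
  by apply: ler_pM => //; [exact: ltW|rewrite lerDl].
pose a t := (1 + t * k) * (Num.sqrt (yy t))^-1.
have a0 : a 0 = 1 by rewrite /a /yy c0 y1 sqrtr1 mul0r addr0 invr1 mulr1.
pose I := (fun t : R => - e < t < e : Prop).
have oI : open I by exact: open_oo.
have sI (F : normedModType R) (f : R -> F) : smooth setT f -> smooth I f by exact: smooth_subset.
have sa : smooth I (a : R -> R^o).
  apply: (@smoothM R R^o) => //.
    apply: (@smoothD R R^o R^o) => //; first exact: smooth_cst.
    by apply: (@smoothM R R^o) => //; [exact: smooth_id|exact: smooth_cst].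
  apply: (@smoothV R R^o) => //; first by move=> t It; rewrite gt_eqF// sqrtr_gt0 Hyy.
  by apply: (@smooth_sqrt_comp R R^o) => //; exact: sI.
have dr : is_derive (0 : R) (1 : R) (fun t : R => rsubmx (c t)) (rsubmx v).
  exact: (@is_derive_rsubmx R _ _ R^o).
have dl : is_derive (0 : R) (1 : R) (fun t : R => lsubmx (c t)) (lsubmx v).
  exact: (@is_derive_lsubmx R _ _ R^o).
have da : is_derive (0 : R) (1 : R) (a : R -> R^o) 0.
  have did : is_derive (0 : R) (1 : R) (fun t : R => t : R^o) 1 by exact: is_derive_id.
  have d1 := @is_deriveM_fun R R^o (fun t => t) (fun _ => k) 0 1 _ _ did (is_derive_cst_fun _ _ _).
  have d2 := @is_deriveD_fun R R^o R^o (fun _ => 1) _ 0 1 _ _ (is_derive_cst_fun _ _ _) d1.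
  have dyy := @is_derive_dot R n R^o _ _ 0 1 _ _ dr dr.
  have h0 : 0 < yy 0 by apply: Hyy; rewrite oppr_lt0 e0.
  have ds := @is_derive_chain R R^o Num.sqrt yy 0 1 _ _ (is_derive1_sqrt h0) dyy.
  have s0 : Num.sqrt (yy 0) != 0 by rewrite gt_eqF// sqrtr_gt0.
  have d3 := @is_deriveV R (fun t => Num.sqrt (yy t)) 0 _ 1 s0 ds.
  have d4 := @is_deriveM_fun R R^o _ _ 0 1 _ _ d2 d3.
  apply: (is_derive_eq d4); rewrite scaleRE /yy c0 y1 sqrtr1 (dotC (rsubmx v)) -/k.
  by field.
pose c2 t := row_mx (lsubmx (c t)) (a t *: rsubmx (c t)).
exists c2, e; split=> //.
- apply: (@smooth_row_mx R _ _ R^o) => //; first exact: sI.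
  by apply: (@smoothZ R R^o) => //; exact: sI.
- by rewrite /c2 a0 scale1r hsubmxK.
- rewrite derive1E; have dZ := @is_deriveZ_fun R R^o _ a _ 0 1 _ _ da dr.
  have [_ ->] := @is_derive_row_mx R _ _ R^o _ _ 0 1 _ _ dl dZ.
  by rewrite scale0r add0r a0 scale1r hsubmxK.
have H t : - e < t < e -> t * k <= 0 -> D (c2 t).
  move=> te tk; have [T1 T2] := Tc t; apply/DTSP; rewrite /on_TS /c2 row_mxKl row_mxKr; split.
    by rewrite T1 dotZr T2 mulr0.
  rewrite dotZl dotZr -/(yy t) /a.
  have s0 : Num.sqrt (yy t) != 0 by rewrite gt_eqF// sqrtr_gt0 Hyy.
  have -> : (1 + t * k) / Num.sqrt (yy t) * ((1 + t * k) / Num.sqrt (yy t) * yy t) = (1 + t * k) ^+ 2.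
    by rewrite -[X in _ * (_ * X) = _](@sqr_sqrtr _ (yy t)) ?ltW ?Hyy//; field.
  have := Hk t te; rewrite ler0_norm// => tk1.
  by rewrite expr_le1//; lra.
have [k0|k0] := leP k 0.
  left=> t /andP[t0 te]; apply: H; first by rewrite te andbT (lt_le_trans _ t0)// oppr_lt0.
  exact: mulr_ge0_le0.
right=> t /andP[te t0]; apply: H; first by rewrite te (le_lt_trans t0).
by apply: mulr_le0_ge0 => //; exact: ltW.
Qed.

(** The witness is $v$ turned by the standard complex structure $(v_x,v_y)\mapsto(v_y,-v_x)$, both
    components corrected by multiples of $x$ to be tangent. Then $\omega(v,w)=|w_1|^2+|v_x|^2$,
    which vanishes only for $v=0$. *)
Lemma omega_nondegenerate z v : D z -> tangent D z v -> v <> 0 ->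
  exists w, tangent D z w /\ omega v w <> 0.
Proof.
move=> Dz tv v0; have [x1 xy] := DTS_on_TS Dz.
have [xv xv'] := tangent_on_TS (@DTS_on_TS R n) tv.
set x := lsubmx z in x1 xy xv xv'; set y := rsubmx z in xy xv'.
pose w1 := rsubmx v + dot y (lsubmx v) *: x.
pose w2 := - lsubmx v - dot y w1 *: x.
have xw1 : dot x w1 = 0 by rewrite dotDr dotZr x1 mulr1.
exists (row_mx w1 w2); split.
  apply: tangent_DTS => //; rewrite /tangent_TS row_mxKl row_mxKr -/x -/y; split=> //.
  by rewrite dotDr !dotNr dotZr x1 xv mulr1 oppr0 add0r addNr.
rewrite /omega row_mxKl row_mxKr => om0; apply: v0.
have e : dot (rsubmx v) w1 - dot w2 (lsubmx v) = dot w1 w1 + dot (lsubmx v) (lsubmx v).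
  have -> : rsubmx v = w1 - dot y (lsubmx v) *: x by rewrite addrK.
  by rewrite /w2 !(dotDl, dotNl, dotZl) xw1 xv; ring.
move: om0; rewrite e => /eqP; rewrite paddr_eq0 ?dot_ge0// !dot_eq0 => /andP[/eqP w10 /eqP v10].
rewrite -[v]hsubmxK v10; move: w10; rewrite /w1 v10 dot0r scale0r addr0 => ->.
exact: row_mx0.
Qed.

End DTSManifold.

Lemma dot_del (R : realType) n i (x y : 'rV[R]_n.+2) :
  dotp R n.+1 x y = x 0 i * y 0 i + dotp R n (del i x) (del i y).
Proof. by rewrite -{1}(delK i x) -{1}(delK i y) dot_ins. Qed.

(** * Graph charts of the cotangent bundle over hemispheres *)

Section Charts.
Variables (R : realType) (n : nat).
Local Notation dot1 := (dotp R n.+1).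
Local Notation dot := (dotp R n).
Local Notation E := 'rV[R]_(n.+2 + n.+2).
Local Notation D := (DTS R n.+1).
Local Notation V := 'rV[R]_n.+1.
Variables (i : 'I_n.+2) (s : R).
Hypothesis s2 : s * s = 1.

(* [T*S^(n+1)] over the hemisphere [0 < s * x_i], as a graph over the other coordinates. *)
Definition graph_x (a : V) : R := s * Num.sqrt (1 - dot a a).
Definition graph_y (a b : V) : R := - dot a b / graph_x a.
Definition graph (a b : V) : E := row_mx (ins i (graph_x a) a) (ins i (graph_y a b) b).

Lemma graph_x_sqr a : dot a a < 1 -> graph_x a * graph_x a = 1 - dot a a.
Proof.
move=> a1; rewrite /graph_x mulrACA s2 mul1r -expr2 sqr_sqrtr//.
by rewrite subr_ge0 ltW.
Qed.

Lemma graph_x_neq0 a : dot a a < 1 -> graph_x a != 0.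
Proof.
move=> a1; have h : 0 < graph_x a * graph_x a by rewrite graph_x_sqr// subr_gt0.
by apply/eqP => g0; move: h; rewrite g0 mul0r ltxx.
Qed.

Lemma graph_sx a : dot a a < 1 -> 0 < s * graph_x a.
Proof. by move=> a1; rewrite /graph_x mulrA s2 mul1r sqrtr_gt0 subr_gt0. Qed.

Lemma graph_on_TS a b : dot a a < 1 -> on_TS (graph a b).
Proof.
move=> a1; rewrite /on_TS /graph row_mxKl row_mxKr !dot_ins graph_x_sqr// subrK; split=> //.
by rewrite /graph_y mulrC divfK ?graph_x_neq0// addNr.
Qed.

Lemma graph_del z : on_TS z -> 0 < s * lsubmx z 0 i ->
  dot (del i (lsubmx z)) (del i (lsubmx z)) < 1 /\
  graph (del i (lsubmx z)) (del i (rsubmx z)) = z.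
Proof.
move=> [x1 xy] sx; set x := lsubmx z in x1 xy sx *; set y := rsubmx z in xy *.
move: x1 xy; rewrite !(dot_del i).
set a := del i x; set b := del i y; set xi := x 0 i in sx *; set yi := y 0 i => x1 xy.
have xi0 : xi != 0 by apply/eqP => h; move: sx; rewrite h mulr0 ltxx.
have a1 : dot a a < 1 by rewrite -x1 ltrDr -expr2 exprn_even_gt0.
split=> //.
have gx : graph_x a = xi.
  rewrite /graph_x -x1 addrK -expr2 sqrtr_sqr.
  have sn : `|s| = 1.
    by apply/eqP; rewrite -(@eqrXn2 _ 2) ?expr1n// real_normK ?num_real// expr2 s2.
  rewrite -[`|xi|]mul1r -sn -normrM gtr0_norm// mulrA s2 mul1r //.
rewrite /graph gx /graph_y gx (_ : - dot a b / xi = yi) /a /b /xi /yi ?delK ?hsubmxK//.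
have -> : - dot a b = xi * yi by apply/eqP; rewrite eqr_oppLR -addr_eq0 addrC xy.
by rewrite mulrC mulKf.
Qed.

(** Over a fixed base point the graph is linear in the fibre coordinates; this allows the boundary
    chart to prescribe $|y|$ by rescaling. *)
Lemma graphZ a c b : graph a (c *: b) =
  row_mx (lsubmx (graph a b)) (c *: rsubmx (graph a b)).
Proof.
rewrite /graph row_mxKl row_mxKr -insZ; congr (row_mx _ (ins _ _ _)).
by rewrite /graph_y dotZr; ring.
Qed.

Lemma smooth_graph (F : normedModType R) {fF : findim F} (A : set F) (a b : F -> V) : open A ->
  (forall u, A u -> dot (a u) (a u) < 1) -> smooth A a -> smooth A b ->
  smooth A (fun u => graph (a u) (b u)).
Proof.
move=> oA a1 sa sb.
have sgx : smooth A (fun u => graph_x (a u) : R^o).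
  apply: smoothM => //; first exact: smooth_cst.
  apply: smooth_sqrt_comp => // [u /a1|]; first by rewrite subr_gt0.
  by apply: smoothB => //; [exact: smooth_cst|exact: smooth_dot].
apply: smooth_row_mx => //; apply: smooth_ins => //.
apply: smoothM => //; first by apply: smoothN => //; exact: smooth_dot.
by apply: smoothV => // u /a1; exact: graph_x_neq0.
Qed.

End Charts.

Section DTSCharts.
Variables (R : realType) (n : nat).
Local Notation dot1 := (dotp R n.+1).
Local Notation dot := (dotp R n).
Local Notation en := (enorm R n.+1).
Local Notation E := 'rV[R]_(n.+2 + n.+2).
Local Notation D := (DTS R n.+1).
Local Notation V := 'rV[R]_n.+1.

Lemma sign_entry (m : nat) (x : 'rV[R]_m.+1) : x != 0 ->
  exists (i : 'I_m.+1) (s : R), s * s = 1 /\ 0 < s * x 0 i.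
Proof.
move=> x0; have [i xi] : exists i, x 0 i != 0.
  apply/existsP; rewrite -negb_forall; apply: contra x0 => /forallP h.
  by apply/eqP/rowP => i; rewrite mxE; apply/eqP.
have [xp|xn] := ltP 0 (x 0 i); first by exists i, 1; rewrite !mul1r.
by exists i, (-1); rewrite mulrNN mulr1 mulN1r oppr_gt0 lt_neqAle xi.
Qed.

Lemma delZ (m : nat) (i : 'I_m.+1) c (x : 'rV[R]_m.+1) : del i (c *: x) = c *: del i x.
Proof. by apply/rowP => k; rewrite !mxE. Qed.

Lemma on_TS_neq0 (z : E) : on_TS z -> lsubmx z != 0.
Proof. by move=> [x1 _]; apply/eqP => h; move: x1; rewrite h dot0l => /esym/eqP; rewrite oner_eq0. Qed.

Lemma open_smooth_lt (F : normedModType R) (A : set F) (f : F -> R) (a : R) : open A ->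
  smooth A (f : F -> R^o) -> open (A `&` [set u | f u < a]).
Proof.
move=> oA sf; apply: (@open_preimage _ _ _ _ (f : F -> R^o) [set t | t < a]) => //.
by move=> u; exact: smooth_continuous.
Qed.

Lemma open_smooth_gt (F : normedModType R) (A : set F) (f : F -> R) (a : R) : open A ->
  smooth A (f : F -> R^o) -> open (A `&` [set u | a < f u]).
Proof.
move=> oA sf; apply: (@open_preimage _ _ _ _ (f : F -> R^o) [set t | a < t]) => //.
by move=> u; exact: smooth_continuous.
Qed.

Lemma smooth_sx (A : set E) i (s : R) : open A -> smooth A (fun z => s * lsubmx z 0 i : R^o).
Proof.
move=> oA; apply: smoothM => //; first exact: smooth_cst.
by apply: smooth_entry => //; have [] := smooth_coords oA.
Qed.

(** Graph coordinates over a hemisphere. The dimension [m] is a variable with an equation because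
    the page dimension is the product [2 * n.+1], while the chart needs a sum to split row
    vectors. *)
Lemma interior_chart (z : E) m : D z -> dot1 (rsubmx z) (rsubmx z) < 1 -> m = (n.+1 + n.+1)%N ->
  exists p W q U, @local_param R (n.+2 + n.+2) m D p W q U /\ U z.
Proof.
move=> Dz y1 ->; have Tz := DTS_on_TS Dz.
have [i [s [s2 sx]]] := sign_entry (on_TS_neq0 Tz).
pose a (u : 'rV[R]_(n.+1 + n.+1)) : V := lsubmx u - const_mx 2.
pose p (u : 'rV[R]_(n.+1 + n.+1)) := graph i s (a u) (rsubmx u).
(* Charts take values in a half-space. The deleted base point has entries in $(-1,1)$, so the shift
   by 2 makes the first coordinate positive. *)
pose q (z : E) := row_mx (del i (lsubmx z) + const_mx 2) (del i (rsubmx z)).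
pose W1 := setT `&` [set u | dot (a u) (a u) < 1].
pose W := W1 `&` [set u | dot1 (rsubmx (p u)) (rsubmx (p u)) < 1].
pose U := (setT `&` [set z : E | 0 < s * lsubmx z 0 i]) `&` [set z | dot1 (rsubmx z) (rsubmx z) < 1].
have sa A : open A -> smooth A a.
  move=> oA; apply: smoothB => //; last exact: smooth_cst.
  by apply: smooth_lsubmx => //; exact: smooth_id.
have oW1 : open W1.
  by apply: open_smooth_lt; [exact: openT|apply: smooth_dot; [exact: openT|exact: sa openT|exact: sa openT]].
have sp : smooth W1 p.
  apply: (@smooth_graph R n i s s2) => //; [by move=> u []|exact: sa|].
  by apply: smooth_rsubmx => //; exact: smooth_id.
have oW : open W.
  by apply: open_smooth_lt => //; apply: smooth_dot => //; exact: smooth_rsubmx.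
have oU : open U.
  apply: open_smooth_lt; first by apply: open_smooth_gt; [exact: openT|exact: smooth_sx openT].
  by have [_ _] := @smooth_dots R n.+1 _ (open_smooth_gt 0 openT (@smooth_sx setT i s openT)).
have sq : smooth U q.
  have [sl sr] := smooth_coords oU.
  apply: smooth_row_mx => //; last exact: smooth_del.
  by apply: smoothD => //; [exact: smooth_del|exact: smooth_cst].
exists p, W, q, U; split; last by split=> //; split.
split=> //.
- by apply: smooth_subset sp => u [].
- move=> u [[_ a1] y1u] _; have Tp := graph_on_TS i s2 (rsubmx u) a1.
  split; first by apply/DTSP; split=> //; exact: ltW.
    split=> //; split=> //; rewrite /p /graph /= row_mxKl ins_eq; exact: graph_sx.
  by rewrite /q /p /graph row_mxKl row_mxKr !insK /a subrK hsubmxK.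
move=> x Dx [[_ sxi] y1x]; have [a1 gE] := graph_del s2 (DTS_on_TS Dx) sxi.
have aq : a (q x) = del i (lsubmx x) by rewrite /a /q row_mxKl addrK.
have pq : p (q x) = x by rewrite /p aq /q row_mxKr gE.
split=> //.
  by split; [split=> //; rewrite /= aq|rewrite /= pq].
move=> j j0; have -> : j = lshift _ ord0 by apply: val_inj.
rewrite /q row_mxEl mxE [const_mx _ _ _]mxE.
have := entry_sqr_le (del i (lsubmx x)) ord0 => h.
set t := del _ _ _ _ in h *.
have t1 : t * t < 1 by exact: le_lt_trans h a1.
have : `|t| < 1 by rewrite -(@expr_lt1 _ 2)// real_normK ?num_real// expr2.
by rewrite ltr_norml => /andP[]; lra.
Qed.

(** Polar coordinates in the fibre: $1-|y|$, the base point, and the direction of $y$ recorded by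
    the ratios of its graph coordinates to a nonzero one, whose sign [s'] is fixed in the chart. The
    first coordinate is the boundary defining function. *)
Lemma boundary_chart (z : E) m : D z -> rsubmx z != 0 -> m = (1 + (n.+1 + n))%N ->
  exists p W q U, [/\ @local_param R (n.+2 + n.+2) m D p W q U, U z &
    exists i : 'I_m, i = 0%N :> nat /\ q z 0 i = 1 - en (rsubmx z)].
Proof.
move=> Dz y0 ->; have Tz := DTS_on_TS Dz.
have [i [s [s2 sx]]] := sign_entry (on_TS_neq0 Tz).
have [j [s' [s'2 sy]]] : exists (j : 'I_n.+1) (s' : R), s' * s' = 1 /\ 0 < s' * del i (rsubmx z) 0 j.
  apply: sign_entry; apply: contra y0 => /eqP b0.
  have [a1 gE] := graph_del s2 Tz sx; apply/eqP.
  have := graphZ i s (del i (lsubmx z)) 0 (del i (rsubmx z)).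
  by rewrite scale0r -{1}b0 gE => /(congr1 rsubmx); rewrite row_mxKr scale0r.
pose t (u : 'rV[R]_(1 + (n.+1 + n))) : R := lsubmx u 0 0.
pose a (u : 'rV[R]_(1 + (n.+1 + n))) : V := lsubmx (rsubmx u).
pose b0 (u : 'rV[R]_(1 + (n.+1 + n))) : V := ins j 1 (rsubmx (rsubmx u)).
pose N u := en (rsubmx (graph i s (a u) (b0 u))).
(* The multiple of the direction vector [b0 u] whose point in the bundle has fibre norm $1-t$ and
   whose [j]-th entry has sign [s']. *)
pose l u := s' * (1 - t u) / N u.
pose p u := graph i s (a u) (l u *: b0 u).
pose q (z : E) : 'rV[R]_(1 + (n.+1 + n)) :=
  row_mx (const_mx (1 - en (rsubmx z)))
    (row_mx (del i (lsubmx z)) ((del i (rsubmx z) 0 j)^-1 *: del j (del i (rsubmx z)))).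
pose W1 := setT `&` [set u | dot (a u) (a u) < 1].
pose W := W1 `&` [set u | t u < 1].
pose U1 := setT `&` [set z : E | 0 < s * lsubmx z 0 i].
pose U := U1 `&` [set z : E | 0 < s' * del i (rsubmx z) 0 j].
have oTu : open (setT : set 'rV[R]_(1 + (n.+1 + n))) by exact: openT.
have sid A : smooth A (fun u : 'rV[R]_(1 + (n.+1 + n)) => u) by exact: smooth_id.
have sa A : open A -> smooth A a.
  by move=> oA; apply: smooth_lsubmx => //; exact: smooth_rsubmx.
have st A : open A -> smooth A (t : _ -> R^o).
  by move=> oA; apply: smooth_entry => //; exact: smooth_lsubmx.
have sb A : open A -> smooth A b0.
  move=> oA; apply: smooth_ins => //; first exact: smooth_cst.
  by apply: smooth_rsubmx => //; exact: smooth_rsubmx.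
have oW1 : open W1 by apply: open_smooth_lt => //; apply: smooth_dot => //; exact: sa.
have oW : open W by apply: open_smooth_lt => //; exact: st.
have a1W u : W u -> dot (a u) (a u) < 1 by move=> [[]].
have gb u : rsubmx (graph i s (a u) (b0 u)) != 0.
  apply/eqP => h; have : del i (rsubmx (graph i s (a u) (b0 u))) 0 j = 0 by rewrite h !mxE.
  by rewrite /graph row_mxKr insK /b0 ins_eq => /eqP; rewrite oner_eq0.
have N0 u : 0 < N u by rewrite enorm_gt0.
have sl : smooth W (l : _ -> R^o).
  apply: smoothM => //.
    apply: smoothM => //; first exact: smooth_cst.
    apply: (@smoothB _ _ R^o) => //; first exact: smooth_cst.
    exact: st.
  have N1 u : W u -> N u != 0 by rewrite gt_eqF.
  apply: (smoothV oW N1); apply: (smooth_enorm oW) => [u _|]; first exact: gb.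
  by apply: smooth_rsubmx => //; apply: smooth_graph => //; [exact: sa|exact: sb].
have sp : smooth W p.
  by apply: smooth_graph => //; [exact: sa|apply: smoothZ => //; exact: sb].
have oT : open (setT : set E) by exact: openT.
have oU1 : open U1 by apply: open_smooth_gt => //; exact: smooth_sx.
have sd A : open A -> smooth A (fun z : E => del i (rsubmx z)).
  by move=> oA; apply: smooth_del => //; have [] := smooth_coords oA.
have oU : open U.
  apply: open_smooth_gt => //; apply: smoothM => //; first exact: smooth_cst.
  by apply: smooth_entry => //; exact: sd.
have Uyj w : U w -> del i (rsubmx w) 0 j != 0.
  by move=> [_ /= h]; apply/eqP => h0; move: h; rewrite h0 mulr0 ltxx.
have Uy w : U w -> rsubmx w != 0.
  by move=> /Uyj; apply: contra => /eqP ->; rewrite !mxE.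
have sq : smooth U q.
  have [sL sR] := smooth_coords oU.
  apply: smooth_row_mx => //.
    have lc : linear (fun c : R^o => const_mx c : 'rV[R]_1).
      by move=> c u v; apply/rowP => k; rewrite !mxE.
    apply: (@smooth_lin_comp _ _ R^o _ _ (fun c => const_mx c : 'rV[R]_1)) => //.
      exact: linear_continuous_findim.
    by apply: (@smoothB _ _ R^o) => //; [exact: smooth_cst|exact: smooth_enorm].
  apply: smooth_row_mx => //; first exact: smooth_del.
  apply: smoothZ => //; last by apply: smooth_del => //; exact: sd.
  by apply: smoothV => //; apply: smooth_entry => //; exact: sd.
have enp u : W u -> en (rsubmx (p u)) = 1 - t u.
  move=> [_ /= t1]; rewrite /p graphZ row_mxKr /enorm dotZl dotZr -enorm_sqr -/(N u) mulrA -!expr2 -exprMn.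
  have -> : l u * N u = s' * (1 - t u) by rewrite /l divfK ?gt_eqF.
  by rewrite exprMn expr2 s'2 mul1r sqrtr_sqr ger0_norm// subr_ge0 ltW.
exists p, W, q, U; split; last 2 first.
- by split=> //; split.
- by exists (lshift _ ord0); split=> //; rewrite /q row_mxEl mxE.
split=> //.
- move=> u Wu hu; have a1 := a1W _ Wu; have Tp := graph_on_TS i s2 (l u *: b0 u) a1.
  have t1 : t u < 1 by case: Wu.
  have t0 : 0 <= t u.
    by have := hu (lshift _ ord0) erefl; rewrite /t mxE.
  have dp : del i (rsubmx (p u)) = l u *: b0 u by rewrite /p /graph row_mxKr insK.
  have dpj : del i (rsubmx (p u)) 0 j = l u by rewrite dp mxE /b0 ins_eq mulr1.
  have l0 : 0 < s' * l u by rewrite /l !mulrA s'2 mul1r divr_gt0// subr_gt0.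
  split.
  + apply/DTSP; split=> //; rewrite -enorm_le1 enp//; lra.
  + split; last by rewrite /= dpj.
    by split=> //; rewrite /= /p /graph row_mxKl ins_eq graph_sx.
  + rewrite /q enp// dpj dp subKr.
    have -> : del i (lsubmx (p u)) = a u by rewrite /p /graph row_mxKl insK.
    have -> : (l u)^-1 *: del j (l u *: b0 u) = rsubmx (rsubmx u).
      have l00 : l u != 0 by apply/eqP => h; move: l0; rewrite h mulr0 ltxx.
      by rewrite delZ /b0 insK scalerA mulVf// scale1r.
    rewrite /a hsubmxK (_ : const_mx _ = lsubmx u) ?hsubmxK//.
    by apply/rowP => k; rewrite mxE (ord1 k).
move=> x Dx Ux; have [[_ sxi] syj] := Ux; have [a1 gE] := graph_del s2 (DTS_on_TS Dx) sxi.
have aq : a (q x) = del i (lsubmx x) by rewrite /a /q row_mxKr row_mxKl.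
have tq : t (q x) = 1 - en (rsubmx x) by rewrite /t /q row_mxKl mxE.
set yj := del i (rsubmx x) 0 j in syj.
have yj0 : yj != 0 by exact: Uyj.
have bq : b0 (q x) = yj^-1 *: del i (rsubmx x).
  rewrite /b0 /q !row_mxKr -/yj -[X in _ = yj^-1 *: X](delK j) -insZ -/yj.
  by rewrite mulVf.
have en0 : 0 < en (rsubmx x) by rewrite enorm_gt0 Uy.
have Nq : N (q x) = en (rsubmx x) / (s' * yj).
  rewrite /N aq bq graphZ row_mxKr gE /enorm dotZl dotZr mulrA -expr2 sqrtrM ?sqr_ge0//.
  rewrite sqrtr_sqr normfV mulrC; congr (_ / _).
  have sn : `|s'| = 1.
    by apply/eqP; rewrite -(@eqrXn2 _ 2) ?expr1n// real_normK ?num_real// expr2 s'2.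
  by rewrite -[LHS]mul1r -sn -normrM gtr0_norm.
have lq : l (q x) = yj.
  rewrite /l Nq tq subKr; have s'0 : s' != 0 by apply/eqP => h; move: s'2; rewrite h mul0r => /esym/eqP; rewrite oner_eq0.
  rewrite -[RHS]mul1r -s'2; field.
  by rewrite yj0 s'0 gt_eqF.
have pq : p (q x) = x by rewrite /p aq lq bq scalerA divff// scale1r gE.
split=> //.
  by split; [split=> //; rewrite /= aq|rewrite /= tq; lra].
move=> k k0; have -> : k = lshift _ ord0 by apply: val_inj.
rewrite /q row_mxEl mxE subr_ge0.
by have [_ _] : D x by [].
Qed.

Lemma manifold_DTS : manifold (2 * n.+1) D.
Proof.
move=> z Dz; have [y0|y0] := eqVneq (rsubmx z) 0.
  have [||p [W [q [U [lp Uz]]]]] := @interior_chart z (2 * n.+1) Dz.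
  - by rewrite y0 dot0l.
  - by rewrite mul2n addnn.
  by exists p, W, q, U.
have [||p [W [q [U [lp Uz _]]]]] := @boundary_chart z (2 * n.+1) Dz => //; first by rewrite mul2n -addnn add1n addnS.
by exists p, W, q, U.
Qed.

(** [boundary] asks for some chart with vanishing first coordinate, so invariance of the boundary is
    at stake. If $|y|<1$, a chart line entering the half-space has a velocity $v$ along which the
    first coordinate has derivative 1. As $-v$ is also the velocity of a curve in the bundle, the
    coordinate would become negative along it. *)
Lemma boundary_DTS : boundary (2 * n.+1) D = [set z | D z /\ dot1 (rsubmx z) (rsubmx z) = 1].
Proof.
apply/seteqP; split=> z [Dz].
  move=> [p [W [q [U [[[oW oU] sp sq pW qU] Uz [i [i0 qi]]]]]]]; split=> //.
  apply/eqP; rewrite eq_le; have [Tz y1] := (DTSP z).1 Dz; rewrite y1 /= leNgt; apply/negP => ylt.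
  have [Wq hq pq] := qU _ Dz Uz.
  pose c (t : R) := p (q z + t *: delta_mx 0 i).
  have line0 : q z + 0 *: delta_mx 0 i = q z by rewrite scale0r addr0.
  have sline : smooth setT (fun t : R => q z + t *: (delta_mx 0 i : 'rV[R]_(2 * n.+1))).
    apply: (@smoothD R R^o) => //; first exact: openT.
      exact: smooth_cst.
    by apply: (@smoothZ R R^o) => //; [exact: openT|exact: smooth_id|exact: smooth_cst].
  have [e e0 He] : exists2 e, 0 < e & forall t, - e < t < e -> W (q z + t *: delta_mx 0 i).
    have cl : {for (0 : R), continuous (fun t : R => q z + t *: (delta_mx 0 i : 'rV[R]_(2 * n.+1)))}.
      exact: (smooth_continuous sline).
    have /nbhs_normP[e /= e0 He] : nbhs (0 : R) ((fun t : R => q z + t *: delta_mx 0 i) @^-1` W).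
      by apply: cl; apply: open_nbhs_nbhs; split=> //; rewrite line0.
    by exists e => // t te; apply: He; rewrite /= sub0r normrN ltr_norml.
  have sc : smooth (fun t : R => - e < t < e : Prop) c.
    apply: (@smooth_comp R R^o _ _ _ _ _ _ W _ p (@open_oo _ _ _) oW He _ sp).
    by exact: smooth_subset sline.
  have hc t : 0 <= t < e -> [/\ D (c t), U (c t) & q (c t) = q z + t *: delta_mx 0 i].
    move=> /andP[t0 te]; apply: pW; first by apply: He; rewrite te andbT (lt_le_trans _ t0)// oppr_lt0.
    move=> j j0; have -> : j = i by apply: val_inj; rewrite /= j0 i0.
    by rewrite mxE qi add0r !mxE !eqxx mulr1.
  have c0 : c 0 = z by rewrite /c line0.
  pose v := derive1 c 0.
  have tv : tangent D z v by exists c, e; split=> //; left=> t /hc[].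
  have [t1 t2] := tangent_on_TS (@DTS_on_TS R n.+1) tv.
  have tnv : tangent_TS z (- v).
    rewrite /tangent_TS !linearN !dotNr t1 oppr0; split=> //.
    by rewrite -opprD t2 oppr0.
  have [g [d [d0 sg g0 dg Dg]]] := curve_in_interior Tz tnv ylt.
  have sqi : smooth U (fun w => q w 0 i : R^o) by exact: (smooth_lin_comp oU (@entry_linear _ _ i) (linear_continuous_findim (@entry_linear _ _ i))).
  have dqi : differentiable (fun w => q w 0 i : R^o) z by exact: (smooth_differentiable oU sqi).
  have dq1 : is_derive (0 : R) (1 : R) (fun t => q (c t) 0 i : R^o) ('D_v (fun w => q w 0 i : R^o) z).
    rewrite -[X in 'D_v _ X]c0.
    by apply: (@derive_curve R _ R^o _ _ c (fun w => q w 0 i : R^o) e) => //; rewrite c0.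
  have Dv1 : 'D_v (fun w => q w 0 i : R^o) z = 1.
    have [d1 e1] := is_deriveB dq1 (is_derive_id_fun (0 : R^o) 1).
    apply/eqP; rewrite -subr_eq0 -e1; apply/eqP; apply: (derive_zero_side e0 d1); left=> t te.
    rewrite fctE; have [_ _ ->] := hc t te.
    by rewrite !mxE qi add0r !eqxx mulr1 subrr.
  have g'0 : derive1 g 0 = - v by rewrite derive1E; case: dg.
  have dq2 : is_derive (0 : R) (1 : R) (fun t => q (g t) 0 i : R^o) (-1).
    have -> : -1 = 'D_(derive1 g 0) (fun w => q w 0 i : R^o) (g 0).
      rewrite g0 g'0 deriveE// linearN -deriveE// Dv1 //.
    by apply: (@derive_curve R _ R^o _ _ g (fun w => q w 0 i : R^o) d) => //; rewrite g0.
  have [f [f0 fd Hf]] : exists f, [/\ 0 < f, f <= d & forall t, 0 <= t < f -> U (g t)].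
    have cg : {for (0 : R), continuous g} by apply: (smooth_continuous sg); rewrite oppr_lt0 d0.
    have /nbhs_normP[f /= f0 Hf] : nbhs (0 : R) (g @^-1` U).
      by apply: cg; apply: open_nbhs_nbhs; split=> //; rewrite g0.
    exists (Num.min f d); split; [by rewrite lt_min f0 d0|by rewrite ge_min lexx orbT|].
    move=> t /andP[t0 tf]; apply: Hf; rewrite /= sub0r normrN ger0_norm//.
    by rewrite (lt_le_trans tf)// ge_min lexx.
  have [d2 e2] := dq2.
  have := @derive_ge0_right R (fun t => q (g t) 0 i) f f0 d2.
  rewrite e2 g0 => /(_ qi) H.
  suff : 0 <= (-1 : R) by rewrite oppr_ge0 ler10.
  apply: H => t tf; have /andP[t0 tf'] := tf.
  have Dt : D (g t).
    by apply: Dg; rewrite (lt_le_trans tf' fd) andbT (lt_le_trans _ t0)// oppr_lt0.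
  by have [_ h _] := qU _ Dt (Hf t tf); exact: h.
move=> y1; split=> //; have y0 : rsubmx z != 0.
  by apply/eqP => h; move: y1; rewrite h dot0l => /esym/eqP; rewrite oner_eq0.
have [|p [W [q [U [lp Uz [i [i0 qi]]]]]]] := @boundary_chart z (2 * n.+1) Dz y0.
  by rewrite mul2n -addnn add1n addnS.
exists p, W, q, U; split=> //; exists i; split=> //.
by rewrite qi ((enorm_eq1 _).2 y1) subrr.
Qed.

End DTSCharts.

(** * Group law and symmetries of the normalized geodesic flow *)

Section Rotation.
Variables (R : realType) (n : nat).
Local Notation dot := (dotp R n).
Local Notation en := (enorm R n).
Local Notation E := 'rV[R]_(n.+1 + n.+1).
Local Notation sg := (sigma R n).
Implicit Types (z u v : E) (s t : R).

Lemma lsubmxZ (c : R) z : lsubmx (c *: z) = c *: lsubmx z.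
Proof. by apply/rowP => i; rewrite !mxE. Qed.

Lemma rsubmxZ (c : R) z : rsubmx (c *: z) = c *: rsubmx z.
Proof. by apply/rowP => i; rewrite !mxE. Qed.

(** This anti-symplectic involution conjugates $\sigma_t$ to $\sigma_{-t}$. A radial twist
    conjugated by it is therefore its own inverse twist, which is smooth across the zero section
    because the twist is. *)
Definition fibre_neg z : E := row_mx (lsubmx z) (- rsubmx z).

Lemma fibre_negK z : fibre_neg (fibre_neg z) = z.
Proof. by rewrite /fibre_neg row_mxKl row_mxKr opprK hsubmxK. Qed.

Lemma fibre_negZ c z : fibre_neg (c *: z) = c *: fibre_neg z.
Proof. by rewrite /fibre_neg lsubmxZ rsubmxZ scale_row_mx scalerN. Qed.

Lemma smooth_fibre_neg (A : set E) : open A -> smooth A fibre_neg.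
Proof.
by move=> oA; have [sl sr] := smooth_coords oA; apply: smooth_row_mx => //; exact: smoothN.
Qed.

Lemma lsubmx_sigma t z :
  lsubmx (sg t z) = cos t *: lsubmx z + ((en (rsubmx z))^-1 * sin t) *: rsubmx z.
Proof. exact: row_mxKl. Qed.

Lemma rsubmx_sigma t z :
  rsubmx (sg t z) = - (en (rsubmx z) * sin t) *: lsubmx z + cos t *: rsubmx z.
Proof. exact: row_mxKr. Qed.

Lemma sigma_on_TS t z : on_TS z -> rsubmx z != 0 ->
  on_TS (sg t z) /\ dot (rsubmx (sg t z)) (rsubmx (sg t z)) = dot (rsubmx z) (rsubmx z).
Proof.
move=> [x1 xy] y0; rewrite /on_TS lsubmx_sigma rsubmx_sigma.
set x := lsubmx z in x1 xy *; set y := rsubmx z in y0 xy *; set r := en y.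
have r0 : r != 0 by rewrite enorm_neq0.
have yy : dot y y = r * r by rewrite -enorm_sqr expr2.
have cs : cos t * cos t + sin t * sin t = 1 by rewrite -!expr2 cos2Dsin2.
rewrite !(dotDl, dotDr, dotZl, dotZr) (dotC y x) x1 xy yy; split; [split|].
- by rewrite -[RHS]cs; field.
- by field.
- by rewrite -[RHS]mul1r -[X in _ = X * _]cs; ring.
Qed.

Lemma sigma_neq0 t z : on_TS z -> rsubmx z != 0 -> rsubmx (sg t z) != 0.
Proof. by move=> Tz y0; rewrite -dot_gt0 (sigma_on_TS t Tz y0).2 dot_gt0. Qed.

Lemma enorm_sigma t z : on_TS z -> rsubmx z != 0 -> en (rsubmx (sg t z)) = en (rsubmx z).
Proof. by move=> Tz y0; rewrite /enorm (sigma_on_TS t Tz y0).2. Qed.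

Lemma sigmaD s t z : on_TS z -> rsubmx z != 0 -> sg s (sg t z) = sg (s + t) z.
Proof.
move=> Tz y0; have r0 : en (rsubmx z) != 0 by rewrite enorm_neq0.
rewrite [LHS]/sigma enorm_sigma// lsubmx_sigma rsubmx_sigma /sigma cosD sinD.
by congr row_mx; apply/rowP => i; rewrite !mxE; field.
Qed.

Lemma sigma0 z : sg 0 z = z.
Proof. by rewrite /sigma cos0 sin0 !mulr0 !scale1r scale0r oppr0 scale0r addr0 add0r hsubmxK. Qed.

Lemma enormN (y : 'rV[R]_n.+1) : en (- y) = en y.
Proof. by rewrite /enorm dotNl dotNr opprK. Qed.

Lemma sigma_fibre_neg t z : fibre_neg (sg t (fibre_neg z)) = sg (- t) z.
Proof.
rewrite /fibre_neg lsubmx_sigma rsubmx_sigma row_mxKl row_mxKr enormN /sigma cosN sinN.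
by congr row_mx; apply/rowP => i; rewrite !mxE; ring.
Qed.

Lemma cos_sin_int (k : int) : cos (k%:~R * pi) = (-1) ^ k :> R /\ sin (k%:~R * pi) = 0 :> R.
Proof.
have nat_case m : cos (m%:R * pi) = (-1) ^+ m :> R /\ sin (m%:R * pi) = 0 :> R.
  elim: m => [|m [IHc IHs]]; first by rewrite mul0r cos0 sin0.
  rewrite -natr1 mulrDl mul1r; split; [rewrite cosD|rewrite sinD];
    by rewrite IHc IHs cospi sinpi ?mulr0 ?mul0r ?subr0 ?addr0 // exprSr.
case: k => m; first exact: nat_case.
have [c s] := nat_case m.+1.
rewrite NegzE mulrNz mulNr cosN sinN c s oppr0; split=> //.
by rewrite -[LHS]invrK -exprVn invrN1 exprnN.
Qed.

Lemma sigma_int (k : int) z : sg (k%:~R * pi) z = (-1) ^ k *: z.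
Proof.
have [c s] := cos_sin_int k.
by rewrite /sigma c s !mulr0 oppr0 !scale0r addr0 add0r -scale_row_mx hsubmxK.
Qed.

Lemma smooth_sigma (F : normedModType R) {fF : findim F} (A : set F) (f : F -> R) (g : F -> E) :
  open A -> (forall w, A w -> rsubmx (g w) != 0) ->
  smooth A (f : F -> R^o) -> smooth A g -> smooth A (fun w => sg (f w) (g w)).
Proof.
move=> oA g0 sf sgg.
have sl : smooth A (fun w => lsubmx (g w)) by exact: smooth_lsubmx.
have sr : smooth A (fun w => rsubmx (g w)) by exact: smooth_rsubmx.
have se : smooth A (fun w => en (rsubmx (g w)) : R^o) by exact: smooth_enorm.
have sc : smooth A (fun w => cos (f w) : R^o) by exact: smooth_cos_comp.
have ss : smooth A (fun w => sin (f w) : R^o) by exact: smooth_sin_comp.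
have se' : smooth A (fun w => (en (rsubmx (g w)))^-1 : R^o).
  by apply: smoothV => // w /g0; rewrite enorm_neq0.
apply: smooth_row_mx => //; apply: smoothD => //; apply: smoothZ => //.
  exact: smoothM.
by apply: (@smoothN _ _ R^o) => //; exact: smoothM.
Qed.

Lemma open_rsubmx_neq0 : open [set z : E | rsubmx z != 0].
Proof.
have -> : [set z : E | rsubmx z != 0] = setT `&` [set z : E | 0 < dot (rsubmx z) (rsubmx z)].
  by apply/seteqP; split=> z /=; rewrite dot_gt0 => // -[].
by apply: open_smooth_gt; [exact: openT|have [] := @smooth_dots R n setT openT].
Qed.

Lemma differentiable_sigma (psi : E -> R) z : rsubmx z != 0 ->
  differentiable (psi : E -> R^o) z -> differentiable (fun w => sg (psi w) w) z.
Proof.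
move=> y0 dp.
have oN : open [set w : R^o * E | rsubmx w.2 != 0].
  have := @open_preimage R (R^o * E)%type E setT snd _ openT _ open_rsubmx_neq0.
  by rewrite setTI; apply => w _; exact: cvg_snd.
have ds : differentiable (fun w : R^o * E => sg w.1 w.2) (psi z, z).
  apply: (smooth_differentiable oN) => //.
  by apply: smooth_sigma => //; [exact: smooth_fst|exact: smooth_snd].
have dpair : differentiable (fun w => (psi w : R^o, w)) z by exact: differentiable_pair.
exact: (differentiable_comp dpair ds).
Qed.

End Rotation.

(** * Twists with a radial profile are symplectomorphisms *)

Section RadialTwist.
Variables (R : realType) (n : nat).
Local Notation dot := (dotp R n.+1).
Local Notation en := (enorm R n.+1).
Local Notation E := 'rV[R]_(n.+2 + n.+2).
Local Notation D := (DTS R n.+1).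
Local Notation sg := (sigma R n.+1).
Local Notation om := (@omega R n.+1).
Implicit Types (z u v : E) (s t : R).

Lemma form1_lambda (X : set E) : form1_near X (lambda_can R n.+1).
Proof.
exists setT; split=> //; first exact: openT.
  by move=> x _ s u v; rewrite /lambda_can linearP dotDr dotZr.
move=> v; apply: smooth_dot; first exact: openT.
  by have [] := smooth_coords (@openT E).
exact: smooth_cst.
Qed.

Lemma DTS_convex k : collar R (DTS_page R n.+1) k -> exact_symplectic_convex R (DTS_page R n.+1).
Proof.
move=> ck; split.
- exact: compact_DTS.
- exact: manifold_DTS.
- exact: form1_lambda.
- move=> x v Dx tv v0; have [w [tw ow]] := omega_nondegenerate Dx tv v0.
  by exists w; split=> //; rewrite /pomega extd_lambda.
- by exists k.
Qed.

(** A common form for the given twists, the flattened ones and all stages of their isotopies.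
    Smoothness across the zero section is demanded of the map; of the profile only derivability away
    from $r=0$ is asked. [e] is the sign on the zero section and [p] bounds the support away from
    the boundary. *)
Definition radial_twist (phi : E -> E) (f : R -> R) (e p : R) : Prop :=
  [/\ smooth_near D phi,
      forall z, D z -> phi z = if rsubmx z == 0 then e *: z else sg (f (en (rsubmx z))) z,
      e * e = 1,
      forall r, 0 < r <= 1 -> derivable (f : R -> R^o) r 1 &
      0 < p < 1 /\ forall r, p <= r -> f r = 0].

(** Such a [w] is a fibre direction over a point of the zero section, along which that point will be
    approached. *)
Lemma unit_tangent (x : 'rV[R]_n.+2) : x != 0 -> exists w, w != 0 /\ dot x w = 0.
Proof.
move=> /sign_entry[i [s [_ sx]]].
have xi0 : x 0 i != 0 by apply/eqP => h; move: sx; rewrite h mulr0 ltxx.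
pose b : 'rV[R]_n.+1 := delta_mx 0 ord0.
have bE j : b 0 j = (j == ord0)%:R by rewrite /b mxE eqxx.
have xb : dotp R n (del i x) b = del i x 0 ord0.
  rewrite /dotp (bigD1 ord0) //= big1 ?addr0 ?bE ?eqxx ?mulr1// => j j0.
  by rewrite bE (negbTE j0) mulr0.
exists (ins i (- del i x 0 ord0) (x 0 i *: b)); split.
  apply/eqP => /(congr1 (fun w => del i w 0 ord0)); rewrite insK [_ 0 ord0]mxE bE eqxx mulr1 !mxE => h.
  by move: xi0; rewrite h eqxx.
by rewrite -{1}(delK i x) dot_ins dotZr xb; ring.
Qed.

Lemma zero_at_right (H : R -> R^o) (e : R) : 0 < e -> {for 0, continuous H} ->
  (forall t, 0 < t < e -> H t = 0) -> H 0 = 0.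
Proof.
move=> e0 cH H0; have c1 : H t @[t --> 0^'+] --> H 0 by apply: cvg_at_right_filter.
rewrite -(cvg_lim _ c1)//; apply: lim_near_cst => //; near=> t; apply: H0.
by apply/andP; split; near: t; [exact: nbhs_right_gt|exact: nbhs_right_lt].
Unshelve. all: by end_near. Qed.

Section OneTwist.
Variables (phi : E -> E) (f : R -> R) (e p : R).
Hypothesis phiT : radial_twist phi f e p.

Lemma twist_mem z : D z -> D (phi z) /\ dot (rsubmx (phi z)) (rsubmx (phi z)) = dot (rsubmx z) (rsubmx z).
Proof.
have [_ pE e1 _ _] := phiT; move=> Dz; rewrite pE//; have [[x1 xy] y1] := (DTSP z).1 Dz.
case: eqVneq => [y0|y0].
  rewrite rsubmxZ y0 scaler0 dot0l; split=> //; apply/DTSP.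
  rewrite /on_TS lsubmxZ rsubmxZ y0 scaler0 dot0l dot0r dotZl dotZr mulrA e1 x1 mulr1.
  by [].
have [T1 T2] := sigma_on_TS (f (en (rsubmx z))) (conj x1 xy) y0.
by rewrite T2; split=> //; apply/DTSP; split=> //; rewrite T2.
Qed.

Lemma twist_neg z : D z -> D (fibre_neg z).
Proof.
move=> /DTSP[[x1 xy] y1]; apply/DTSP; rewrite /on_TS /fibre_neg row_mxKl row_mxKr.
by rewrite dotNr dotNl dotNr opprK xy oppr0.
Qed.

Lemma twist_inv z : D z -> fibre_neg (phi (fibre_neg (phi z))) = z.
Proof.
have [_ pE e1 _ _] := phiT; move=> Dz; have [Dp pp] := twist_mem Dz.
rewrite [phi (fibre_neg _)]pE; last exact: twist_neg.
have [y0|y0] := eqVneq (rsubmx z) 0.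
  have := pp; rewrite y0 dot0l => /eqP; rewrite dot_eq0 => /eqP py0.
  have -> : rsubmx (fibre_neg (phi z)) = 0 by rewrite row_mxKr py0 oppr0.
  by rewrite eqxx fibre_negZ fibre_negK pE// y0 eqxx scalerA e1 scale1r.
have py0 : rsubmx (phi z) != 0 by rewrite -dot_gt0 pp dot_gt0.
have -> : rsubmx (fibre_neg (phi z)) = - rsubmx (phi z) by rewrite row_mxKr.
rewrite oppr_eq0 (negbTE py0) enormN.
have -> : en (rsubmx (phi z)) = en (rsubmx z) by rewrite /enorm pp.
rewrite sigma_fibre_neg pE// (negbTE y0).
by rewrite sigmaD ?addNr ?sigma0//; exact: DTS_on_TS.
Qed.

(** The time is a function of $|y|$, so the correction terms in [omega_sigma] cancel. The formula
    for [phi] holds only on the bundle, hence the passage through [tangent_derive_eq]. *)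
Lemma twist_pullback_neq0 z u v : D z -> rsubmx z != 0 -> tangent D z u -> tangent D z v ->
  om ('D_u phi z) ('D_v phi z) = om u v.
Proof.
have [sphi pE e1 df _] := phiT; move=> Dz y0 tu tv.
pose psi (w : E) := f (en (rsubmx w)).
have Tz := DTS_on_TS Dz.
have r0 : 0 < en (rsubmx z) by rewrite enorm_gt0.
have r1 : en (rsubmx z) <= 1 by have [] : D z by [].
have den : differentiable (fun w : E => en (rsubmx w) : R^o) z.
  apply: (smooth_differentiable (@open_rsubmx_neq0 R n.+1)) => //.
  apply: smooth_enorm => //; first exact: open_rsubmx_neq0.
  by have [] := @smooth_coords R n.+1 _ (@open_rsubmx_neq0 R n.+1).
have dfr : differentiable (f : R^o -> R^o) (en (rsubmx z)).
  by apply/derivable1_diffP; apply: df; rewrite r0 r1.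
have dpsi : differentiable (psi : E -> R^o) z by exact: (differentiable_comp den dfr).
have dphi : differentiable phi z by exact: smooth_near_differentiable sphi Dz.
have dE w : tangent D z w -> 'D_w phi z = 'D_w (fun w => sg (psi w) w) z.
  move=> tw; apply: (@tangent_derive_eq _ _ _ _ _ (D `&` [set z | rsubmx z != 0])) => //.
  - exact: differentiable_sigma.
  - by move=> y [Dy yy]; rewrite pE// (negbTE yy).
  - by apply: tangent_near => //; exact: open_rsubmx_neq0.
rewrite !dE//.
have dpsiE w : is_derive z w (psi : E -> R^o)
    (derive1 f (en (rsubmx z)) * (dot (rsubmx z) (rsubmx w) / en (rsubmx z))).
  apply: (@is_derive_chain R E f (fun w => en (rsubmx w))).
    by split; [apply/derivable1_diffP|rewrite derive1E].
  by apply: is_derive_enorm => //; have [] := is_derive_coords z w.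
have tT w (tw : tangent D z w) := tangent_on_TS (@DTS_on_TS R n.+1) tw.
rewrite (omega_sigma (f := id) Tz y0 (tT _ tu) (tT _ tv) (is_derive_id_fun z u)
  (is_derive_id_fun z v) (dpsiE u) (dpsiE v)).
by ring.
Qed.

(* Over the zero section, [z] is approached along a fibre by points where the identity is already known. *)
Lemma twist_pullback z u v : D z -> tangent D z u -> tangent D z v ->
  om ('D_u phi z) ('D_v phi z) = om u v.
Proof.
move=> Dz tu tv; have [y0|y0] := eqVneq (rsubmx z) 0; last exact: twist_pullback_neq0.
have [sphi _ _ _ _] := phiT; have [U [oU DU sU]] := sphi.
have Tz := DTS_on_TS Dz; have [x1 _] := Tz; set x := lsubmx z in x1.
have tT w (tw : tangent D z w) := tangent_on_TS (@DTS_on_TS R n.+1) tw.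
have [xu xu'] := tT _ tu; have [xv xv'] := tT _ tv.
rewrite -/x y0 dot0l addr0 in xu'; rewrite -/x y0 dot0l addr0 in xv'.
rewrite -/x in xu xv.
have [w [w0 xw]] := unit_tangent (on_TS_neq0 Tz); rewrite -/x in xw.
pose zt t : E := row_mx x (t *: w).
(* The correction turning $u$, tangent at $z$, into a vector $u+t\,c(u)$ tangent at [zt t]: it
   restores $x\cdot u_y+y\cdot u_x=0$ for $y=tw$. *)
pose c (u : E) : E := row_mx 0 (- dot w (lsubmx u) *: x).
have z0 : zt 0 = z by rewrite /zt scale0r -y0 hsubmxK.
have szt : smooth setT (zt : R^o -> E).
  apply: smooth_row_mx; [exact: openT|exact: smooth_cst|].
  by apply: smoothZ; [exact: openT|exact: smooth_id|exact: smooth_cst].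
pose A := (setT : set R^o) `&` zt @^-1` U.
have oA : open A.
  by apply: open_preimage => //; [exact: openT|move=> t _; exact: (smooth_continuous szt)].
have A0 : A 0 by split=> //; rewrite /= z0; exact: DU.
have szA : smooth A (zt : R^o -> E) by exact: smooth_subset szt.
have sD (b : E) : smooth A (fun t : R^o => 'D_b phi (zt t)).
  have AU t : A t -> U (zt t) by case.
  exact: (smooth_comp oA oU AU szA (smooth_derive b sU)).
have sD' (b : E) : smooth A (fun t : R^o => 'D_b phi (zt t) + t *: 'D_(c b) phi (zt t)).
  apply: smoothD => //; apply: smoothZ => //; exact: smooth_id.
have sB (b : E) : smooth A (fun t : R^o => b + t *: c b).
  by apply: smoothD => //; [exact: smooth_cst|apply: smoothZ => //; [exact: smooth_id|exact: smooth_cst]].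
have som (f1 f2 : R^o -> E) : smooth A f1 -> smooth A f2 -> smooth A (fun t => om (f1 t) (f2 t) : R^o).
  move=> s1 s2; apply: (@smoothB R R^o R^o) => //; apply: smooth_dot => //;
  by [exact: smooth_rsubmx|exact: smooth_lsubmx].
pose H (t : R) : R^o := om ('D_u phi (zt t) + t *: 'D_(c u) phi (zt t)) ('D_v phi (zt t) + t *: 'D_(c v) phi (zt t))
  - om (u + t *: c u) (v + t *: c v).
have sH : smooth A (H : R^o -> R^o) by apply: (@smoothB R R^o R^o) => //; exact: som.
suff : H 0 = 0.
  by rewrite /H z0 !scale0r !addr0 => /eqP; rewrite subr_eq0 => /eqP.
(* For $0<t<d\le 1$ one has $t^2|w|^2\le 1$, so [zt t] lies in the disk bundle. *)
pose d := (dot w w + 1)^-1.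
have d0 : 0 < d by rewrite invr_gt0 ltr_wpDl ?dot_ge0.
have d1 : d <= 1 by rewrite invf_le1 ?lerDr ?dot_ge0// ltr_wpDl ?dot_ge0.
apply: (@zero_at_right H d d0); first exact: (smooth_continuous sH).
move=> t /andP[t0 te].
have tw1 : t * t * dot w w <= 1.
  apply: (@le_trans _ _ (d * (dot w w + 1))); last by rewrite mulVf// gt_eqF// ltr_wpDl ?dot_ge0.
  apply: ler_pM; rewrite ?dot_ge0 ?lerDl//; first by rewrite mulr_ge0// ltW.
  rewrite -[d]mulr1; apply: ler_pM; do ?[exact: ltW]; exact: le_trans (ltW te) d1.
have Dt : D (zt t).
  apply/DTSP; rewrite /on_TS /zt row_mxKl row_mxKr x1 dotZr xw mulr0; split=> //.
  by rewrite dotZl dotZr mulrA.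
have yt0 : rsubmx (zt t) != 0 by rewrite row_mxKr scaler_eq0 (gt_eqF t0).
have tt (b : E) : dot x (lsubmx b) = 0 -> dot x (rsubmx b) = 0 -> tangent D (zt t) (b + t *: c b).
  move=> xb xb'; apply: tangent_DTS => //; rewrite /tangent_TS !linearD /=.
  rewrite lsubmxZ rsubmxZ /c /zt !row_mxKl !row_mxKr scaler0 addr0; split=> //.
  by rewrite dotDr xb' !(dotZl, dotZr) x1; ring.
have dphi : differentiable phi (zt t) by exact: smooth_near_differentiable sphi Dt.
have dl (b : E) : 'D_b phi (zt t) + t *: 'D_(c b) phi (zt t) = 'D_(b + t *: c b) phi (zt t).
  by rewrite !deriveE// addrC [in RHS]addrC linearP.
by rewrite /H !dl (twist_pullback_neq0 Dt yt0 (tt _ xu xu') (tt _ xv xv')) subrr.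
Qed.

Lemma twist_symplecto : symplecto R (DTS_page R n.+1) phi.
Proof.
have [sphi pE e1 _ [/andP[p0 p1] fp]] := phiT.
have im : phi @` D = D.
  apply/seteqP; split=> [w [z Dz <-]|z Dz]; first exact: (twist_mem Dz).1.
  exists (fibre_neg (phi (fibre_neg z))); first exact: twist_neg (twist_mem (twist_neg Dz)).1.
  by rewrite -[LHS]fibre_negK twist_inv ?fibre_negK//; exact: twist_neg.
split=> //.
- split=> //; exists (fun w => fibre_neg (phi (fibre_neg w))); split; last exact: twist_inv.
  rewrite im; apply: (@smooth_near_comp _ _ _ _ _ _ _ D D) => [w Dw||].
  + exact: (twist_mem (twist_neg Dw)).1.
  + apply: (smooth_near_comp twist_neg) => //.
    by apply: smooth_nearT; apply: smooth_fibre_neg; exact: openT.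
  + by apply: smooth_nearT; apply: smooth_fibre_neg; exact: openT.
- move=> z u v Dz tu tv; rewrite /pomega !extd_lambda; exact: twist_pullback.
exists (setT `&` [set z : E | p * p < dot (rsubmx z) (rsubmx z)]); split.
- by apply: open_smooth_gt; [exact: openT|have [] := @smooth_dots R n.+1 setT openT].
- rewrite /bd /= boundary_DTS => z [Dz y1]; split=> //=.
  by rewrite y1 -expr2 expr_lt1// ltW.
move=> z Dz [_ /= pz]; have y0 : rsubmx z != 0.
  by rewrite -dot_gt0; apply: le_lt_trans pz; rewrite mulr_ge0// ltW.
rewrite pE// (negbTE y0) fp ?sigma0//.
rewrite -(@ler_pXn2r _ 2) ?nnegrE ?enorm_ge0 ?(ltW p0)// enorm_sqr expr2.
exact: ltW.
Qed.

End OneTwist.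

End RadialTwist.

(** * Isotopies of twists *)

Section TwistIsotopies.
Variables (R : realType) (n : nat).
Local Notation dot := (dotp R n.+1).
Local Notation en := (enorm R n.+1).
Local Notation E := 'rV[R]_(n.+2 + n.+2).
Local Notation D := (DTS R n.+1).
Local Notation sg := (sigma R n.+1).
Local Notation P := (DTS_page R n.+1).
Local Notation profile := (smooth_near [set r : R | 0 <= r]).
Implicit Types (z u v : E) (s t : R).

Definition cyl : set (R * E) := [set w | 0 <= w.1 <= 1 /\ D w.2].

Lemma smooth_near_slice (Phi : R * E -> E) s : smooth_near cyl Phi -> 0 <= s <= 1 ->
  smooth_near D (fun z => Phi (s, z)).
Proof.
move=> sPhi s01; apply: (smooth_near_comp (Y := cyl) (f := fun z => (s : R^o, z))) => //.
apply: smooth_nearT; apply: smooth_pair; [exact: openT|exact: smooth_cst|exact: smooth_id].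
Qed.

Lemma profile_derivable (g : R -> R) r : profile (g : R -> R^o) -> 0 <= r ->
  derivable (g : R -> R^o) r 1.
Proof.
move=> [U [oU rU sU]] r0; apply: diff_derivable.
by apply: (@smooth_differentiable R R^o R^o _ _ U) => //; exact: rU.
Qed.

(** Puts the case $k=0$, where [is_twist] gives no profile, on the same footing through the zero
    profile with support radius $1/2$. The map [phi0] stands for any representative agreeing with
    [tau] on the bundle. *)
Lemma is_twist_radial (k : int) (tau phi0 : E -> E) : is_twist R n.+1 k tau ->
  smooth_near D phi0 -> (forall z, D z -> phi0 z = tau z) ->
  exists g p, [/\ radial_twist phi0 g ((-1) ^ k) p, profile (g : R -> R^o) & g 0 = k%:~R * pi].
Proof.
have e1 (j : int) : (-1) ^ j * (-1) ^ j = 1 :> R by rewrite -expfzMl mulrNN mul1r exp1rz.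
rewrite /is_twist => + s0 p0; case: eqVneq => [->|k0] tw.
  exists (fun _ => 0), 2^-1; split; last 2 first.
  - by apply: smooth_nearT; exact: smooth_cst.
  - by rewrite mul0r.
  split=> //.
  - move=> z Dz; rewrite p0// tw// sigma0 expr0z scale1r; by case: ifP.
  - by split=> //; rewrite invr_gt0 ltr0n invf_lt1 ?ltr1n.
case: tw => _ [g [[sgr g0 _ [p [p1 _ gp]]] tE]]; exists g, p; split=> //.
split=> //.
- move=> z Dz; rewrite p0// tE// /twist_map; case: eqVneq => [y0|//].
  by rewrite -[in RHS](hsubmxK z) y0 scale_row_mx scaler0.
- by move=> r /andP[r0 _]; apply: profile_derivable => //; exact: ltW.
Qed.

(** The isotopy is $\sigma_{(1-s)m}$. Since [m] vanishes near $r=0$, it extends smoothly by the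
    identity over the zero section; since [m] vanishes from $p<1$ on, it is fixed near the
    boundary. *)
Lemma sigma_family (m : R -> R) (a p : R) : 0 < a -> 0 < p < 1 -> profile (m : R -> R^o) ->
  (forall r, r * r <= a -> m r = 0) -> (forall r, p <= r -> m r = 0) ->
  symp_isotopic R P (fun z => sg (m (en (rsubmx z))) z) id.
Proof.
move=> a0 p01 sm ma mp; have [U [oU rU sU]] := sm.
have oT : open (setT : set (R^o * E)) by exact: openT.
have s2 A : open A -> smooth A (fun w : R^o * E => w.2) by move=> _; exact: smooth_snd.
have sr A : open A -> smooth A (fun w : R^o * E => rsubmx w.2).
  by move=> oA; apply: smooth_rsubmx => //; exact: s2.
have sd A : open A -> smooth A (fun w : R^o * E => dot (rsubmx w.2) (rsubmx w.2) : R^o).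
  by move=> oA; apply: smooth_dot => //; exact: sr.
pose A0 : set (R^o * E) := setT `&` [set w | 0 < dot (rsubmx w.2) (rsubmx w.2)].
have oA0 : open A0 by apply: open_smooth_gt => //; exact: sd.
have A0y w : A0 w -> rsubmx w.2 != 0 by move=> [_ /=]; rewrite dot_gt0.
have se : smooth A0 (fun w : R^o * E => en (rsubmx w.2) : R^o).
  by apply: smooth_enorm => //; exact: sr.
pose A1 : set (R^o * E) := A0 `&` (fun w => en (rsubmx w.2)) @^-1` U.
have oA1 : open A1.
  apply: (@open_preimage _ _ _ A0 (fun w : R^o * E => en (rsubmx w.2) : R^o)) => // w.
  exact: smooth_continuous.
pose A2 : set (R^o * E) := setT `&` [set w | dot (rsubmx w.2) (rsubmx w.2) < a].
have oA2 : open A2 by apply: open_smooth_lt => //; exact: sd.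
pose Phi (w : R^o * E) := sg ((1 - w.1) * m (en (rsubmx w.2))) w.2.
have sPhi : smooth_near cyl Phi.
  exists (A1 `|` A2); split; first exact: openU.
    move=> [s z] /= [_ Dz]; have [y0|y0] := eqVneq (rsubmx z) 0.
      by right; split=> //=; rewrite y0 dot0l.
    by left; split; [split=> //=; rewrite dot_gt0|exact/rU/enorm_ge0].
  apply: smooth_local => w [Aw|Aw]; [exists A1|exists A2]; split=> //.
    apply: smooth_sigma => // [w' []||]; [by move=> /A0y| |exact: smooth_snd].
    apply: smoothM => //.
      by apply: (@smoothB _ _ R^o) => //; [exact: smooth_cst|exact: smooth_fst].
    apply: (@smooth_comp R _ R^o R^o _ _ _ A1 U (fun w => en (rsubmx w.2)) m) => //; first by move=> w' [].
    by apply: smooth_subset se => w' [].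
  apply: (@smooth_eq R _ _ A2 snd) => //; last exact: smooth_snd.
  move=> w' [_ /= h]; rewrite /Phi ma ?mulr0 ?sigma0//.
  by rewrite -expr2 enorm_sqr ltW.
exists Phi; split=> //.
- move=> s s01; apply: (@twist_symplecto R n _ (fun r => (1 - s) * m r) 1 p); split.
  + exact: smooth_near_slice.
  + move=> z Dz; case: eqVneq => // y0; rewrite /Phi /= ma ?mulr0 ?sigma0 ?scale1r//.
    by rewrite -expr2 enorm_sqr y0 dot0l ltW.
  + by rewrite mulr1.
  + move=> r /andP[r0 _]; apply: (@derivableZ _ R^o R^o); apply: profile_derivable => //; exact: ltW.
  + by split=> // r pr; rewrite mp// mulr0.
- exists (setT `&` [set z : E | p * p < dot (rsubmx z) (rsubmx z)]); split.
  + by apply: open_smooth_gt; [exact: openT|have [] := @smooth_dots R n.+1 setT openT].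
  + rewrite /bd /= boundary_DTS => z [Dz y1]; split=> //=.
    by rewrite y1; case/andP: p01 => p0 p1; rewrite -expr2 expr_lt1// ltW.
  move=> s z _ Dz [_ /= pz]; rewrite /Phi /= mp ?mulr0 ?sigma0//.
  case/andP: p01 => p0 p1.
  rewrite -(@ler_pXn2r _ 2) ?nnegrE ?enorm_ge0 ?(ltW p0)// enorm_sqr expr2.
  exact: ltW.
- by move=> z Dz; rewrite /Phi /= subr0 mul1r.
- by move=> z Dz; rewrite /Phi /= subrr mul0r sigma0.
Qed.

(* Rescaling the fibre coordinate by [1 - cutoff] near the zero section makes the
   profile constant there; written through [phi0] so as to stay smooth at [y = 0]. *)
Lemma flatten (phi0 : E -> E) (g : R -> R) (k : int) (p : R) :
  radial_twist phi0 g ((-1) ^ k) p -> profile (g : R -> R^o) -> g 0 = k%:~R * pi ->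
  exists delta, symp_isotopic R P delta id /\ forall z, D z -> delta (phi0 z) =
    if rsubmx z == 0 then (-1) ^ k *: z
    else sg (g ((1 - cutoff 16^-1 8^-1 (en (rsubmx z) ^+ 2)) * en (rsubmx z))) z.
Proof.
move=> tw sg' g0; have [sphi pE e1 _ _] := tw; set e := (-1) ^ k in tw pE e1 *.
(* [lam 1] is constantly 1 and [lam 0] is the full flattening factor, 0 for $r^2\le 1/16$. For
   $r^2\ge 1/8$ the value is 1 at every [s]. *)
pose lam (s r : R) := 1 - (1 - s) * cutoff 16^-1 8^-1 (r ^+ 2).
have c01 : 16^-1 < 8^-1 :> R by rewrite ltf_pV2 ?posrE ?ltr0n// ltr_nat.
have lam0 s r : 0 <= s <= 1 -> 0 <= lam s r <= 1.
  move=> /andP[s0 s1]; have c0 := cutoff_ge0 (r ^+ 2) c01; have c1 := cutoff_le1 (r ^+ 2) c01.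
  have h0 : 0 <= (1 - s) * cutoff 16^-1 8^-1 (r ^+ 2) by rewrite mulr_ge0 ?subr_ge0.
  have h1 : (1 - s) * cutoff 16^-1 8^-1 (r ^+ 2) <= 1.
    by rewrite -[leRHS]mulr1; apply: ler_pM => //; lra.
  by apply/andP; split; rewrite /lam; lra.
pose scal (w : R^o * E) : E := row_mx (lsubmx w.2) (lam w.1 (en (rsubmx w.2)) *: rsubmx w.2).
(* Rebuilds a point of the orbit of $(x,y)$ from its base component
   $X=\cos\theta\,x+\sin\theta\,y/|y|$: as $x\cdot X=\cos\theta$ and $y\cdot X=|y|\sin\theta$, the
   fibre part is $-(y\cdot X)x+(x\cdot X)y$. No division occurs, so the formula is smooth at $y=0$,
   and only the base component of [phi0] at the rescaled point is used. *)
pose mix (q : (R^o * E) * E) : E :=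
  row_mx (lsubmx q.2)
    (- dot (rsubmx q.1.2) (lsubmx q.2) *: lsubmx q.1.2
     + dot (lsubmx q.1.2) (lsubmx q.2) *: rsubmx q.1.2).
pose Theta (w : R^o * E) := mix (w, phi0 (scal w)).
(* The inverse of [phi0]. Thus [Delta] at stage [s] undoes [phi0] and then applies the twist with
   rescaled profile; at [s = 1] the two cancel. *)
pose back (z : E) := fibre_neg (phi0 (fibre_neg z)).
pose Delta (w : R^o * E) := Theta (w.1, back w.2).
have scalD w : cyl w -> D (scal w).
  case: w => s z [/= s01 Dz]; have [[x1 xy] y1] := (DTSP z).1 Dz.
  apply/DTSP; rewrite /on_TS /scal row_mxKl row_mxKr /= dotZr xy mulr0; split=> //.
  have /andP[l0 l1] := lam0 s (en (rsubmx z)) s01.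
  rewrite dotZl dotZr mulrA -[leRHS]mulr1; apply: ler_pM; rewrite ?dot_ge0 ?mulr_ge0//.
  by rewrite -[leRHS]mulr1; apply: ler_pM.
have backD z : D z -> D (back z).
  by move=> Dz; apply: twist_neg; apply: (twist_mem tw _).1; exact: twist_neg.
have oT : open (setT : set (R^o * E)) by exact: openT.
have sscal : smooth setT scal.
  have s2 : smooth setT (fun w : R^o * E => rsubmx w.2) by apply: smooth_rsubmx => //; exact: smooth_snd.
  apply: smooth_row_mx => //; first by apply: smooth_lsubmx => //; exact: smooth_snd.
  apply: smoothZ => //; apply: (@smoothB _ _ R^o) => //; first exact: smooth_cst.
  apply: smoothM => //.
    by apply: (@smoothB _ _ R^o) => //; [exact: smooth_cst|exact: smooth_fst].
  apply: smooth_cutoff_comp => //.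
  apply: (@smooth_eq _ _ R^o _ (fun w : R^o * E => dot (rsubmx w.2) (rsubmx w.2))) => //.
    by move=> w _; rewrite enorm_sqr.
  exact: smooth_dot.
have oT2 : open (setT : set ((R^o * E) * E)) by exact: openT.
have smix : smooth setT mix.
  have a1 : smooth setT (fun q : (R^o * E) * E => q.1.2).
    apply: (@smooth_comp R _ _ _ _ _ _ setT setT fst snd) => //; [exact: smooth_fst|exact: smooth_snd].
  have a2 : smooth setT (fun q : (R^o * E) * E => q.2) by exact: smooth_snd.
  have b1 := smooth_lsubmx oT2 a1; have b2 := smooth_rsubmx oT2 a1; have b3 := smooth_lsubmx oT2 a2.
  apply: smooth_row_mx => //; apply: smoothD => //; apply: smoothZ => //; last exact: smooth_dot.
  by apply: (@smoothN _ _ R^o) => //; exact: smooth_dot.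
have sback : smooth_near D back.
  apply: (@smooth_near_comp _ _ _ _ _ _ _ D D) => [w Dw||].
  - exact: (twist_mem tw (twist_neg Dw)).1.
  - apply: (smooth_near_comp (@twist_neg R n)) => //.
    by apply: smooth_nearT; apply: smooth_fibre_neg; exact: openT.
  - by apply: smooth_nearT; apply: smooth_fibre_neg; exact: openT.
have sTheta : smooth_near cyl Theta.
  apply: (smooth_near_comp (Y := setT) (f := fun w => (w, phi0 (scal w))) (g := mix)) => //.
    apply: smooth_near_pair; first by apply: smooth_nearT; exact: smooth_id.
    by apply: (smooth_near_comp scalD) => //; exact: smooth_nearT.
  exact: smooth_nearT.
have sDelta : smooth_near cyl Delta.
  apply: (smooth_near_comp (Y := cyl) (f := fun w : R^o * E => (w.1, back w.2)) (g := Theta)) => //.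
    by case=> s z [/= s01 Dz]; split=> //=; exact: backD.
  apply: smooth_near_pair; first by apply: smooth_nearT; exact: smooth_fst.
  apply: (smooth_near_comp (Y := D) (f := snd)) => //; first by case=> s z [].
  by apply: smooth_nearT; exact: smooth_snd.
have ThetaE s z : 0 <= s <= 1 -> D z -> Theta (s, z) =
    if rsubmx z == 0 then e *: z else sg (g (lam s (en (rsubmx z)) * en (rsubmx z))) z.
  move=> s01 Dz; have [[x1 xy] y1] := (DTSP z).1 Dz.
  have Ds : D (scal (s, z)) by exact: scalD.
  rewrite /Theta /mix /= pE//.
  have rs : rsubmx (scal (s, z)) = lam s (en (rsubmx z)) *: rsubmx z by rewrite row_mxKr.
  have ls : lsubmx (scal (s, z)) = lsubmx z by rewrite row_mxKl.
  rewrite rs; have [y0|y0] := eqVneq (rsubmx z) 0.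
    rewrite y0 scaler0 eqxx lsubmxZ ls !dot0l oppr0 scale0r scaler0 addr0.
    by rewrite -[in RHS](hsubmxK z) y0 scale_row_mx scaler0.
  have r0 : en (rsubmx z) != 0 by rewrite enorm_neq0.
  set r := en (rsubmx z) in r0 *.
  have /andP[l0 l1] := lam0 s r s01.
  (* Here the rescaled point lies on the zero section although $y\neq 0$; the sign $(-1)^k$ of
     [phi0] there is $\sigma$ at the profile value $g(0)=k\pi$. *)
  have [lz|lz] := eqVneq (lam s r) 0.
    rewrite lz scale0r eqxx mul0r g0 sigma_int lsubmxZ ls !dotZr (dotC (rsubmx z)) xy x1.
    rewrite mulr0 oppr0 scale0r add0r mulr1.
    by rewrite -[in RHS](hsubmxK z) scale_row_mx.
  rewrite scaler_eq0 (negbTE lz) (negbTE y0) lsubmx_sigma ls rs.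
  have -> : en (lam s r *: rsubmx z) = lam s r * r.
    by rewrite /enorm dotZl dotZr mulrA -expr2 sqrtrM ?sqr_ge0// sqrtr_sqr ger0_norm.
  rewrite /sigma -/r !dotDr !dotZr x1 (dotC (rsubmx z)) xy -enorm_sqr -/r.
  by congr row_mx; apply/rowP => i; rewrite !mxE; field; rewrite ?lz ?r0.
have backE z : D z -> back z = if rsubmx z == 0 then e *: z else sg (- g (en (rsubmx z))) z.
  move=> Dz; rewrite /back pE; last exact: twist_neg.
  rewrite [rsubmx (fibre_neg z)]row_mxKr oppr_eq0 enormN; case: ifP => _.
    by rewrite fibre_negZ fibre_negK.
  exact: sigma_fibre_neg.
have DeltaE s z : 0 <= s <= 1 -> D z -> Delta (s, z) =
    if rsubmx z == 0 then z else sg (g (lam s (en (rsubmx z)) * en (rsubmx z)) - g (en (rsubmx z))) z.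
  move=> s01 Dz; rewrite /Delta /= ThetaE//; last exact: backD.
  rewrite backE//; have Tz := DTS_on_TS Dz; case: (eqVneq (rsubmx z) 0) => y0.
    by rewrite rsubmxZ y0 scaler0 eqxx scalerA e1 scale1r.
  by rewrite (negbTE (sigma_neq0 _ Tz y0)) enorm_sigma// sigmaD.
have lam1 s r : 2^-1 <= r -> lam s r = 1.
  move=> r2; rewrite /lam cutoff0 ?mulr0 ?subr0//.
  apply: (@le_trans _ _ (2^-1 * 2^-1)); last by rewrite expr2; apply: ler_pM => //; rewrite invr_ge0 ler0n.
  by rewrite -invfM -natrM lef_pV2 ?posrE ?ltr0n// ler_nat.
have dlam s r : derivable (lam s : R -> R^o) r 1.
  apply: diff_derivable; apply: (@smooth_differentiable R R^o R^o _ _ setT) => //; first exact: openT.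
  apply: (@smoothB _ _ R^o); [exact: openT|exact: smooth_cst|].
  apply: (@smoothM R R^o); [exact: openT|exact: smooth_cst|].
  apply: (@smooth_cutoff_comp R R^o _ _ _ _ (fun r => r ^+ 2)) => //; first exact: openT.
  apply: (@smooth_eq R R^o R^o _ (fun r => r * r)); [exact: openT|by []|].
  by apply: (@smoothM R R^o); [exact: openT|exact: smooth_id|exact: smooth_id].
exists (fun z => Delta (0, z)); split.
  exists Delta; split=> //.
  - move=> s s01; apply: (@twist_symplecto R n _ (fun r => g (lam s r * r) - g r) 1 2^-1); split.
    + exact: smooth_near_slice.
    + by move=> z Dz; rewrite DeltaE// scale1r.
    + by rewrite mulr1.
    + move=> r /andP[r0 _]; apply: derivableB; last by apply: profile_derivable => //; exact: ltW.
      have /andP[l0 _] := lam0 s r s01.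
      have dg : derivable (g : R -> R^o) (lam s r * r) 1.
        by apply: profile_derivable => //; rewrite mulr_ge0// ltW.
      have dl : is_derive r (1 : R) (fun r => lam s r * r : R^o) ('D_1 (lam s : R -> R^o) r * r + lam s r * 1).
        exact: (@is_deriveM_fun R R^o (lam s) id r 1 _ _ (derivableP (dlam s r)) (is_derive_id _ _)).
      by have [] := @is_derive_chain R R^o g (fun r => lam s r * r) r 1 _ _ (derivableP dg) dl.
    + split; first by rewrite invr_gt0 ltr0n invf_lt1 ?ltr1n.
      by move=> r r2; rewrite lam1// mul1r subrr.
  - exists (setT `&` [set z : E | 2^-1 * 2^-1 < dot (rsubmx z) (rsubmx z)]); split.
    + by apply: open_smooth_gt; [exact: openT|have [] := @smooth_dots R n.+1 setT openT].
    + rewrite /bd /= boundary_DTS => z [Dz y1]; split=> //=.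
      by rewrite y1 -invfM -natrM invf_lt1 ?ltr1n.
    move=> s z s01 Dz [_ /= pz]; rewrite DeltaE//; case: ifP => // y0.
    rewrite lam1 ?mul1r ?subrr ?sigma0//.
    rewrite -(@ler_pXn2r _ 2) ?nnegrE ?enorm_ge0 ?invr_ge0 ?ler0n// enorm_sqr expr2.
    exact: ltW.
  - move=> z Dz; rewrite DeltaE ?ler01 ?lexx//; case: ifP => // _.
    by rewrite /lam subrr mul0r subr0 mul1r subrr sigma0.
move=> z Dz; have [Dp pp] := twist_mem tw Dz; rewrite DeltaE ?lexx ?ler01//.
have Tz := DTS_on_TS Dz; rewrite -dot_eq0 pp dot_eq0 pE//; case: eqVneq => // y0.
by rewrite enorm_sigma// sigmaD// subrK /lam subr0 mul1r.
Qed.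

End TwistIsotopies.

Lemma is_deriveN_fun (R : realType) (E F : normedModType R) (f : E -> F) x v df :
  is_derive x v f df -> is_derive x v (fun y => - f y) (- df).
Proof. by move=> hf; exact: is_deriveN. Qed.

Lemma pullback2_inverse (R : realType) (E F : normedModType R) {fE : findim E} {fF : findim F}
    (X : set E) (Y : set F) (f : E -> F) (g : F -> E) a b :
  smooth_near X f -> smooth_near Y g -> (forall y, Y y -> X (g y)) ->
  (forall y, Y y -> f (g y) = y) -> pullback2 X f (fun _ => b) (fun _ => a) ->
  pullback2 Y g (fun _ => a) (fun _ => b).
Proof.
move=> sf sg YX fg fb y u v Yy tu tv.
have dg : differentiable g y by exact: smooth_near_differentiable sg Yy.
have df : differentiable f (g y) by exact: smooth_near_differentiable sf (YX _ Yy).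
have dE w : tangent Y y w -> 'D_('D_w g y) f (g y) = w.
  move=> tw; rewrite -derive_comp//.
  rewrite (@tangent_derive_eq R F F _ _ Y (fun y => f (g y)) id y w) ?derive_id//.
  exact: (differentiable_comp dg df).
rewrite -(fb (g y)) ?dE//; [exact: YX|exact: tangent_push tu|exact: tangent_push tv].
Qed.

(** * Rotation in a tube around a codimension two cotangent bundle *)

Section Tube.
Variables (R : realType) (n : nat).
Local Notation dot := (dotp R n.+1).
Local Notation dot2 := (dotp R n.+2).
Local Notation en := (enorm R n.+1).
Local Notation B := 'rV[R]_(n.+2 + n.+2).
Local Notation E := 'rV[R]_(n.+3 + n.+3).
Local Notation W := (B * (R^o * R^o))%type.
Local Notation D := (DTS R n.+2).
Local Notation sg := (sigma R n.+1).

Definition tube_domain : set W := [set w | on_TS w.1 /\ w.2.1 * w.2.1 < 1].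

(** The form $dY\wedge dX+dp\wedge du$. *)
Definition tube_form (a b : W) : R := omega a.1 b.1 + a.2.2 * b.2.1 - b.2.2 * a.2.1.

Definition wid (u : R) : R := Num.sqrt (1 - u * u).

(* The symplectic coordinates [(X, Y; u, p)] around [T*S^(n+1)]: here
   [x = (u, c X)] with [c = sqrt (1 - u^2)], and [y . dx = Y . dX + p du]. *)
Definition tube (w : W) : E :=
  let u := w.2.1 in let p := w.2.2 in let c := wid u in
  row_mx (ins ord0 u (c *: lsubmx w.1))
         (ins ord0 (p * (c * c)) (c^-1 *: rsubmx w.1 + - (u * p * c) *: lsubmx w.1)).

Definition untube (z : E) : W :=
  let u := lsubmx z 0 ord0 in let v := rsubmx z 0 ord0 in let c := wid u in
  (row_mx (c^-1 *: del ord0 (lsubmx z))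
          (c *: del ord0 (rsubmx z) + (u * v * c^-1) *: del ord0 (lsubmx z)),
   (u, v * (c^-1 * c^-1))).

Lemma wid_gt0 u : u * u < 1 -> 0 < wid u.
Proof. by move=> u1; rewrite sqrtr_gt0 subr_gt0. Qed.

Lemma wid_sqr u : u * u < 1 -> wid u * wid u = 1 - u * u.
Proof. by move=> u1; rewrite -expr2 sqr_sqrtr// subr_ge0 ltW. Qed.

Lemma tubeK w : w.2.1 * w.2.1 < 1 -> untube (tube w) = w.
Proof.
case: w => z [u p] /= u1; have c0 := wid_gt0 u1.
rewrite /untube /tube /= !row_mxKl !row_mxKr !ins_eq !insK.
set c := wid u in c0 *; have c1 : c != 0 by rewrite gt_eqF.
congr (_, (_, _)); last by field.
by rewrite -[RHS]hsubmxK; congr row_mx; apply/rowP => i; rewrite !mxE; field.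
Qed.

Lemma untubeK z : lsubmx z 0 ord0 * lsubmx z 0 ord0 < 1 -> tube (untube z) = z.
Proof.
move=> u1; have c0 := wid_gt0 u1; rewrite /untube /tube /= !row_mxKl !row_mxKr.
set c := wid _ in c0 *; have c1 : c != 0 by rewrite gt_eqF.
rewrite scalerA divff// scale1r delK -[RHS]hsubmxK; congr row_mx.
rewrite -[RHS](delK ord0); congr ins; first by field.
by apply/rowP => i; rewrite !mxE; field.
Qed.

Lemma tube_on_TS w : tube_domain w -> on_TS (tube w).
Proof.
case: w => z [u p] [/= [x1 xy] u1]; have c0 := wid_gt0 u1; have cc := wid_sqr u1.
rewrite /on_TS /tube /= row_mxKl row_mxKr !dot_ins; set c := wid u in c0 cc *.
have c1 : c != 0 by rewrite gt_eqF.
rewrite !(dotDr, dotZl, dotZr) x1 xy; split; last by field.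
by rewrite mulr1 cc; ring.
Qed.

Lemma dot_tube w : tube_domain w -> dot2 (rsubmx (tube w)) (rsubmx (tube w)) =
  w.2.2 * w.2.2 * (1 - w.2.1 * w.2.1) + dot (rsubmx w.1) (rsubmx w.1) / (1 - w.2.1 * w.2.1).
Proof.
case: w => z [u p] [/= [x1 xy] u1]; have c0 := wid_gt0 u1; have cc := wid_sqr u1.
rewrite /tube /= row_mxKr !dot_ins; set c := wid u in c0 cc *.
have c1 : c != 0 by rewrite gt_eqF.
rewrite !(dotDl, dotDr, dotZl, dotZr) (dotC (rsubmx z) (lsubmx z)) x1 xy -cc.
have -> : u * p * c = u * (p * c) by ring.
have e : u * u = 1 - c * c by rewrite cc; ring.
rewrite (_ : - (u * (p * c)) * (- (u * (p * c)) * 1) = (u * u) * (p * c * (p * c))); last by ring.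
by rewrite e; field.
Qed.

Lemma untube_on_TS z : on_TS z -> lsubmx z 0 ord0 * lsubmx z 0 ord0 < 1 -> tube_domain (untube z).
Proof.
move=> []; rewrite (dot_del ord0) => x1; rewrite (dot_del ord0) => xy u1.
have c0 := wid_gt0 u1; have cc := wid_sqr u1.
split=> //; rewrite /on_TS /untube /= row_mxKl row_mxKr.
set c := wid _ in c0 cc *; set u := lsubmx z 0 ord0 in x1 xy u1 cc *.
have c1 : c != 0 by rewrite gt_eqF.
set a := del _ _ in x1 xy *; set b := del _ _ in xy *; set v := rsubmx z 0 ord0 in xy *.
rewrite !(dotDr, dotZl, dotZr).
have aa : dot a a = c * c by rewrite cc; lra.
have ab : dot a b = - (u * v) by apply/eqP; rewrite -addr_eq0 addrC xy.
by rewrite aa ab; split; field.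
Qed.

Lemma open_sq_lt (F : normedModType R) (A : set F) (f : F -> R) (a : R) : open A ->
  smooth A (f : F -> R^o) -> open (A `&` [set x | f x * f x < a]).
Proof. by move=> oA sf; apply: open_smooth_lt => //; exact: smoothM. Qed.

Lemma smooth_wid (F : normedModType R) {fF : findim F} (A : set F) (f : F -> R) : open A ->
  (forall x, A x -> f x * f x < 1) -> smooth A (f : F -> R^o) ->
  smooth A (fun x => wid (f x) : R^o) /\ smooth A (fun x => (wid (f x))^-1 : R^o).
Proof.
move=> oA f1 sf.
have s1 : smooth A (fun x => wid (f x) : R^o).
  apply: smooth_sqrt_comp => // [x /f1|]; first by rewrite subr_gt0.
  by apply: (@smoothB _ _ R^o) => //; [exact: smooth_cst|exact: smoothM].
by split=> //; apply: smoothV => // x /f1 /wid_gt0 h; rewrite gt_eqF.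
Qed.

Lemma smooth_W (A : set W) : open A -> [/\ smooth A (fun w => lsubmx w.1),
  smooth A (fun w => rsubmx w.1), smooth A (fun w => w.2.1) & smooth A (fun w => w.2.2)].
Proof.
move=> oA.
have s1 : smooth A (fun w : W => w.1) by exact: smooth_fst.
have s2 : smooth A (fun w : W => w.2) by exact: smooth_snd.
split; [exact: smooth_lsubmx|exact: smooth_rsubmx| |].
  by apply: (@smooth_comp R _ _ _ _ _ _ A setT snd fst) => //; [exact: openT|exact: smooth_fst].
by apply: (@smooth_comp R _ _ _ _ _ _ A setT snd snd) => //; [exact: openT|exact: smooth_snd].
Qed.

Definition tube_open : set W := setT `&` [set w | w.2.1 * w.2.1 < 1].

Lemma open_tube_open : open tube_open.
Proof. by apply: open_sq_lt; [exact: openT|have [] := smooth_W openT]. Qed.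

Lemma smooth_tube : smooth tube_open tube.
Proof.
have oA := open_tube_open; have [s1 s2 s3 s4] := smooth_W oA.
have [c1 c2] := @smooth_wid _ _ _ (fun w : W => w.2.1) oA (fun w h => h.2) s3.
apply: smooth_row_mx => //; apply: smooth_ins => //.
- exact: smoothZ.
- by apply: smoothM => //; exact: smoothM.
apply: smoothD => //; apply: smoothZ => //.
by apply: (@smoothN _ _ R^o) => //; apply: smoothM => //; exact: smoothM.
Qed.

Definition untube_open : set E := setT `&` [set z | lsubmx z 0 ord0 * lsubmx z 0 ord0 < 1].

Lemma smooth_head (A : set E) : open A -> smooth A (fun z => lsubmx z 0 ord0 : R^o) /\
  smooth A (fun z => rsubmx z 0 ord0 : R^o).
Proof. by move=> oA; have [sl sr] := smooth_coords oA; split; exact: smooth_entry. Qed.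

Lemma open_untube_open : open untube_open.
Proof. by apply: open_sq_lt; [exact: openT|have [] := smooth_head openT]. Qed.

Lemma smooth_untube : smooth untube_open untube.
Proof.
have oA := open_untube_open; have [su sv] := smooth_head oA; have [sl sr] := smooth_coords oA.
have [c1 c2] := @smooth_wid _ _ _ (fun z : E => lsubmx z 0 ord0) oA (fun w h => h.2) su.
have d1 : smooth untube_open (fun z : E => del ord0 (lsubmx z)) by exact: smooth_del.
have d2 : smooth untube_open (fun z : E => del ord0 (rsubmx z)) by exact: smooth_del.
apply: smooth_pair => //.
  apply: smooth_row_mx => //; first exact: smoothZ.
  by apply: smoothD => //; apply: smoothZ => //; apply: smoothM => //; exact: smoothM.
by apply: smooth_pair => //; apply: smoothM => //; exact: smoothM.
Qed.

(** Infinitesimally this is the exterior derivative of $y\cdot dx=Y\cdot dX+p\,du$; here it is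
    checked on pairs of tangent vectors. *)
Lemma tube_pullback : pullback2 tube_domain tube (fun _ => @omega R n.+2) (fun _ => tube_form).
Proof.
move=> w a b Nw ta tb; have [[x1 xy] u1] := Nw.
have tT v : tangent tube_domain w v -> tangent_TS w.1 v.1.
  move=> tv; have := @tangent_push R _ _ _ _ tube_domain (@on_TS R n.+1) fst w v.
  have -> : 'D_v fst w = v.1.
    by have [_ ->] := @is_derive_linear R W B fst w v (fun _ _ _ => erefl).
  move=> H; apply: (@tangent_on_TS R n.+1 (@on_TS R n.+1)) => //.
  by apply: H tv => [|y []//]; apply: smooth_nearT; exact: smooth_fst.
have c0 := wid_gt0 u1; have cc := wid_sqr u1.
have dE v : is_derive w v tube
   (let u := w.2.1 in let p := w.2.2 in let c := wid u in
    let X := lsubmx w.1 in let Y := rsubmx w.1 in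
    let du := v.2.1 in let dp := v.2.2 in let dc := - (u * du) / c in
    row_mx (ins ord0 du (dc *: X + c *: lsubmx v.1))
      (ins ord0 (dp * (c * c) + p * (dc * c + c * dc))
         (- (c^-1 * c^-1) * dc *: Y + c^-1 *: rsubmx v.1
          + ((- (du * p * c + u * dp * c + u * p * dc)) *: X + - (u * p * c) *: lsubmx v.1)))).
  have dl : is_derive w v (fun w : W => lsubmx w.1) (lsubmx v.1).
    by apply: is_derive_linear => k a1 a2 /=; rewrite linearP.
  have dr : is_derive w v (fun w : W => rsubmx w.1) (rsubmx v.1).
    by apply: is_derive_linear => k a1 a2 /=; rewrite linearP.
  have du : is_derive w v (fun w : W => w.2.1) v.2.1 by apply: is_derive_linear.
  have dp : is_derive w v (fun w : W => w.2.2) v.2.2 by apply: is_derive_linear.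
  have s0 : 0 < 1 - w.2.1 * w.2.1 by rewrite subr_gt0.
  have duu := is_deriveB (is_derive_cst_fun (1 : R^o) w v) (is_deriveM_fun du du).
  have dc := @is_derive_chain R W Num.sqrt (fun w => 1 - w.2.1 * w.2.1) w v _ _ (is_derive1_sqrt s0) duu.
  have cn : wid w.2.1 != 0 by rewrite gt_eqF.
  have dV := @is_deriveV R id (wid w.2.1) 1 1 cn (is_derive_id _ _); rewrite scaleRE mulr1 in dV.
  have dci := @is_derive_chain R W (fun t => t^-1) (fun w => wid w.2.1) w v _ _ dV dc.
  have D1 := is_derive_ins ord0 du (is_deriveZ_fun dc dl).
  have D2 := is_deriveM_fun dp (is_deriveM_fun dc dc).
  have D3 := is_deriveZ_fun dci dr.
  have D4 := is_deriveZ_fun (is_deriveN_fun (is_deriveM_fun (is_deriveM_fun du dp) dc)) dl.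
  have DD := is_derive_row_mx D1 (is_derive_ins ord0 D2 (is_deriveD_fun D3 D4)).
  apply: (is_derive_eq DD) => /=; rewrite -/(wid w.2.1).
  set c := wid w.2.1 in cn *; set u := w.2.1.
  have -> : (2 * c)^-1 * (0 - (v.2.1 * u + u * v.2.1)) = - (u * v.2.1) / c by field.
  congr (row_mx _ (ins _ _ _)).
  apply/rowP => i; rewrite !mxE; field; exact: cn.
have [ta1 ta2] := tT _ ta; have [tb1 tb2] := tT _ tb.
have [_ ->] := dE a; have [_ ->] := dE b => /=.
rewrite /omega /tube_form !row_mxKl !row_mxKr !dot_ins /omega.
set c := wid _ in c0 cc *; set u := w.2.1 in cc *; set p := w.2.2.
set X := lsubmx w.1 in x1 xy ta1 ta2 tb1 tb2 *; set Y := rsubmx w.1 in xy ta2 tb2 *.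
have cn : c != 0 by rewrite gt_eqF.
have {}ta2 : dot X (rsubmx a.1) = - dot Y (lsubmx a.1) by apply/eqP; rewrite -addr_eq0 ta2.
have {}tb2 : dot X (rsubmx b.1) = - dot Y (lsubmx b.1) by apply/eqP; rewrite -addr_eq0 tb2.
have cu : c * c + u * u = 1 by rewrite cc; ring.
(* The $du$-part of $y\cdot dx$ is $p(c^2+u^2)\,du$: $pc^2$ from the first coordinate, $pu^2$ from
   the variation of $c$ against the $X$-component of $y$. With this factor kept, the identity is
   purely rational. *)
transitivity (dot (rsubmx a.1) (lsubmx b.1) - dot (rsubmx b.1) (lsubmx a.1) +
   (c * c + u * u) * (a.2.2 * b.2.1 - b.2.2 * a.2.1)); last by rewrite cu; ring.
rewrite !(dotDl, dotDr, dotZl, dotZr).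
rewrite ?(dotC (lsubmx a.1) X) ?(dotC (lsubmx b.1) X) ?(dotC (rsubmx a.1) X) ?(dotC (rsubmx b.1) X).
rewrite ?(dotC Y X) ?(dotC (lsubmx b.1) (lsubmx a.1)).
rewrite x1 xy ta1 tb1 ta2 tb2.
by field.
Qed.

End Tube.

Lemma smooth_derive1 (R : realType) (A : set R) (f : R -> R) :
  smooth A (f : R -> R^o) -> smooth A (derive1 f : R -> R^o).
Proof.
move=> sf; have -> : (derive1 f : R -> R^o) = 'D_1 (f : R -> R^o).
  by apply/funext => x; rewrite derive1E.
exact: smooth_derive.
Qed.

Lemma is_derive_smooth (R : realType) (f : R -> R) x : smooth setT (f : R -> R^o) ->
  is_derive x (1 : R) (f : R -> R^o) (derive1 f x).
Proof.
move=> sf; have df : differentiable (f : R^o -> R^o) x.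
  by apply: (@smooth_differentiable R R^o R^o _ _ setT) => //; exact: openT.
by split; [exact/derivable1_diffP|rewrite derive1E].
Qed.

Lemma derive1_local (R : realType) (A : set R) (f g : R -> R) x : open A -> A x ->
  (forall y, A y -> f y = g y) -> derive1 f x = derive1 g x.
Proof. by move=> oA Ax fg; rewrite !derive1E; exact: near_derive_eq fg. Qed.

(** * The cut-off rotation as an explicit Hamiltonian flow *)

Section TubeRotation.
Variables (R : realType) (n : nat).
Local Notation dot := (dotp R n.+1).
Local Notation dot2 := (dotp R n.+2).
Local Notation en := (enorm R n.+1).
Local Notation B := 'rV[R]_(n.+2 + n.+2).
Local Notation E := 'rV[R]_(n.+3 + n.+3).
Local Notation W := (B * (R^o * R^o))%type.
Local Notation D := (DTS R n.+2).
Local Notation sg := (sigma R n.+1).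
Local Notation tube_domain := (@tube_domain R n).
Implicit Types (w a b : W) (c : R).

(** Equal to $t/2$ up to $1/40$, so that the disk then turns with unit angular speed where
    [moment_cut] is 1, and 0 from $1/32$ on. This support, with $|Y|^2\le 1/16$ from [moment_cut],
    keeps the flow in $|y|^2\le 1/4$. *)
Definition radial_cut (t : R) : R := 2^-1 * t * cutoff 40^-1 32^-1 t.
Definition moment_cut (t : R) : R := cutoff 20^-1 16^-1 t.
Definition kap w : R := w.2.1 * w.2.1 + w.2.2 * w.2.2.
Definition mom w : R := dot (rsubmx w.1) (rsubmx w.1).
(** Angular speed of the flow of the Hamiltonian along the orbits of $\sigma$: minus its derivative
    in $|Y|$. The arguments $u^2+p^2$ and $|Y|^2$ are invariants of the flow, so the speeds are
    constant in time and the flow has a closed form. *)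
Definition orbit_angle w : R :=
  - (2 * radial_cut (kap w) * derive1 moment_cut (mom w) * en (rsubmx w.1)).
Definition disk_angle w : R := 2 * derive1 radial_cut (kap w) * moment_cut (mom w).

(* Time-[c] flow of the Hamiltonian [radial_cut (u^2 + p^2) * moment_cut (|Y|^2)]. *)
Definition rot c w : W :=
  (sg (c * orbit_angle w) w.1,
   (cos (c * disk_angle w) * w.2.1 - sin (c * disk_angle w) * w.2.2,
    sin (c * disk_angle w) * w.2.1 + cos (c * disk_angle w) * w.2.2)).

Let lt40 : 40^-1 < 32^-1 :> R. Proof. by rewrite ltf_pV2 ?posrE ?ltr0n// ltr_nat. Qed.
Let lt20 : 20^-1 < 16^-1 :> R. Proof. by rewrite ltf_pV2 ?posrE ?ltr0n// ltr_nat. Qed.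
Let oTR : open (setT : set R). Proof. exact: openT. Qed.

Lemma smooth_radial_cut : smooth setT (radial_cut : R -> R^o).
Proof.
apply: (@smoothM R R^o) => //; last exact: smooth_cutoff.
by apply: (@smoothM R R^o) => //; [exact: smooth_cst|exact: smooth_id].
Qed.

Lemma smooth_moment_cut : smooth setT (moment_cut : R -> R^o).
Proof. exact: smooth_cutoff. Qed.

Lemma radial_cut0 t : 32^-1 <= t -> radial_cut t = 0.
Proof. by move=> h; rewrite /radial_cut cutoff0 ?mulr0. Qed.

Lemma derive_radial_cut0 t : 32^-1 < t -> derive1 radial_cut t = 0.
Proof.
move=> h; rewrite (@derive1_local R [set t | 32^-1 < t] _ (cst 0)) ?derive1_cst//.
by move=> y /= /ltW; exact: radial_cut0.
Qed.

Lemma derive_radial_cut_half t : t < 40^-1 -> derive1 radial_cut t = 2^-1.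
Proof.
move=> h; rewrite (@derive1_local R [set t | t < 40^-1] _ (fun t => 2^-1 * t)) //.
  rewrite derive1E; have dd := @is_deriveM_fun R R^o (fun _ => 2^-1) (fun t => t) t 1 _ _
    (is_derive_cst_fun _ _ _) (is_derive_id _ _).
  by have [_ ->] := dd; rewrite mul0r add0r mulr1.
by move=> y /= /ltW yl; rewrite /radial_cut cutoff1 ?mulr1.
Qed.

Lemma moment_cut1 t : t <= 20^-1 -> moment_cut t = 1.
Proof. by move=> h; rewrite /moment_cut cutoff1. Qed.

Lemma derive_moment_cut_lt t : t < 20^-1 -> derive1 moment_cut t = 0.
Proof.
move=> h; rewrite (@derive1_local R [set t | t < 20^-1] _ (cst 1)) ?derive1_cst//.
by move=> y /= /ltW; exact: moment_cut1.
Qed.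

Lemma derive_moment_cut_gt t : 16^-1 < t -> derive1 moment_cut t = 0.
Proof.
move=> h; rewrite (@derive1_local R [set t | 16^-1 < t] _ (cst 0)) ?derive1_cst//.
by move=> y /= /ltW h'; rewrite /moment_cut cutoff0.
Qed.

Lemma orbit_angle_small w : mom w < 20^-1 -> orbit_angle w = 0.
Proof. by move=> h; rewrite /orbit_angle derive_moment_cut_lt// mulr0 mul0r oppr0. Qed.

Lemma rot_angle0 c w : orbit_angle w = 0 -> disk_angle w = 0 -> rot c w = w.
Proof.
move=> h1 h2; rewrite /rot h1 h2 mulr0 sigma0 cos0 sin0 !mul1r !mul0r subr0 add0r.
by case: w h1 h2 => z [u p].
Qed.

Lemma rot_trivial c w : 32^-1 < kap w \/ 16^-1 < mom w -> rot c w = w.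
Proof.
move=> [h|h]; apply: rot_angle0.
- by rewrite /orbit_angle radial_cut0 ?ltW// mulr0 !mul0r oppr0.
- by rewrite /disk_angle derive_radial_cut0// mulr0 mul0r.
- by rewrite /orbit_angle derive_moment_cut_gt// mulr0 mul0r oppr0.
- by rewrite /disk_angle /moment_cut cutoff0 ?mulr0// ltW.
Qed.

Lemma kap_rot c w : kap (rot c w) = kap w.
Proof.
rewrite /kap /rot /=; have := cos2Dsin2 (c * disk_angle w).
set C := cos _; set S := sin _; rewrite !expr2 => cs.
by rewrite -[RHS]mul1r -cs; ring.
Qed.

Lemma rot_fst c w : on_TS w.1 ->
  on_TS (rot c w).1 /\ mom (rot c w) = mom w.
Proof.
move=> Tw; rewrite /mom /rot /=; have [y0|y0] := eqVneq (rsubmx w.1) 0; last exact: sigma_on_TS.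
by rewrite orbit_angle_small ?mulr0 ?sigma0// /mom y0 dot0l invr_gt0 ltr0n.
Qed.

Lemma rotK c w : on_TS w.1 -> rot (- c) (rot c w) = w.
Proof.
move=> Tw; have [Tr mr] := rot_fst c Tw.
have en_rot : en (rsubmx (rot c w).1) = en (rsubmx w.1) by rewrite /enorm -!/(mom _) mr.
have -> : rot (- c) (rot c w) = (sg (- (c * orbit_angle w)) (rot c w).1,
   (cos (c * disk_angle w) * (rot c w).2.1 + sin (c * disk_angle w) * (rot c w).2.2,
    - sin (c * disk_angle w) * (rot c w).2.1 + cos (c * disk_angle w) * (rot c w).2.2)).
  rewrite {1}/rot /orbit_angle /disk_angle kap_rot mr en_rot -/(orbit_angle w) -/(disk_angle w).
  by rewrite !mulNr cosN sinN !mulNr opprK.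
have := cos2Dsin2 (c * disk_angle w); rewrite !expr2 /rot /= => cs.
case: w Tw cs {Tr mr en_rot} => z [u p] /= Tz; set t := disk_angle _; set o := orbit_angle _ => cs.
congr (_, (_, _)).
- have [y0|y0] := eqVneq (rsubmx z) 0.
    by rewrite /o orbit_angle_small ?mulr0 ?oppr0 ?sigma0// /mom /= y0 dot0l invr_gt0 ltr0n.
  by rewrite sigmaD// addNr sigma0.
- by rewrite -[RHS]mul1r -cs; ring.
- by rewrite -[RHS]mul1r -cs; ring.
Qed.

Lemma kap_ge w : w.2.1 * w.2.1 <= kap w.
Proof. by rewrite lerDl -expr2 sqr_ge0. Qed.

Lemma rot_tube_domain c w : w.2.1 * w.2.1 < 1 -> (rot c w).2.1 * (rot c w).2.1 < 1.
Proof.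
move=> u1; have [h|h] := ltP 32^-1 (kap w); first by rewrite rot_trivial//; left.
apply: le_lt_trans (kap_ge _) _; rewrite kap_rot; apply: le_lt_trans h _.
by rewrite invf_lt1 ?ltr1n.
Qed.

Lemma smooth_angles (A : set W) : open A ->
  [/\ smooth A (kap : W -> R^o), smooth A (mom : W -> R^o), smooth A (disk_angle : W -> R^o) &
      (forall w, A w -> rsubmx w.1 != 0) -> smooth A (orbit_angle : W -> R^o)].
Proof.
move=> oA; have [sX sY su sp] := smooth_W oA.
have sk : smooth A (kap : W -> R^o) by apply: (@smoothD _ _ R^o) => //; exact: smoothM.
have sm : smooth A (mom : W -> R^o) by exact: smooth_dot.
have sc (f : R -> R) (g : W -> R) : smooth setT (f : R -> R^o) -> smooth A (g : W -> R^o) ->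
    smooth A (fun w => f (g w) : R^o).
  by move=> sf sgg; apply: (@smooth_comp R _ R^o R^o _ _ _ A setT g f).
have sr := smooth_radial_cut; have smc := smooth_moment_cut.
split=> //.
  apply: smoothM => //; last exact: sc.
  by apply: smoothM => //; [exact: smooth_cst|apply: sc => //; exact: smooth_derive1].
move=> Y0; apply: (@smoothN _ _ R^o) => //; apply: smoothM => //; last exact: smooth_enorm.
apply: smoothM => //; last by apply: sc => //; exact: smooth_derive1.
by apply: smoothM => //; [exact: smooth_cst|exact: sc].
Qed.

Lemma open_mom_lt : open (setT `&` [set w : W | mom w < 20^-1]).
Proof. by apply: open_smooth_lt; [exact: openT|have [] := smooth_angles openT]. Qed.

Lemma open_mom_gt : open (setT `&` [set w : W | 0 < mom w]).
Proof. by apply: open_smooth_gt; [exact: openT|have [] := smooth_angles openT]. Qed.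

(** Near $Y=0$, where $\sigma$ is singular, [moment_cut] is constant, so the orbit angle is 0 and
    the first component is the identity. The regions $|Y|^2<1/20$ and $Y\neq 0$ cover everything. *)
Lemma smooth_rot : smooth setT (fun q : R^o * W => rot q.1 q.2).
Proof.
have oT : open (setT : set (R^o * W)) by exact: openT.
have comp2 (F : normedModType R) (fF : findim F) (A : set (R^o * W)) (V : set W) (f : W -> F) :
    open A -> open V -> (forall q, A q -> V q.2) -> smooth V f -> smooth A (fun q => f q.2).
  move=> oA oV AV sf; apply: (@smooth_comp R _ _ _ _ _ _ A V snd f) => //; exact: smooth_snd.
have [sX sY su sp] := smooth_W (@openT W); have [sk sm sd _] := smooth_angles (@openT W).
have s1 : smooth setT (fun q : R^o * W => q.1 : R^o) by exact: smooth_fst.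
have sth : smooth setT (fun q : R^o * W => q.1 * disk_angle q.2 : R^o).
  by apply: smoothM => //; apply: (comp2 R^o _ setT setT disk_angle) => //; exact: openT.
have sc : smooth setT (fun q : R^o * W => cos (q.1 * disk_angle q.2) : R^o) by exact: smooth_cos_comp.
have ss : smooth setT (fun q : R^o * W => sin (q.1 * disk_angle q.2) : R^o) by exact: smooth_sin_comp.
have su' : smooth setT (fun q : R^o * W => q.2.2.1 : R^o).
  by apply: (comp2 R^o _ setT setT (fun w : W => w.2.1)) => //; exact: openT.
have sp' : smooth setT (fun q : R^o * W => q.2.2.2 : R^o).
  by apply: (comp2 R^o _ setT setT (fun w : W => w.2.2)) => //; exact: openT.
apply: smooth_pair => //; last first.
  apply: smooth_pair => //; [apply: (@smoothB _ _ R^o)|apply: (@smoothD _ _ R^o)] => //; exact: smoothM.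
have s21 (A : set (R^o * W)) : open A -> smooth A (fun q : R^o * W => q.2.1).
  move=> oA; apply: (comp2 B _ A setT (fun w : W => w.1)) => //; first exact: openT.
  exact: smooth_fst.
pose A1 : set (R^o * W) := snd @^-1` (setT `&` [set w : W | 0 < mom w]).
pose A2 : set (R^o * W) := snd @^-1` (setT `&` [set w : W | mom w < 20^-1]).
have opre (V : set W) : open V -> open (snd @^-1` V : set (R^o * W)).
  move=> oV; have := @open_preimage R (R^o * W)%type W setT snd V oT _ oV.
  by rewrite setTI; apply => q _; exact: cvg_snd.
have oA1 : open A1 by apply: opre; exact: open_mom_gt.
have oA2 : open A2 by apply: opre; exact: open_mom_lt.
apply: smooth_local => q _; have [y0|y0] := eqVneq (rsubmx q.2.1) 0.
  exists A2; split; first by split=> //=; rewrite /mom y0 dot0l invr_gt0 ltr0n.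
  apply: (@smooth_eq R _ _ A2 (fun q : R^o * W => q.2.1)) => //; last exact: s21.
  by move=> q' [_ /= h]; rewrite orbit_angle_small// mulr0 sigma0.
exists A1; split; first by split=> //=; rewrite /mom dot_gt0.
have n1 q' : A1 q' -> rsubmx q'.2.1 != 0 by move=> [_ /=]; rewrite /mom dot_gt0.
apply: smooth_sigma => //; last exact: s21.
apply: smoothM => //; first exact: smooth_fst.
apply: (comp2 R^o _ A1 (setT `&` [set w : W | 0 < mom w]) orbit_angle) => //; first exact: open_mom_gt.
have [_ _ _ so] := smooth_angles open_mom_gt; apply: so => w [_ /=].
by rewrite /mom dot_gt0.
Qed.

Lemma smooth_rot_at c : smooth setT (rot c).
Proof.
apply: (@smooth_comp R W (R^o * W)%type W _ _ _ setT setT (fun w => (c : R^o, w)) (fun q => rot q.1 q.2));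
  try exact: openT; last exact: smooth_rot.
- by [].
- by apply: smooth_pair; [exact: openT|exact: smooth_cst|exact: smooth_id].
Qed.

Lemma is_derive_kap w v : is_derive w v (kap : W -> R^o) (2 * (w.2.1 * v.2.1 + w.2.2 * v.2.2)).
Proof.
have du : is_derive w v (fun w : W => w.2.1) v.2.1 by apply: is_derive_linear.
have dp : is_derive w v (fun w : W => w.2.2) v.2.2 by apply: is_derive_linear.
apply: (is_derive_eq (is_deriveD_fun (is_deriveM_fun du du) (is_deriveM_fun dp dp))).
by ring.
Qed.

Lemma is_derive_mom w v : is_derive w v (mom : W -> R^o) (2 * dot (rsubmx w.1) (rsubmx v.1)).
Proof.
have dr : is_derive w v (fun w : W => rsubmx w.1) (rsubmx v.1).
  by apply: is_derive_linear => k a1 a2 /=; rewrite linearP.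
by apply: (is_derive_eq (is_derive_dot dr dr)); rewrite (dotC (rsubmx v.1)); ring.
Qed.

Lemma is_derive_disk_angle w v : is_derive w v (disk_angle : W -> R^o)
  (2 * (derive1 (derive1 radial_cut) (kap w) * (2 * (w.2.1 * v.2.1 + w.2.2 * v.2.2)) * moment_cut (mom w)
   + derive1 radial_cut (kap w) * (derive1 moment_cut (mom w) * (2 * dot (rsubmx w.1) (rsubmx v.1))))).
Proof.
have d1 := @is_derive_chain R W _ kap w v _ _
  (is_derive_smooth (kap w) (smooth_derive1 smooth_radial_cut)) (is_derive_kap w v).
have d2 := @is_derive_chain R W _ mom w v _ _
  (is_derive_smooth (mom w) smooth_moment_cut) (is_derive_mom w v).
apply: (is_derive_eq (is_deriveM_fun (is_deriveM_fun (is_derive_cst_fun (2 : R^o) w v) d1) d2)).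
by ring.
Qed.

Lemma is_derive_orbit_angle w v : rsubmx w.1 != 0 -> is_derive w v (orbit_angle : W -> R^o)
  (- 2 * (derive1 radial_cut (kap w) * (2 * (w.2.1 * v.2.1 + w.2.2 * v.2.2)) * derive1 moment_cut (mom w) * en (rsubmx w.1)
   + radial_cut (kap w) * (derive1 (derive1 moment_cut) (mom w) * (2 * en (rsubmx w.1)) + derive1 moment_cut (mom w) / en (rsubmx w.1)) * dot (rsubmx w.1) (rsubmx v.1))).
Proof.
move=> y0; have d1 := @is_derive_chain R W _ kap w v _ _
  (is_derive_smooth (kap w) smooth_radial_cut) (is_derive_kap w v).
have d2 := @is_derive_chain R W _ mom w v _ _
  (is_derive_smooth (mom w) (smooth_derive1 smooth_moment_cut)) (is_derive_mom w v).
have dr : is_derive w v (fun w : W => rsubmx w.1) (rsubmx v.1).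
  by apply: is_derive_linear => k a1 a2 /=; rewrite linearP.
have d3 := @is_derive_enorm R n.+1 W (fun w => rsubmx w.1) w v _ y0 dr.
apply: (is_derive_eq (is_deriveN_fun (is_deriveM_fun
  (is_deriveM_fun (is_deriveM_fun (is_derive_cst_fun (2 : R^o) w v) d1) d2) d3))).
by field; rewrite enorm_neq0.
Qed.

Lemma tangent_tube_domain w v : tangent tube_domain w v -> tangent_TS w.1 v.1.
Proof.
move=> tv; have := @tangent_push R _ _ _ _ tube_domain (@on_TS R n.+1) fst w v.
have -> : 'D_v fst w = v.1.
  by have [_ ->] := @is_derive_linear R W B fst w v (fun _ _ _ => erefl).
move=> H; apply: (@tangent_on_TS R n.+1 (@on_TS R n.+1)) => //.
by apply: H tv => [|y []//]; apply: smooth_nearT; exact: smooth_fst.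
Qed.

Lemma is_derive_pair (F G H : normedModType R) (f : F -> G) (g : F -> H) x v df dg :
  is_derive x v f df -> is_derive x v g dg ->
  is_derive x v (fun y => (f y, g y)) (df, dg).
Proof.
move=> [/cvg_ex[/= lf hf] ef] [/cvg_ex[/= lg hg] eg].
have elf : df = lf by rewrite -ef; exact: cvg_lim hf.
have elg : dg = lg by rewrite -eg; exact: cvg_lim hg.
have h : h^-1 *: (((fun y => (f y, g y)) \o shift x) (h *: v) - (f x, g x)) @[h --> 0^'] --> (df, dg).
  by rewrite elf elg; exact: (cvg_pair hf hg).
by split; [apply/cvg_ex; eexists; exact: h|exact: cvg_lim h].
Qed.

Lemma is_derive_disk_rot c w v t : is_derive w v (disk_angle : W -> R^o) t ->
  let C := cos (c * disk_angle w) in let S := sin (c * disk_angle w) in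
  is_derive w v (fun w => (rot c w).2)
    (C * v.2.1 - S * v.2.2 - c * t * (S * w.2.1 + C * w.2.2),
     S * v.2.1 + C * v.2.2 + c * t * (C * w.2.1 - S * w.2.2)).
Proof.
move=> dt C S.
have du : is_derive w v (fun w : W => w.2.1) v.2.1 by apply: is_derive_linear.
have dp : is_derive w v (fun w : W => w.2.2) v.2.2 by apply: is_derive_linear.
have dct := is_deriveM_fun (is_derive_cst_fun (c : R^o) w v) dt.
have dC := @is_derive_chain R W _ (fun w => c * disk_angle w) w v _ _ (is_derive_cos _) dct.
have dS := @is_derive_chain R W _ (fun w => c * disk_angle w) w v _ _ (is_derive_sin _) dct.
have D1 := is_deriveB (is_deriveM_fun dC du) (is_deriveM_fun dS dp).
have D2 := is_deriveD_fun (is_deriveM_fun dS du) (is_deriveM_fun dC dp).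
apply: (is_derive_eq (is_derive_pair D1 D2)); rewrite -/C -/S.
by congr (_, _); ring.
Qed.

Lemma tube_formE a b (a1 b1 : B) (a2 b2 : (R^o * R^o)%type) : a.1 = a1 -> a.2 = a2 -> b.1 = b1 -> b.2 = b2 ->
  @tube_form R n a b = omega a1 b1 + a2.2 * b2.1 - b2.2 * a2.1.
Proof. by move=> <- <- <- <-. Qed.

(** The variable time adds $d|Y|\wedge d\psi$ to the first summand by [omega_sigma], and the
    variable disk angle adds a term to $dp\wedge du$. Both angles come from derivatives of one
    Hamiltonian, so by symmetry of its mixed second derivatives the two terms are opposite. *)
Lemma rot_pullback c :
  pullback2 tube_domain (rot c) (fun _ => @tube_form R n) (fun _ => @tube_form R n).
Proof.
move=> w a b Nw ta tb; have [Tw u1] := Nw.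
have tta := tangent_tube_domain ta; have ttb := tangent_tube_domain tb.
have drot : differentiable (rot c) w.
  by apply: (smooth_differentiable (@openT W) (smooth_rot_at c)).
have D1 v : ('D_v (rot c) w).1 = 'D_v (fun w => (rot c w).1) w.
  have [_ ->] := @is_derive_linear_fun R W W B _ fst (rot c) w v _ (fun _ _ _ => erefl)
     (is_derive_differentiable v drot); by [].
have D2 v : ('D_v (rot c) w).2 = 'D_v (fun w => (rot c w).2) w.
  have [_ ->] := @is_derive_linear_fun R W W (R^o * R^o)%type _ snd (rot c) w v _ (fun _ _ _ => erefl)
     (is_derive_differentiable v drot); by [].
rewrite (tube_formE (D1 a) (D2 a) (D1 b) (D2 b)) {1}/tube_form.
have [_ ->] := is_derive_disk_rot c (is_derive_disk_angle w a).
have [_ ->] := is_derive_disk_rot c (is_derive_disk_angle w b).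
have := cos2Dsin2 (c * disk_angle w).
set C := cos _; set S := sin _; rewrite !expr2 /= => cs.
(* [omega_sigma] needs $Y\neq 0$; at $Y=0$ the orbit angle vanishes in a neighbourhood and only the
   disk turns. *)
have [y0|y0] := eqVneq (rsubmx w.1) 0.
  have m0 : mom w < 20^-1 by rewrite /mom y0 dot0l invr_gt0 ltr0n.
  have dE v : 'D_v (fun w => (rot c w).1) w = v.1.
    rewrite (@near_derive_eq R W B (setT `&` [set w | mom w < 20^-1]) _ (fun w => w.1)) //.
    - by have [_ ->] := @is_derive_linear R W B fst w v (fun _ _ _ => erefl).
    - exact: open_mom_lt.
    - by move=> w' [_ /= h]; rewrite orbit_angle_small// mulr0 sigma0.
  rewrite !dE y0 !dot0l !mulr0.
  rewrite -[RHS]addrA -[X in _ = _ + X]mul1r -cs /=; ring.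
have d1 v : is_derive w v (fun w : W => w.1) v.1 by apply: is_derive_linear.
have dE v := is_deriveM_fun (is_derive_cst_fun (c : R^o) w v) (is_derive_orbit_angle v y0).
have := omega_sigma (f := fun w : W => w.1) Tw y0 tta ttb (d1 a) (d1 b) (dE a) (dE b).
rewrite /= => ->.
set k1 := derive1 (derive1 radial_cut) _; set m1 := derive1 (derive1 moment_cut) _.
set k0 := derive1 radial_cut _; set m0 := derive1 moment_cut _.
set k := radial_cut _; set m := moment_cut _; set r := en _.
set ya := dot _ (rsubmx a.1); set yb := dot _ (rsubmx b.1).
have r0 : r != 0 by rewrite enorm_neq0.
(* The derivative of the orbit time along [v]. *)
pose tw (v : W) (yv : R) := c * (- 2 * (k0 * (2 * (w.2.1 * v.2.1 + w.2.2 * v.2.2)) * m0 * r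
  + k * (m1 * (2 * r) + m0 / r) * yv)).
transitivity (omega a.1 b.1 + (tw b yb * (ya / r) - tw a ya * (yb / r)) +
  (C * C + S * S) * (a.2.2 * b.2.1 - b.2.2 * a.2.1 - (tw b yb * (ya / r) - tw a ya * (yb / r)))).
  by rewrite /tw; field.
by rewrite cs; ring.
Qed.

(** The threshold $1/2$ on $u^2$ is a safe place to glue: [rot] moves only points with $u^2+p^2\le
    1/32$, so both branches are the identity for $u^2$ between $1/4$ and $1/2$, and smoothness is
    checked on two overlapping open sets. *)
Definition tube_rot c (z : E) : E :=
  if lsubmx z 0 ord0 * lsubmx z 0 ord0 < 2^-1 then tube (rot c (untube z)) else z.

Let lt2 : 2^-1 < 1 :> R. Proof. by rewrite invf_lt1 ?ltr1n. Qed.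

Lemma tube_head w : lsubmx (@tube R n w) 0 ord0 = w.2.1.
Proof. by rewrite /tube row_mxKl ins_eq. Qed.

Lemma tube_rot_trivial c z : 32^-1 < kap (untube z) \/ 16^-1 < mom (untube z) -> tube_rot c z = z.
Proof.
move=> h; rewrite /tube_rot; case: ifP => // u2.
by rewrite rot_trivial// untubeK//; exact: lt_trans u2 lt2.
Qed.

Lemma tube_rot_out c z : 4^-1 < lsubmx z 0 ord0 * lsubmx z 0 ord0 -> tube_rot c z = z.
Proof.
move=> u4; apply: tube_rot_trivial; left; apply: lt_le_trans (kap_ge _).
by apply: le_lt_trans u4; rewrite lef_pV2 ?posrE ?ltr0n// ler_nat.
Qed.

Lemma tube_rot_cases c z : on_TS z -> tube_rot c z = z \/
  [/\ lsubmx z 0 ord0 * lsubmx z 0 ord0 < 2^-1, kap (untube z) <= 32^-1 & mom (untube z) <= 16^-1].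
Proof.
move=> Tz; have [k|k] := ltP 32^-1 (kap (untube z)).
  by left; apply: tube_rot_trivial; left.
have [m|m] := ltP 16^-1 (mom (untube z)); first by left; apply: tube_rot_trivial; right.
have [u|u] := ltP (lsubmx z 0 ord0 * lsubmx z 0 ord0) 2^-1; first by right.
by left; rewrite /tube_rot ltNge u.
Qed.

(** By [dot_tube], $|y|^2=p^2(1-u^2)+|Y|^2/(1-u^2)$, at most $1/32+1/8$ here. Hence the support of
    the rotation stays away from the boundary of the disk bundle. *)
Lemma dot_tube_le w : tube_domain w -> kap w <= 32^-1 -> mom w <= 16^-1 ->
  dot2 (rsubmx (tube w)) (rsubmx (tube w)) <= 4^-1.
Proof.
move=> Nw k m; have [_ u1] := Nw; rewrite dot_tube// -/(mom w).
have u32 : w.2.1 * w.2.1 <= 32^-1 by apply: le_trans (kap_ge w) k.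
have p32 : w.2.2 * w.2.2 <= 32^-1.
  by apply: le_trans k; rewrite /kap lerDr -expr2 sqr_ge0.
have u0 : 0 <= w.2.1 * w.2.1 by rewrite -expr2 sqr_ge0.
have p0 : 0 <= w.2.2 * w.2.2 by rewrite -expr2 sqr_ge0.
have m0 : 0 <= mom w by exact: dot_ge0.
set U := w.2.1 * w.2.1 in u32 u0 u1 *; set Q := w.2.2 * w.2.2 in p32 p0 *.
have h1 : Q * (1 - U) <= 32^-1.
  by apply: le_trans p32; rewrite ler_piMr//; lra.
have h2 : mom w / (1 - U) <= 8^-1.
  by rewrite ler_pdivrMr ?subr_gt0//; lra.
by lra.
Qed.

Lemma tube_rot_in c z : on_TS z -> lsubmx z 0 ord0 * lsubmx z 0 ord0 < 2^-1 ->
  kap (untube z) <= 32^-1 -> mom (untube z) <= 16^-1 ->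
  [/\ tube_rot c z = tube (rot c (untube z)), tube_domain (rot c (untube z)),
      on_TS (tube_rot c z), untube (tube_rot c z) = rot c (untube z) &
      dot2 (rsubmx (tube_rot c z)) (rsubmx (tube_rot c z)) <= 4^-1].
Proof.
move=> Tz u2 k m; have u1 := lt_trans u2 lt2.
have [Tw wu] := untube_on_TS Tz u1.
have [Tr mr] := rot_fst c Tw.
have Nr : tube_domain (rot c (untube z)) by split=> //; exact: rot_tube_domain.
have e : tube_rot c z = tube (rot c (untube z)) by rewrite /tube_rot u2.
split; rewrite ?e //; first exact: tube_on_TS.
  by apply: tubeK; case: Nr.
by apply: dot_tube_le => //; rewrite ?kap_rot ?mr.
Qed.

Lemma tube_rot_big c z : on_TS z -> 4^-1 < dot2 (rsubmx z) (rsubmx z) -> tube_rot c z = z.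
Proof.
move=> Tz; have [//|[u2 k m]] := tube_rot_cases c Tz.
have u1 := lt_trans u2 lt2; rewrite ltNge -{1 2}(untubeK u1).
by rewrite dot_tube_le//; exact: untube_on_TS.
Qed.

Lemma tube_rot_mem c z : D z -> D (tube_rot c z).
Proof.
move=> Dz; have Tz := DTS_on_TS Dz; have [->//|[u2 k m]] := tube_rot_cases c Tz.
have [_ _ T1 _ y4] := tube_rot_in c Tz u2 k m.
by apply/DTSP; split=> //; apply: le_trans y4 _; rewrite invf_le1 ?ler1n.
Qed.

Lemma tube_rotK c z : on_TS z -> tube_rot (- c) (tube_rot c z) = z.
Proof.
move=> Tz; have [tr|[u2 k m]] := tube_rot_cases c Tz.
  have [u2|u2] := ltP (lsubmx z 0 ord0 * lsubmx z 0 ord0) 2^-1; last first.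
    by rewrite tr /tube_rot ltNge u2.
  have u1 := lt_trans u2 lt2; have [Tw wu] := untube_on_TS Tz u1.
  (* A fixed point of [tube_rot] inside the tube is fixed in tube coordinates too, by injectivity of
     [tube]; then [rotK] gives the inverse. *)
  have rw : rot c (untube z) = untube z.
    have := tr; rewrite {1}/tube_rot u2 => /(congr1 (@untube R n)); rewrite tubeK//.
    exact: rot_tube_domain.
  by rewrite tr /tube_rot u2 -[X in rot (- c) X]rw rotK// untubeK.
have [e Nr T1 ue _] := tube_rot_in c Tz u2 k m.
have u1 := lt_trans u2 lt2; have [Tw wu] := untube_on_TS Tz u1.
rewrite {1}/tube_rot ue rotK// untubeK// e tube_head ifT//.
apply: le_lt_trans (kap_ge _) _; rewrite kap_rot; apply: le_lt_trans k _.
by rewrite ltf_pV2 ?posrE ?ltr0n// ltr_nat.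
Qed.

Lemma smooth_tube_rot : smooth setT (fun q : R^o * E => tube_rot q.1 q.2).
Proof.
have oT : open (setT : set (R^o * E)) by exact: openT.
have su : smooth setT (fun q : R^o * E => lsubmx q.2 0 ord0 : R^o).
  by apply: smooth_entry => //; apply: smooth_lsubmx => //; exact: smooth_snd.
have suu : smooth setT (fun q : R^o * E => lsubmx q.2 0 ord0 * lsubmx q.2 0 ord0 : R^o) by exact: smoothM.
pose A1 : set (R^o * E) := setT `&` [set q | lsubmx q.2 0 ord0 * lsubmx q.2 0 ord0 < 2^-1].
pose A2 : set (R^o * E) := setT `&` [set q | 4^-1 < lsubmx q.2 0 ord0 * lsubmx q.2 0 ord0].
have oA1 : open A1 by exact: open_smooth_lt.
have oA2 : open A2 by exact: open_smooth_gt.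
apply: smooth_local => q _.
have [u2|u2] := ltP (lsubmx q.2 0 ord0 * lsubmx q.2 0 ord0) 2^-1; last first.
  exists A2; split.
    by split=> //=; apply: lt_le_trans u2; rewrite ltf_pV2 ?posrE ?ltr0n// ltr_nat.
  apply: (@smooth_eq R _ _ A2 snd) => //; last exact: smooth_snd.
  by move=> q' [_ /=]; move=> /tube_rot_out ->.
exists A1; split=> //.
apply: (@smooth_eq R _ _ A1 (fun q => tube (rot q.1 (untube q.2)))) => //.
  by move=> q' [_ /= h]; rewrite /tube_rot h.
have sun : smooth A1 (fun q : R^o * E => untube q.2).
  have AU q' : A1 q' -> @untube_open R n q'.2.
    by move=> [_ /= h]; split=> //=; exact: lt_trans h lt2.
  have s2 : smooth A1 (fun q : R^o * E => q.2) by exact: smooth_snd.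
  exact: (smooth_comp oA1 (@open_untube_open R n) AU s2 (@smooth_untube R n)).
have sr : smooth A1 (fun q : R^o * E => rot q.1 (untube q.2)).
  have sp : smooth A1 (fun q : R^o * E => (q.1 : R^o, untube q.2)).
    by apply: smooth_pair => //; exact: smooth_fst.
  exact: (smooth_comp oA1 (@openT (R^o * W)%type) (fun _ _ => I) sp smooth_rot).
have AT q' : A1 q' -> @tube_open R n (rot q'.1 (untube q'.2)).
  move=> [_ /= h]; split=> //=; apply: rot_tube_domain; rewrite /untube /=.
  exact: lt_trans h lt2.
exact: (smooth_comp oA1 (@open_tube_open R n) AT sr (@smooth_tube R n)).
Qed.

Lemma smooth_tube_rot_at c : smooth setT (tube_rot c).
Proof.
apply: (@smooth_comp R E (R^o * E)%type E _ _ _ setT setT (fun z => (c : R^o, z)) (fun q => tube_rot q.1 q.2));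
  try exact: openT; last exact: smooth_tube_rot.
- by [].
- by apply: smooth_pair; [exact: openT|exact: smooth_cst|exact: smooth_id].
Qed.

Lemma tube_rot_pullback c :
  pullback2 D (tube_rot c) (fun _ => @omega R n.+2) (fun _ => @omega R n.+2).
Proof.
move=> z a b Dz ta tb.
pose U2 : set E := setT `&` [set z : E | lsubmx z 0 ord0 * lsubmx z 0 ord0 < 2^-1].
pose U4 : set E := setT `&` [set z : E | 4^-1 < lsubmx z 0 ord0 * lsubmx z 0 ord0].
have oT : open (setT : set E) by exact: openT.
have [su _] := smooth_head oT.
have oU2 : open U2 by apply: open_smooth_lt => //; exact: smoothM.
have oU4 : open U4 by apply: open_smooth_gt => //; exact: smoothM.
have [u2|u2] := ltP (lsubmx z 0 ord0 * lsubmx z 0 ord0) 2^-1; last first.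
  have Uz : U4 z by split=> //=; apply: lt_le_trans u2; rewrite ltf_pV2 ?posrE ?ltr0n// ltr_nat.
  have dE v : 'D_v (tube_rot c) z = v.
    by rewrite (near_derive_eq v oU4 Uz (g := id)) ?derive_id// => y [_ /tube_rot_out].
  by rewrite !dE.
have Uz : U2 z by [].
pose X := D `&` U2.
have XN : forall y, X y -> tube_domain (untube y).
  by move=> y [Dy [_ /= h]]; apply: untube_on_TS (lt_trans h lt2); exact: DTS_on_TS.
have NN : forall w, tube_domain w -> tube_domain (rot c w).
  by move=> w [Tw h]; split; [exact: (rot_fst c Tw).1|exact: rot_tube_domain].
have sX : smooth_near X (@untube R n).
  exists (@untube_open R n); split; [exact: open_untube_open| |exact: smooth_untube].
  by move=> y [_ [_ /= h]]; split=> //=; exact: lt_trans h lt2.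
have sN : smooth_near tube_domain (@tube R n).
  exists (@tube_open R n); split; [exact: open_tube_open| |exact: smooth_tube].
  by move=> w [_ h]; split.
have sr : smooth_near tube_domain (rot c) by apply: smooth_nearT; exact: smooth_rot_at.
have p1 : pullback2 X (@untube R n) (fun _ => @tube_form R n) (fun _ => @omega R n.+2).
  apply: (pullback2_inverse sN sX XN) (@tube_pullback R n) => y [_ [_ /= h]].
  by apply: untubeK; exact: lt_trans h lt2.
pose proof (pullback2_comp sX sr XN p1 (@rot_pullback c)) as p2.
have sXr : smooth_near X (fun y => rot c (untube y)) by exact: (smooth_near_comp XN sX sr).
pose proof (pullback2_comp sXr sN (fun y Xy => NN _ (XN y Xy)) p2 (@tube_pullback R n)) as p3.
have dE v : 'D_v (tube_rot c) z = 'D_v (fun y => tube (rot c (untube y))) z.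
  by apply: (near_derive_eq v oU2 Uz) => y [_ /= h]; rewrite /tube_rot h.
by rewrite !dE; apply: p3 => //; exact: tangent_near.
Qed.

Lemma tube_rot_symplecto c : symplecto R (DTS_page R n.+2) (tube_rot c).
Proof.
have im : tube_rot c @` D = D.
  apply/seteqP; split=> [z [y Dy <-]|z Dz]; first exact: tube_rot_mem.
  exists (tube_rot (- c) z); first exact: tube_rot_mem.
  by rewrite -{1}[c]opprK tube_rotK//; exact: DTS_on_TS.
split=> //.
- split; first by apply: smooth_nearT; exact: smooth_tube_rot_at.
  exists (tube_rot (- c)); split; first by apply: smooth_nearT; exact: smooth_tube_rot_at.
  by move=> z /DTS_on_TS; exact: tube_rotK.
- by move=> z u v Dz tu tv; rewrite /pomega !extd_lambda; exact: tube_rot_pullback.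
exists (setT `&` [set z : E | 4^-1 < dot2 (rsubmx z) (rsubmx z)]); split.
- by apply: open_smooth_gt; [exact: openT|have [] := @smooth_dots R n.+2 setT openT].
- rewrite /bd /= boundary_DTS => z [Dz y1]; split=> //=.
  by rewrite y1 invf_lt1 ?ltr1n.
- by move=> z Dz [_ /= y4]; apply: tube_rot_big => //; exact: DTS_on_TS.
Qed.

Lemma tube_rot_isotopic c : symp_isotopic R (DTS_page R n.+2) (tube_rot c) id.
Proof.
have oT : open (setT : set (R^o * E)) by exact: openT.
exists (fun q : R^o * E => tube_rot ((1 - q.1) * c) q.2); split.
- apply: smooth_nearT.
  have sp : smooth setT (fun q : R^o * E => ((1 - q.1) * c : R^o, q.2)).
    apply: smooth_pair => //; last exact: smooth_snd.
    apply: smoothM => //; last exact: smooth_cst.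
    by apply: (@smoothB _ _ R^o) => //; [exact: smooth_cst|exact: smooth_fst].
  exact: (smooth_comp oT oT (fun _ _ => I) sp smooth_tube_rot).
- by move=> s _; exact: (tube_rot_symplecto ((1 - s) * c)).
- exists (setT `&` [set z : E | 4^-1 < dot2 (rsubmx z) (rsubmx z)]); split.
  + by apply: open_smooth_gt; [exact: openT|have [] := @smooth_dots R n.+2 setT openT].
  + rewrite /bd /= boundary_DTS => z [Dz y1]; split=> //=.
    by rewrite y1 invf_lt1 ?ltr1n.
  + by move=> s z _ Dz [_ /= y4]; apply: tube_rot_big => //; exact: DTS_on_TS.
- by move=> z Dz; rewrite /= subr0 mul1r.
move=> z Dz /=; rewrite subrr mul0r.
have r0 : rot 0 (untube z) = untube z.
  rewrite /rot !mul0r sigma0 cos0 sin0 !mul1r !mul0r subr0 add0r.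
  by case: (untube z) => w [u p].
by rewrite /tube_rot r0; case: ifP => // u2; rewrite untubeK//; exact: lt_trans u2 lt2.
Qed.

(* In the tube coordinates, [hyper v z] is [(z; 0, v)]. *)
Definition hyper (v : R) (z : B) : E := row_mx (ins ord0 0 (lsubmx z)) (ins ord0 v (rsubmx z)).

Lemma untube_hyper v z : untube (hyper v z) = (z, (0, v)).
Proof.
rewrite /untube /hyper !row_mxKl !row_mxKr !ins_eq !insK /wid mul0r subr0 sqrtr1 invr1.
by rewrite !mul0r scale0r addr0 !mulr1 !scale1r hsubmxK.
Qed.

Lemma tube_hyper v z : tube (z, (0, v)) = hyper v z :> E.
Proof.
rewrite -untube_hyper untubeK// /hyper row_mxKl ins_eq mul0r.
exact: ltr01.
Qed.

(** The cotangent bundle of the equator is $u=p=0$: the disk rotation fixes its centre, and the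
    orbit angle vanishes because [radial_cut 0] is 0. So the whole of it is fixed pointwise, also
    where the rotation is not rigid. *)
Lemma tube_rot_hyper0 c z : tube_rot c (hyper 0 z) = hyper 0 z.
Proof.
rewrite /tube_rot {1 2}/hyper row_mxKl ins_eq mul0r invr_gt0 ltr0n untube_hyper.
rewrite -[RHS]tube_hyper; congr tube; rewrite /rot /orbit_angle /kap /= !mulr0 addr0.
by rewrite /radial_cut !(mulr0, mul0r, oppr0, addr0) sigma0.
Qed.

(** Within these bounds [radial_cut] has slope $1/2$ and [moment_cut] is 1, so the flow is the rigid
    rotation of the disk by $k\pi$, with no motion along the orbits. *)
Lemma tube_rot_hyper (k : int) v z : v * v < 40^-1 -> dot (rsubmx z) (rsubmx z) < 20^-1 ->
  tube_rot (k%:~R * pi) (hyper v z) = hyper ((-1) ^ k * v) z.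
Proof.
move=> v40 y20; rewrite /tube_rot {1 2}/hyper row_mxKl ins_eq mul0r invr_gt0 ltr0n untube_hyper.
rewrite -[RHS]tube_hyper; congr tube; rewrite /rot /= orbit_angle_small // mulr0 sigma0.
have -> : disk_angle (z, (0, v)) = 1.
  rewrite /disk_angle /kap /= mulr0 add0r derive_radial_cut_half// moment_cut1 ?ltW//.
  by rewrite mulr1 divff.
rewrite mulr1; have [-> ->] := cos_sin_int R k.
by rewrite !mulr0 mul0r subr0 add0r.
Qed.

End TubeRotation.

(** * The embedding of open books *)

Section Aob.
Variable R : realType.

Lemma contactomorphic_refl (M : cmanifold R) : contactomorphic R M M.
Proof.
have sid : smooth setT (fun x : 'rV[R]_(camb R M) => x) by exact: smooth_id.
exists (fun x => x), (fun _ => 1); split=> //.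
- split; first exact: smooth_nearT.
  by exists (fun x => x); split=> //; exact: smooth_nearT.
- by rewrite image_id.
- by move=> x v Mx tv; rewrite derive_id mul1r.
Qed.

(** The collar needed for [exact_symplectic_convex] is taken from the data of the given open
    book. *)
Lemma is_Aob_collar (M : cmanifold R) (P : page R) phi :
  is_Aob R M P phi -> exists k, collar R P k.
Proof. by move=> [_ [phi' [h [c [k [e [Q [B [h1 [h2 [_ _ ck _ _]]]]]]]]]]]; exists k. Qed.

Lemma supports_is_Aob (M : cmanifold R) (P : page R) phi :
  contact R M -> is_Aob R M P phi -> supports R P phi M.
Proof. by move=> cM aM; exists M; split=> //; exact: contactomorphic_refl. Qed.

(** The initial stage of an isotopy is a symplectomorphism and agrees with [phi0] on the page.
    Working with it provides smoothness and boundary behaviour near the page for a map specified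
    only on it. *)
Lemma symp_isotopic_start (P : page R) phi0 phi1 : symp_isotopic R P phi0 phi1 ->
  exists psi, [/\ symplecto R P psi, forall x, Defs.pset R P x -> psi x = phi0 x &
                  symp_isotopic R P psi phi1].
Proof.
move=> [Phi [sm sy bU P0 P1]]; exists (fun x => Phi (0, x)); split=> //.
  by apply: sy; rewrite lexx ler01.
by exists Phi.
Qed.

(** [is_Aob] sees the monodromy only through an isotopy to the normalized [phi']. Composing stage by
    stage with an isotopy from [delta] to the identity gives one from the composite to the same
    [phi']; all other data are kept. *)
Lemma is_Aob_isotopic (M : cmanifold R) (P : page R) phi : is_Aob R M P phi ->
  exists phi0, [/\ symplecto R P phi0, forall x, Defs.pset R P x -> phi0 x = phi x &
    forall delta, symp_isotopic R P delta id ->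
      exists psi, [/\ symplecto R P psi, is_Aob R M P psi &
                      forall x, Defs.pset R P x -> psi x = delta (phi0 x)]].
Proof.
move=> [dM [phi' [h [c [k [e [Q [B [h1 [h2 [iso hh ck mt core]]]]]]]]]]].
have [phi0 [sy0 e0 iso0]] := symp_isotopic_start iso.
exists phi0; split=> // delta isod.
have [psi [sy ep isop]] := symp_isotopic_start (symp_isotopic_comp iso0 isod).
exists psi; split=> //; split=> //.
by exists phi', h, c, k, e, Q, B, h1, h2.
Qed.

End Aob.

(** * The page embedding, the spliced monodromy and the intertwining identity *)

Section Assembly.
Variables (R : realType) (n : nat).
Local Notation dot := (dotp R n.+1).
Local Notation dot2 := (dotp R n.+2).
Local Notation en := (enorm R n.+1).
Local Notation en2 := (enorm R n.+2).
Local Notation B := 'rV[R]_(n.+2 + n.+2).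
Local Notation E := 'rV[R]_(n.+3 + n.+3).
Local Notation D1 := (DTS R n.+1).
Local Notation D2 := (DTS R n.+2).
Local Notation profile := (smooth_near [set r : R | 0 <= r]).

(** The profile produced by [flatten]: $g(0)$ for $r^2\le 1/16$, and $g(r)$ for $r^2\ge 1/8$. *)
Definition flat_profile (g : R -> R) (r : R) : R := g ((1 - cutoff 16^-1 8^-1 (r ^+ 2)) * r).

(** The angle to be added to a twist of profile [g] to obtain profile [f], complete from $r^2=1/64$
    on, the least squared norm attained on the embedded page, and 0 up to $1/256$. *)
Definition splice (f g : R -> R) (r : R) : R := (1 - cutoff 256^-1 64^-1 (r ^+ 2)) * (f r - g r).

Let ltV (a b : nat) : (0 < a < b)%N -> (b%:R^-1 : R) < a%:R^-1.
Proof.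
move=> /andP[a0 ab]; rewrite ltf_pV2 ?posrE ?ltr0n ?ltr_nat//.
exact: leq_trans ab.
Qed.

Lemma profile_flat g : profile (g : R -> R^o) -> profile (flat_profile g : R -> R^o).
Proof.
move=> sg; apply: (@smooth_near_comp R R^o R^o R^o _ _ _ _ [set r : R | 0 <= r]
  (fun r => (1 - cutoff 16^-1 8^-1 (r ^+ 2)) * r) g) => //.
  move=> r /= r0; rewrite mulr_ge0// subr_ge0 cutoff_le1//.
  exact: (@ltV 8 16).
apply: smooth_nearT; have oT : open (setT : set R^o) by exact: openT.
have sid : smooth setT (fun r : R => r : R^o) by exact: smooth_id.
apply: (@smoothM R R^o) => //; apply: (@smoothB R R^o R^o) => //; first exact: smooth_cst.
apply: (@smooth_cutoff_comp R R^o _ _ _ _ (fun r => r ^+ 2)) => //; first exact: (@ltV 8 16).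
by apply: (@smooth_eq R R^o R^o _ (fun r => r * r)) => //; exact: (@smoothM R R^o).
Qed.

Lemma profile_splice f g : profile (f : R -> R^o) -> profile (g : R -> R^o) ->
  profile (splice f g : R -> R^o).
Proof.
move=> [U [oU rU sf]] [V [oV rV sg]]; exists (U `&` V); split; first exact: openI.
  by move=> r r0; split; [exact: rU|exact: rV].
have oI : open (U `&` V) by exact: openI.
have sid : smooth (U `&` V) (fun r : R => r : R^o) by exact: smooth_id.
apply: (@smoothM R R^o) => //.
  apply: (@smoothB R R^o R^o) => //; first exact: smooth_cst.
  apply: (@smooth_cutoff_comp R R^o _ _ _ _ (fun r => r ^+ 2)) => //; first exact: (@ltV 64 256).
  by apply: (@smooth_eq R R^o R^o _ (fun r => r * r)) => //; exact: (@smoothM R R^o).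
by apply: (@smoothB R R^o R^o) => //; [apply: smooth_subset sf|apply: smooth_subset sg] => r [].
Qed.

(** The argument is the squared norm $|Y|^2$. The plateau $1/8$ has square $1/64$, matching the
    threshold of [splice] and below the rigidity bound $1/40$ of [tube_rot_hyper]. *)
Definition lift_height (y : R) : R := 8^-1 * cutoff 64^-1 32^-1 y.

Definition page_embedding (z : B) : E := hyper (lift_height (dot (rsubmx z) (rsubmx z))) z.

Lemma lift_height0 y : 32^-1 <= y -> lift_height y = 0.
Proof. by move=> h; rewrite /lift_height cutoff0 ?mulr0. Qed.

Lemma lift_height_sqr y : lift_height y * lift_height y <= 64^-1.
Proof.
have lt : 64^-1 < 32^-1 :> R by exact: (@ltV 32 64).
have c0 := cutoff_ge0 y lt; have c1 := cutoff_le1 y lt.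
rewrite /lift_height mulrACA -invfM -natrM; rewrite ler_piMr//.
by rewrite -[leRHS]mulr1; exact: ler_pM.
Qed.

(** Either $y\le 1/64$ and the height is on its plateau, contributing $1/64$, or $y$ alone exceeds
    $1/64$. The lower bound keeps the image off the zero section, the upper one inside the flat part
    of the profile. *)
Lemma lift_height_bounds y : 0 <= y -> y < 32^-1 ->
  64^-1 <= lift_height y * lift_height y + y <= 16^-1.
Proof.
move=> y0 y32; apply/andP; split; last by have := lift_height_sqr y; lra.
have [y64|y64] := leP y 64^-1; last first.
  by apply: le_trans (ltW y64) _; rewrite lerDr -expr2 sqr_ge0.
rewrite /lift_height cutoff1 ?mulr1//; last exact: (@ltV 32 64).
by rewrite -invfM -natrM lerDl.
Qed.

Lemma dot_hyper v (z : B) : dot2 (rsubmx (hyper v z)) (rsubmx (hyper v z)) =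
  v * v + dot (rsubmx z) (rsubmx z).
Proof. by rewrite /hyper row_mxKr dot_ins. Qed.

Lemma hyper_on_TS v (z : B) : on_TS z -> on_TS (hyper v z).
Proof. by move=> [x1 xy]; rewrite /on_TS /hyper row_mxKl row_mxKr !dot_ins !mul0r x1 xy !add0r. Qed.

Lemma hyperZ c v (z : B) : c *: hyper v z = hyper (c * v) (c *: z).
Proof. by rewrite /hyper scale_row_mx lsubmxZ rsubmxZ -!insZ mulr0. Qed.

Lemma sigma_hyper0 t (z : B) : sigma R n.+2 t (hyper 0 z) = hyper 0 (sigma R n.+1 t z).
Proof.
have e : en2 (rsubmx (hyper 0 z)) = en (rsubmx z) by rewrite /enorm dot_hyper mul0r add0r.
have lh : lsubmx (hyper 0 z) = ins ord0 0 (lsubmx z) by exact: row_mxKl.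
have rh : rsubmx (hyper 0 z) = ins ord0 0 (rsubmx z) by exact: row_mxKr.
rewrite {1}/sigma e lh rh [RHS]/hyper lsubmx_sigma rsubmx_sigma.
by rewrite -!insZ -!insD !mulr0 addr0.
Qed.

Lemma page_embedding_mem z : D1 z -> D2 (page_embedding z).
Proof.
move=> /DTSP[Tz y1]; apply/DTSP; split; first exact: hyper_on_TS.
rewrite dot_hyper; set y := dot _ _ in y1 *.
have [y32|y32] := ltP y 32^-1; last by rewrite lift_height0// mul0r add0r.
have /andP[_ h] := lift_height_bounds (dot_ge0 _) y32.
by apply: le_trans h _; rewrite invf_le1 ?ler1n.
Qed.

Lemma smooth_page_embedding : smooth setT page_embedding.
Proof.
have oT : open (setT : set B) by exact: openT.
have [sl sr] := smooth_coords oT; have [_ _ sy] := smooth_dots oT.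
apply: smooth_row_mx => //; apply: smooth_ins => //; first exact: smooth_cst.
apply: smoothM => //; first exact: smooth_cst.
by apply: smooth_cutoff_comp => //; exact: (@ltV 32 64).
Qed.

(** The first base coordinate is constant on the image, so the derivative of the height is always
    paired with 0, whatever its value. *)
Lemma page_embedding_pullback X :
  pullback2 X page_embedding (fun _ => @omega R n.+2) (fun _ => @omega R n.+1).
Proof.
move=> z u v _ _ _.
have dh w : is_derive z w (fun z : B => lift_height (dot (rsubmx z) (rsubmx z)) : R^o)
    ('D_w (fun z : B => lift_height (dot (rsubmx z) (rsubmx z)) : R^o) z).
  apply: is_derive_differentiable; apply: (smooth_differentiable (@openT B)) => //.
  have [_ _ sy] := smooth_dots (@openT B); apply: smoothM; [exact: openT|exact: smooth_cst|].
  by apply: smooth_cutoff_comp => //; [exact: openT|exact: (@ltV 32 64)].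
have dE w : is_derive z w page_embedding (row_mx (ins ord0 0 (lsubmx w))
    (ins ord0 ('D_w (fun z : B => lift_height (dot (rsubmx z) (rsubmx z)) : R^o) z) (rsubmx w))).
  have [dl dr] := is_derive_coords z w.
  exact: (is_derive_row_mx (is_derive_ins ord0 (is_derive_cst_fun (0 : R^o) z w) dl)
            (is_derive_ins ord0 (dh w) dr)).
have [_ ->] := dE u; have [_ ->] := dE v.
move: ('D_u _ z) ('D_v _ z) => a b.
by rewrite /omega !row_mxKl !row_mxKr !dot_ins !mulr0 !add0r.
Qed.

(** For the boundary condition: where the height may be nonzero, both squared fibre norms are well
    below 1; elsewhere the embedding preserves the fibre norm. *)
Lemma page_embedding_proper :
  proper_symplectic_embedding R (DTS_page R n.+1) (DTS_page R n.+2) page_embedding.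
Proof.
split.
- split; first by apply: smooth_nearT; exact: smooth_page_embedding.
  exists (fun z : E => row_mx (del ord0 (lsubmx z)) (del ord0 (rsubmx z))); split.
    apply: smooth_nearT; have oT : open (setT : set E) by exact: openT.
    by have [sl sr] := smooth_coords oT; apply: smooth_row_mx => //; exact: smooth_del.
  by move=> z _; rewrite /page_embedding /hyper row_mxKl row_mxKr !insK hsubmxK.
- by move=> _ [z Dz <-]; exact: page_embedding_mem.
- move=> z Dz; rewrite /bd /= !boundary_DTS /= dot_hyper.
  set y := dot _ _; have y0 : 0 <= y by exact: dot_ge0.
  have [y32|y32] := ltP y 32^-1; last first.
    rewrite lift_height0// mul0r add0r; split=> -[_ ->]; split=> //.
    exact: page_embedding_mem.
  have /andP[_ h] := lift_height_bounds y0 y32.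
  have l16 : 16^-1 < 1 :> R by rewrite invf_lt1 ?ltr1n.
  have l32 : 32^-1 < 1 :> R by rewrite invf_lt1 ?ltr1n.
  by split=> -[_ e1]; exfalso; move: h y32 l16 l32; rewrite e1 => *; lra.
- move=> z u v Dz tu tv; rewrite /pomega !extd_lambda.
  exact: (@page_embedding_pullback D1 z u v Dz tu tv).
Qed.

Lemma twist_books_embed (k l : int) (tau_k : B -> B) (tau_l : E -> E) (M1 M2 : cmanifold R) :
  is_twist R n.+1 k tau_k -> is_twist R n.+2 l tau_l -> contact R M1 -> contact R M2 ->
  is_Aob R M1 (DTS_page R n.+1) tau_k -> is_Aob R M2 (DTS_page R n.+2) tau_l ->
  contact_open_book_embeds R M1 M2.
Proof.
move=> tk tl cM1 cM2 a1 a2.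
have [phi1 [sy1 e1 ext1]] := is_Aob_isotopic a1.
have [phi2 [sy2 e2 ext2]] := is_Aob_isotopic a2.
have [[s1 _] _ _ _] := sy1; have [[s2 _] _ _ _] := sy2.
have [g1 [p1 [tw1 pr1 g10]]] := is_twist_radial tk s1 e1.
have [g2 [p2 [tw2 pr2 g20]]] := is_twist_radial tl s2 e2.
have [delta [isod deltaE]] := flatten tw1 pr1 g10.
have [psi1 [sp1 ap1 psi1E]] := ext1 _ isod.
pose f := flat_profile g1; pose m := splice f g2.
have [_ _ _ _ [/andP[p10 p11] g1p]] := tw1; have [_ pE2 _ _ [/andP[p20 p21] g2p]] := tw2.
(* Beyond [p] both profiles vanish, and from $1/2$ on the flattening is inactive because $1/4\ge
   1/8$; hence [m] vanishes there. *)
pose p := Num.max (Num.max p1 p2) 2^-1.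
have p01 : 0 < p < 1.
  by rewrite !lt_max p10 /= !gt_max p11 p21 invf_lt1 ?ltr1n.
have m0 r : r * r <= 256^-1 -> m r = 0.
  by move=> h; rewrite /m /splice cutoff1 ?subrr ?mul0r// ?expr2//; exact: (@ltV 64 256).
have mp r : p <= r -> m r = 0.
  rewrite /p !ge_max => /andP[/andP[r1 r2] r3]; rewrite /m /splice g2p// /f /flat_profile.
  have r8 : 8^-1 <= r ^+ 2.
    apply: (@le_trans _ _ (2^-1 * 2^-1)).
      by rewrite -invfM -natrM ltW//; exact: (@ltV 4 8).
    by rewrite expr2; apply: ler_pM; rewrite // invr_ge0 ler0n.
  by rewrite [cutoff 16^-1 _ _]cutoff0// !subr0 mul1r g1p// mulr0.
have a256 : 0 < 256^-1 :> R by rewrite invr_gt0 ltr0n.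
have isom := sigma_family n.+1 a256 p01 (profile_splice (profile_flat pr1) pr2) m0 mp.
(* On the page, [psi2] applies [phi2], then $\sigma_m$, then the tube rotation by $k\pi$. The norm
   at which [m] is evaluated is unaffected by [phi2]. *)
have [psi2 [sp2 ap2 psi2E]] := ext2 _ (symp_isotopic_comp isom (tube_rot_isotopic n (k%:~R * pi : R))).
have [k1 ck1] := is_Aob_collar a1; have [k2 ck2] := is_Aob_collar a2.
exists (DTS_page R n.+1), (DTS_page R n.+2), psi1, psi2, page_embedding; split.
- by split; [exact: DTS_convex ck1|exact: DTS_convex ck2].
- by [].
- by split; exact: supports_is_Aob.
- exact: page_embedding_proper.
move=> z Dz; rewrite psi1E// psi2E; last exact: page_embedding_mem.
have Tz := DTS_on_TS Dz.
(* Outside a small tube of the zero section the composite is the twist with profile [f]. *)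
have spliceE w : D2 w -> 64^-1 <= dot2 (rsubmx w) (rsubmx w) ->
    sigma R n.+2 (m (en2 (rsubmx (phi2 w)))) (phi2 w) = sigma R n.+2 (f (en2 (rsubmx w))) w.
  move=> Dw w64; have Tw := DTS_on_TS Dw.
  have w0 : rsubmx w != 0 by rewrite -dot_gt0; apply: lt_le_trans w64; rewrite invr_gt0 ltr0n.
  rewrite pE2// (negbTE w0) enorm_sigma// sigmaD//.
  by rewrite /m /splice cutoff0 ?enorm_sqr// subr0 mul1r subrK.
have fk (r : R) : r ^+ 2 <= 16^-1 -> f r = k%:~R * pi.
  move=> h; rewrite /f /flat_profile cutoff1 ?subrr ?mul0r//; exact: (@ltV 8 16).
have DG := page_embedding_mem Dz.
set y := dot (rsubmx z) (rsubmx z); have y0 : 0 <= y by exact: dot_ge0.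
have yE : y = dot (rsubmx z) (rsubmx z) by [].
(* For $|Y|^2<1/32$ source and image both lie where the profile is the constant $k\pi$, so each
   twist is multiplication by $(-1)^k$ and only the sign of the height needs correction. *)
have [y32|y32] := ltP y 32^-1.
  have -> : delta (phi1 z) = (-1) ^ k *: z.
    rewrite deltaE//; case: ifP => // _; rewrite -/(flat_profile g1 _) -/f fk ?sigma_int//.
    by rewrite enorm_sqr -yE ltW// (lt_trans y32)//; exact: (@ltV 16 32).
  have /andP[h64 h16] := lift_height_bounds y0 y32.
  rewrite spliceE//; last by rewrite dot_hyper.
  rewrite fk; last by rewrite enorm_sqr dot_hyper.
  rewrite sigma_int {2}/page_embedding hyperZ tube_rot_hyper.
  - have kk : (-1) ^ k * (-1) ^ k = 1 :> R by rewrite -expfzMl mulrNN mul1r exp1rz.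
    rewrite mulrA kk mul1r /page_embedding; congr hyper.
    by rewrite rsubmxZ dotZl dotZr mulrA kk mul1r.
  - have kk : (-1) ^ k * (-1) ^ k = 1 :> R by rewrite -expfzMl mulrNN mul1r exp1rz.
    rewrite mulrACA kk mul1r; apply: le_lt_trans (lift_height_sqr _) _; exact: (@ltV 40 64).
  - have kk : (-1) ^ k * (-1) ^ k = 1 :> R by rewrite -expfzMl mulrNN mul1r exp1rz.
    by rewrite rsubmxZ dotZl dotZr mulrA kk mul1r -yE (lt_trans y32)//; exact: (@ltV 20 32).
have yn0 : rsubmx z != 0 by rewrite -dot_gt0; apply: lt_le_trans y32; rewrite invr_gt0 ltr0n.
(* For $|Y|^2\ge 1/32$ the height is 0, also after $\sigma$, which preserves $|Y|$. Both sides
   reduce to the same flow inside the equatorial bundle, where the tube rotation is the identity. *)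
have GE w : y <= dot (rsubmx w) (rsubmx w) -> page_embedding w = hyper 0 w.
  by move=> h; rewrite /page_embedding lift_height0//; exact: le_trans h.
rewrite spliceE//; last first.
  by rewrite GE// dot_hyper mul0r add0r -yE (le_trans _ y32)// ltW//; exact: (@ltV 32 64).
rewrite deltaE// (negbTE yn0) -/(flat_profile g1 _) -/f.
rewrite (GE z)// GE; last by rewrite (sigma_on_TS _ Tz yn0).2.
have -> : en2 (rsubmx (hyper 0 z)) = en (rsubmx z) by rewrite /enorm dot_hyper mul0r add0r.
by rewrite sigma_hyper0 tube_rot_hyper0.
Qed.

End Assembly.

Theorem theorem1p1 (R : realType) (n : nat) (hn : (1 <= n)%N) (k l : int)
    (tau_k : 'rV[R]_(n.+1 + n.+1) -> 'rV[R]_(n.+1 + n.+1))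
    (tau_l : 'rV[R]_(n.+2 + n.+2) -> 'rV[R]_(n.+2 + n.+2))
    (htk : is_twist R n k tau_k) (htl : is_twist R n.+1 l tau_l)
    (M1 M2 : cmanifold R) (hM1 : contact R M1) (hM2 : contact R M2)
    (h1 : is_Aob R M1 (DTS_page R n) tau_k)
    (h2 : is_Aob R M2 (DTS_page R n.+1) tau_l) :
  contact_open_book_embeds R M1 M2.
(* The geometry is developed for disk bundles of $S^{n+1}$ with $n\ge 0$; the assumption $1\le n$
   allows the source sphere to be reindexed accordingly. *)
Proof. by case: n hn tau_k tau_l htk htl h1 h2 => // n _ tau_k tau_l *; exact: (@twist_books_embed R n k l tau_k tau_l). Qed.
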